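(* Let $q>0$, $b\neq 0$, $c_1>0$ and $u_0\in W$. Suppose that the sign of $b$ is known (so that $\operatorname{sgn}(b)$ may be used in the observer). Consider the plant with the controller $u(t)=\zeta(t)u_0(t)$, $$w_t(x,t)=w_{xx}(x,t),\quad w_x(0,t)=-q\,w(0,t),\quad w_x(1,t)=b\,\zeta(t)u_0(t),\qquad x\in(0,1),\ t>0,$$ together with the observer $$\begin{cases}\hat w_t(x,t)=\hat w_{xx}(x,t),\\ \hat w_x(0,t)=-q\,w(0,t),\quad \hat w_x(1,t)=u_0(t)+c_1[w(1,t)-\hat w(1,t)],\\ \dot\zeta(t)=-\operatorname{sgn}(b)\,[w(1,t)-\hat w(1,t)]\,u_0(t).\end{cases}$$ Then the observer is well-posed: for any initial state $(w(\cdot,0),\hat w(\cdot,0),\zeta(0))\in \mathcal H^2\times\mathbb R$, the observer admits a unique (weak) solution $(\hat w(\cdot,t),\zeta(t))\in C(0,\infty;\mathcal H\times\mathbb R)$, and there is a constant $\zeta_0\in\mathbb R$ (which may not be $\frac1b$) such that $$|\zeta(t)-\zeta_0|+\|w(\cdot,t)-\hat w(\cdot,t)\|_{\mathcal H}\to 0\quad\text{as } t\to+\infty.$$ If, in addition, $u_0$ satisfies the persistent excitation condition: there exists $\tau>0$ such that $$\lim_{t\to+\infty}\int_t^{t+\tau}u_0(s)\,ds\neq 0,$$ then $\zeta(t)\to\frac1b$ as $t\to+\infty$.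
   Context: $\mathcal H=L^2(0,1)$ (real-valued) with inner product $\langle f,g\rangle_{\mathcal H}=\int_0^1 f(x)g(x)\,dx$. $W=\{f+g : f\in L^\infty(0,\infty),\ g\in L^2(0,\infty)\}$. $C(0,\infty;X)$ denotes the continuous functions $[0,\infty)\to X$. The unknown control coefficient is $b$; the observer is coupled with the plant, since the plant is driven by $u=\zeta u_0$ and the observer by $w(0,t),w(1,t)$. Weak solution: a heat equation $v_t=v_{xx}$ on $(0,1)$ with $v_x(0,t)=g_0(t)$, $v_x(1,t)=g_1(t)$ is understood weakly: $v\in C([0,\infty);L^2(0,1))\cap L^2(0,T;H^1(0,1))$ for every $T>0$, and for all $\varphi\in H^1(0,1)$ and $t\ge 0$, $$\langle v(\cdot,t),\varphi\rangle_{\mathcal H}+\int_0^t\langle v_x(\cdot,s),\varphi_x\rangle_{\mathcal H}ds=\langle v(\cdot,0),\varphi\rangle_{\mathcal H}+\int_0^t[g_1(s)\varphi(1)-g_0(s)\varphi(0)]ds,$$ where $g_0,g_1$ may involve traces of the unknowns; the ODE is understood in time-integrated form. The condition ''$\lim\neq0$'' is understood as: the integral $\int_t^{t+\tau}u_0(s)\,ds$ does not converge to $0$ as $t\to+\infty$. *)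

(* Defs.v *)
From HB Require Import structures.
From mathcomp Require Import all_boot all_order all_algebra.
From mathcomp Require Import all_classical all_reals all_analysis.

Set Implicit Arguments.
Unset Strict Implicit.
Unset Printing Implicit Defensive.

Import Order.TTheory GRing.Theory Num.Theory.
Import numFieldNormedType.Exports.

Local Open Scope classical_set_scope.
Local Open Scope ring_scope.

Definition lebesgue_on (R : realType) (i : interval R) :
    set (measurableTypeR R) -> \bar R :=
  mrestr (@lebesgue_measure R) (measurable_itv i).

HB.instance Definition _ (R : realType) (i : interval R) :=
  Measure.on (@lebesgue_on R i).

(** [L2 R] is the real space L^2(0,1).  Its elements are functions on the whole
    line, of which only the restriction to (0,1) matters: equality in L^2(0,1)
    is equality [%[ae lebesgue_on `]0, 1[]], not Leibniz equality. *)
Notation L2 R := (LfunType (@lebesgue_on R `]0, 1[) (lee1n 2)).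

Notation "f =L2 g" :=
  ((f : _ -> _) = (g : _ -> _) %[ae @lebesgue_on _ `]0, 1[])
  (at level 70, no associativity) : type_scope.

Definition inner (R : realType) (f g : L2 R) : R :=
  \int[@lebesgue_on R `]0, 1[]_x (f x * g x).

Definition L2norm (R : realType) (f : L2 R) : R :=
  fine (Lnorm (@lebesgue_on R `]0, 1[) 2%:E (EFin \o f)).

(** The absolutely continuous function with value [a] at [0] and derivative
    [g]. *)
Definition primitive (R : realType) (a : R) (g : L2 R) (x : R) : R :=
  a + \int[@lebesgue_measure R]_(y in `[0, x]) g y.

(** H^1(0,1) is the set of (classes of) absolutely continuous functions on
    [0,1] whose derivative is in L^2(0,1). *)
Definition is_H1 (R : realType) (f : L2 R) : Prop :=
  exists a g, f =L2 primitive a g.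

Definition H1data (R : realType) (f : L2 R) : R * L2 R :=
  xget (0, 0) [set ag | f =L2 primitive ag.1 ag.2].

(** The weak derivative and the point values on [0,1] of the continuous
    representative of [f]; meaningful when [is_H1 f], and then independent of
    the choice made by [xget] (up to a.e. equality for [deriv1]). *)
Definition deriv1 (R : realType) (f : L2 R) : L2 R := (H1data f).2.

Definition trace (R : realType) (f : L2 R) (x : R) : R :=
  primitive (H1data f).1 (H1data f).2 x.

Definition H1norm (R : realType) (f : L2 R) : R :=
  Num.sqrt (L2norm f ^+ 2 + L2norm (deriv1 f) ^+ 2).

(** The Bochner space L^2(0,T;H^1(0,1)): [s n] are simple functions with values
    in H^1(0,1), converging to [v] a.e. on (0,T) for the norm of H^1(0,1). *)
Definition in_L2H1 (R : realType) (T : R) (v : R -> L2 R) : Prop :=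
  [/\ {ae @lebesgue_measure R, forall t, 0 < t < T -> is_H1 (v t)},
      exists s : nat -> R -> L2 R,
        [/\ forall n, finite_set (range (s n)),
            forall n h, measurable (s n @^-1` [set h] : set (measurableTypeR R)),
            forall n t, is_H1 (s n t)
          & {ae @lebesgue_measure R, forall t, 0 < t < T ->
               (fun n => H1norm (s n t - v t)) @ \oo --> (0 : R)}]
    & (\int[@lebesgue_measure R]_(t in `]0%R, T[) (H1norm (v t) ^+ 2)%:E
         < +oo)%E].

Definition in_CL2 (R : realType) (v : R -> L2 R) : Prop :=
  forall t, 0 <= t ->
    L2norm (v s - v t) @[s --> within (fun s => 0 <= s) (nbhs t)] --> (0 : R).

Definition locally_integrable_pos (R : realType) (g : R -> R) : Prop :=
  forall T, 0 <= T -> (@lebesgue_measure R).-integrable `[0, T] (EFin \o g).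

(** Weak solutions of v_t = v_xx, v_x(0,t) = g0(t), v_x(1,t) = g1(t).  The
    values of [v] at negative times are irrelevant.  Local integrability of
    the boundary data is what gives a meaning to the right-hand side. *)
Definition weak_heat (R : realType) (g0 g1 : R -> R) (v : R -> L2 R) : Prop :=
  [/\ in_CL2 v,
      forall T, 0 < T -> in_L2H1 T v,
      locally_integrable_pos g0,
      locally_integrable_pos g1
    & forall phi : L2 R, is_H1 phi -> forall t, 0 <= t ->
        inner (v t) phi
          + \int[@lebesgue_measure R]_(s in `[0, t])
              inner (deriv1 (v s)) (deriv1 phi)
        = inner (v 0) phi
          + \int[@lebesgue_measure R]_(s in `[0, t])
              (g1 s * trace phi 1 - g0 s * trace phi 0)].

(** The scalar equation z' = h in time-integrated form. *)
Definition integrated_ode (R : realType) (h z : R -> R) : Prop :=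
  [/\ {within `[0, +oo[, continuous z},
      locally_integrable_pos h
    & forall t, 0 <= t ->
        z t = z 0 + \int[@lebesgue_measure R]_(s in `[0, t]) h s].

(** W = L^oo(0,oo) + L^2(0,oo). *)
Definition in_W (R : realType) (u : R -> R) : Prop :=
  exists f g : R -> R,
    [/\ f \in Lfun (@lebesgue_on R `]0, +oo[) +oo%E,
        g \in Lfun (@lebesgue_on R `]0, +oo[) 2%:E
      & forall t, 0 < t -> u t = f t + g t].

(** The plant with controller u = zeta u0, coupled with the observer
    (what, zeta). *)
Definition closed_loop (R : realType) (q b c1 : R) (u0 : R -> R)
    (w what : R -> L2 R) (zeta : R -> R) : Prop :=
  [/\ weak_heat (fun t => - q * trace (w t) 0)
                (fun t => b * zeta t * u0 t) w,
      weak_heat (fun t => - q * trace (w t) 0)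
                (fun t => u0 t + c1 * (trace (w t) 1 - trace (what t) 1)) what
    & integrated_ode
        (fun t => - Num.sg b * (trace (w t) 1 - trace (what t) 1) * u0 t) zeta].

Definition initial_state (R : realType) (w0 what0 : L2 R) (zeta0 : R)
    (w what : R -> L2 R) (zeta : R -> R) : Prop :=
  [/\ w 0 =L2 w0, what 0 =L2 what0 & zeta 0 = zeta0].

Definition persistently_exciting (R : realType) (u : R -> R) : Prop :=
  exists2 tau : R, 0 < tau &
    ~ (\int[@lebesgue_measure R]_(s in `[t, t + tau]) u s @[t --> +oo]
         --> (0 : R)).

(* Main.v *)
(** Expand in the Neumann eigenfunctions [cos (n pi x)]: a weak solution of the
    heat equation is the same thing as a sequence of scalar equations
    [a_n' = - lam_n a_n + g1 eps1_n - g0 eps0_n] with square-summable data.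
    Multiplying by a weight [W] with [W' <= - 2 k^2 (1 + u0^2) W], the boundary
    traces are bounded in the weighted space [L^2(W dt)] by [O(1/k)] times the
    boundary data, since [sum_n 1 / (lam_n + k^2) = O(1/k)].  For [k] large, the
    map sending [w(1) - what(1)] to the trace of the error that it generates,
    and then the map sending [w(0)] to the trace of the plant, are contractions:
    this gives existence and uniqueness.

    With [z = b zeta - 1] and [e = w - what], the function
    [|e|^2 + z^2 / |b|] decreases at the rate [2 |e_x|^2 + 2 c1 e(1)^2], which
    controls [|e|^2] by Poincare's inequality, while [u0] has uniformly bounded
    energy on unit intervals; hence [e -> 0], [z^2] converges, and so does [z] by
    continuity.  The mean of [e] satisfies [c' = u0 z - c1 e(1)], so that
    the integrals of [u0] over [[t, t + tau]] tend to [0] unless [z -> 0]. *)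

Require Import Defs.
From mathcomp Require Import all_boot all_order all_algebra.
From mathcomp Require Import all_classical all_reals all_analysis.
From mathcomp Require Import measurable_realfun ring lra.

Import Order.TTheory GRing.Theory Num.Theory.
Import numFieldNormedType.Exports.
Import HBNNSimple.

Set Implicit Arguments.
Unset Strict Implicit.
Unset Printing Implicit Defensive.

Local Open Scope classical_set_scope.
Local Open Scope ring_scope.

(** A weak solution lies in [H^1] only at almost every time, so the boundary values that the loop
    feeds back are known only almost everywhere. The fixed points are therefore sought among the
    traces, as locally square-integrable functions of [t], and not among the states: changing a
    trace on a null set alters neither the states nor [zeta] at any time.

    The term [u0^2] in the decay rate of [W] answers the possible unboundedness of [u0]: the
    boundary condition contains [zeta u0], and only a decay at rate [u0^2] absorbs the square of
    this product. Since [W] stays positive on every [[0, T]], a single contraction covers all times,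
    without restarting on short intervals.

    The gain [1/k] occurs twice, once from boundary data to state and once from state to trace; this
    is why the thresholds [1024 (b^2 + c1^2)] and [512 q^2] are compared with [k^2].

    The two contractions can be used one after the other because [- q w(0,t)] enters the plant and
    the observer alike: it cancels in the error, whose equation then closes on the mismatch
    [w(1) - what(1)] alone. *)

Lemma sqrD_le (R : realFieldType) (a b : R) :
  (a + b) ^+ 2 <= 2 * a ^+ 2 + 2 * b ^+ 2.
Proof. by have := sqr_ge0 (a - b); nra. Qed.

Lemma Rcvg_unique (R : realType) (T : Type) (F : set_system T)
    {FF : ProperFilter F} (f : T -> R) (a b : R) :
  f x @[x --> F] --> a -> f x @[x --> F] --> b -> a = b.
Proof. by move=> /(cvg_lim (@Rhausdorff R)) <- /(cvg_lim (@Rhausdorff R)) <-. Qed.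

Lemma cvg_sqr0 (R : realType) (T : Type) (F : set_system T) {FF : Filter F} (f : T -> R) :
  f x ^+ 2 @[x --> F] --> (0 : R) -> f x @[x --> F] --> (0 : R).
Proof.
move=> /cvgrPdist_lt h; apply/cvgrPdist_lt => e e0.
have := h _ (exprn_gt0 2 e0); apply: filterS => x.
by rewrite !sub0r !normrN normrX ltr_pXn2r// ?nnegrE ?ltW.
Qed.

(** * Integration *)

Section integration.
Context d (T : measurableType d) (R : realType).
Variable mu : {measure set T -> \bar R}.
Implicit Types (D : set T) (f g : T -> R).

(** No measurability is required: the library integral of a nonnegative function
    is the supremum of the integrals of the simple functions below it. *)
Lemma ae_eq_integral_nomeas D (f g : T -> \bar R) :
  {ae mu, forall x, D x -> f x = g x} ->
  (\int[mu]_(x in D) f x = \int[mu]_(x in D) g x)%E.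
Proof.
have le_sup (u v : T -> \bar R) : {ae mu, forall x, u x = v x} ->
    (forall x, (0 <= v x)%E) ->
    (ereal_sup [set sintegral mu h |
       h in [set h : {nnsfun T >-> R} | forall x, ((h x)%:E <= u x)%E]]
     <= ereal_sup [set sintegral mu h |
       h in [set h : {nnsfun T >-> R} | forall x, ((h x)%:E <= v x)%E]])%E.
  move=> [N [mN N0 sN]] v0; apply: ge_ereal_sup => /= _ [h hu <-].
  pose h' := proj_nnsfun h (measurableC mN).
  have -> : sintegral mu h = sintegral mu h'.
    rewrite -!integralT_nnsfun.
    apply: ae_eq_integral => //; try exact/measurable_EFinP.
    exists N; split => // x hh; apply: contrapT => Nx.
    by apply: hh => _; rewrite /h' /= mindicE mem_set ?mulr1.
  apply: ereal_sup_ubound; exists h' => // x /=.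
  have [Nx|Nx] := pselect (N x).
    by rewrite mindicE memNset ?mulr0//= => /(_ Nx).
  rewrite mindicE mem_set// mulr1.
  suff <- : u x = v x by exact: hu.
  by apply: contrapT => uv; apply/Nx/sN.
have eq_sup (u v : T -> \bar R) : (forall x, (0 <= u x)%E) ->
    (forall x, (0 <= v x)%E) -> {ae mu, forall x, u x = v x} ->
    (ereal_sup [set sintegral mu h |
       h in [set h : {nnsfun T >-> R} | forall x, ((h x)%:E <= u x)%E]]
     = ereal_sup [set sintegral mu h |
       h in [set h : {nnsfun T >-> R} | forall x, ((h x)%:E <= v x)%E]])%E.
  move=> u0 v0 uv; apply/eqP; rewrite eq_le; apply/andP; split.
    exact: le_sup.
  by apply: le_sup => //; apply: filterS uv => x ->.
move=> fg; rewrite /integral; congr (_ - _)%E; apply: eq_sup => //;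
  by apply: filterS fg => x fgx;
    rewrite ?funeposE ?funenegE /patch; case: ifPn => // /set_mem /fgx ->.
Qed.

Lemma ae_eq_Rintegral D f g :
  {ae mu, forall x, D x -> f x = g x} ->
  \int[mu]_(x in D) f x = \int[mu]_(x in D) g x.
Proof.
move=> fg; rewrite /Rintegral (@ae_eq_integral_nomeas _ _ (EFin \o g))//.
by apply: filterS fg => x h /h /= ->.
Qed.

Lemma integrable_le D f g : measurable D -> measurable_fun D f ->
  (forall x, D x -> `|f x| <= g x) ->
  mu.-integrable D (EFin \o g) -> mu.-integrable D (EFin \o f).
Proof.
move=> mD mf fg; apply: le_integrable => //; first exact/measurable_EFinP.
by move=> x Dx /=; rewrite lee_fin (le_trans (fg x Dx))// ler_norm.
Qed.

Lemma integrable_mf D f : mu.-integrable D (EFin \o f) -> measurable_fun D f.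
Proof. by move=> /measurable_int/measurable_EFinP. Qed.

Lemma integrableDr D f g : measurable D -> mu.-integrable D (EFin \o f) ->
  mu.-integrable D (EFin \o g) -> mu.-integrable D (EFin \o (fun x => f x + g x)).
Proof. by move=> mD f1 g1; have := integrableD mD f1 g1. Qed.

Lemma integrableBr D f g : measurable D -> mu.-integrable D (EFin \o f) ->
  mu.-integrable D (EFin \o g) -> mu.-integrable D (EFin \o (fun x => f x - g x)).
Proof. by move=> mD f1 g1; have := integrableB mD f1 g1. Qed.

Lemma integrableZr D k f : measurable D -> mu.-integrable D (EFin \o f) ->
  mu.-integrable D (EFin \o (fun x => k * f x)).
Proof. by move=> mD f1; have := integrableZl mD k f1. Qed.

Lemma integrable_sumr D (I : Type) (s : seq I) (f : I -> T -> R) :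
  measurable D -> (forall i, mu.-integrable D (EFin \o f i)) ->
  mu.-integrable D (EFin \o (fun x => \sum_(i <- s) f i x)).
Proof.
move=> mD f1; elim: s => [|i s ih].
  apply: (@eq_integrable _ _ _ _ _ mD (cst 0%E)); last exact: integrable0.
  by move=> x _ /=; rewrite big_nil.
apply: (@eq_integrable _ _ _ _ _ mD
  (EFin \o (fun x => f i x + \sum_(i <- s) f i x))); last exact: integrableDr.
by move=> x _ /=; rewrite big_cons.
Qed.

Lemma Rintegral_sum D (I : Type) (s : seq I) (f : I -> T -> R) :
  measurable D -> (forall i, mu.-integrable D (EFin \o f i)) ->
  \int[mu]_(x in D) (\sum_(i <- s) f i x) = \sum_(i <- s) \int[mu]_(x in D) f i x.
Proof.
move=> mD f1; elim: s => [|i s ih].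
  by rewrite big_nil /Rintegral integral0_eq// => x _; rewrite big_nil.
rewrite big_cons -ih -RintegralD//; last exact: integrable_sumr.
by apply: eq_Rintegral => x _; rewrite big_cons.
Qed.

Lemma RintegralE D f : measurable D -> mu.-integrable D (EFin \o f) ->
  (\int[mu]_(x in D) (f x)%:E = (\int[mu]_(x in D) f x)%:E)%E.
Proof. by move=> mD f1; rewrite /Rintegral fineK// integrable_fin_num. Qed.

Lemma integrable_Rlty D f : measurable D -> measurable_fun D f ->
  (forall x, D x -> 0 <= f x) -> (\int[mu]_(x in D) (f x)%:E < +oo)%E ->
  mu.-integrable D (EFin \o f).
Proof.
move=> mD mf f0 foo; apply/integrableP; split; first exact/measurable_EFinP.
rewrite (le_lt_trans _ foo)//; rewrite le_eqVlt; apply/orP; left; apply/eqP.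
by apply: eq_integral => x /set_mem Dx /=; rewrite ger0_norm// f0.
Qed.

Lemma ae_imply1 (P Q : T -> Prop) : (forall x, P x -> Q x) ->
  {ae mu, forall x, P x} -> {ae mu, forall x, Q x}.
Proof. by move=> PQ; apply: filterS. Qed.

Lemma ae_imply2 (P Q S : T -> Prop) : (forall x, P x -> Q x -> S x) ->
  {ae mu, forall x, P x} -> {ae mu, forall x, Q x} -> {ae mu, forall x, S x}.
Proof. by move=> PQ; apply: filterS2. Qed.

(** Monotone convergence with a real-valued limit: the bound [C] makes the extended limit
    integrable, hence finite almost everywhere, so that [fine] changes it only on a null set. *)
Lemma levi D (P : nat -> T -> R) (C : R) : measurable D ->
  (forall n, mu.-integrable D (EFin \o P n)) ->
  (forall n x, D x -> 0 <= P n x) ->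
  (forall n x, D x -> P n x <= P n.+1 x) ->
  (forall n, \int[mu]_(x in D) P n x <= C) ->
  exists h : T -> R, [/\ mu.-integrable D (EFin \o h),
    forall x, D x -> 0 <= h x,
    {ae mu, forall x, D x -> P n x @[n --> \oo] --> h x},
    {ae mu, forall x, D x -> forall n, P n x <= h x}
    & \int[mu]_(x in D) h x <= C].
Proof.
move=> mD P1 P0 Pnd PC.
pose H x := limn (fun n => (P n x)%:E).
have ndP x : D x -> nondecreasing_seq (fun n => (P n x)%:E).
  by move=> Dx; apply/nondecreasing_seqP => n; rewrite lee_fin Pnd.
have mP n : measurable_fun D (EFin \o P n) by exact: measurable_int (P1 n).
have cvP x : D x -> (P n x)%:E @[n --> \oo] --> H x.
  by move=> Dx; apply: ereal_nondecreasing_is_cvgn; exact: ndP.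
have mH : measurable_fun D H by apply: (emeasurable_fun_cvg _ _ mP) => x Dx; exact: cvP.
have H0 x : D x -> (0 <= H x)%E.
  by move=> Dx; apply: lime_ge; [exact: cvP|apply: nearW => n; rewrite lee_fin P0].
have IH : (\int[mu]_(x in D) H x <= C%:E)%E.
  have := @cvg_monotone_convergence _ _ _ mu D mD (fun n => EFin \o P n) mP
    (fun n x Dx => P0 n x Dx) (fun x Dx => ndP x Dx).
  move=> cvI; rewrite -(cvg_lim _ cvI)//; apply: lime_le.
    by apply/cvg_ex; eexists; exact: cvI.
  by apply: nearW => n /=; rewrite RintegralE// lee_fin.
have H1 : mu.-integrable D H.
  apply/integrableP; split => //; rewrite (@le_lt_trans _ _ C%:E)// ?ltry//.
  rewrite (le_trans _ IH)// le_eqVlt; apply/orP; left; apply/eqP.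
  by apply: eq_integral => x /set_mem Dx; rewrite gee0_abs// H0.
have Hfin := integrable_ae mD H1.
pose h := fun x => fine (H x).
have hH : {ae mu, forall x, D x -> (h x)%:E = H x}.
  by apply: ae_imply1 Hfin => x hx /hx ?; rewrite fineK.
have mh : measurable_fun D h by exact: measurableT_comp.
have h0 x : D x -> 0 <= h x by move=> Dx; rewrite fine_ge0// H0.
have Ih : (\int[mu]_(x in D) (h x)%:E = \int[mu]_(x in D) H x)%E.
  exact: ae_eq_integral_nomeas.
have h1 : mu.-integrable D (EFin \o h).
  by apply: integrable_Rlty => //; rewrite Ih (le_lt_trans IH)// ltry.
have cvh : {ae mu, forall x, D x -> P n x @[n --> \oo] --> h x}.
  apply: ae_imply1 hH => x hx Dx.
  have /fine_cvg : (P n x)%:E @[n --> \oo] --> (h x)%:E by rewrite hx//; exact: cvP.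
  exact.
exists h; split => //.
  apply: ae_imply1 cvh => x hx Dx n; have cv := hx Dx.
  rewrite -(cvg_lim _ cv)//; apply: nondecreasing_cvgn_le => //.
    by apply/nondecreasing_seqP => k; exact: Pnd.
  by apply/cvg_ex; eexists; exact: cv.
by rewrite -lee_fin -RintegralE// Ih.
Qed.

(** The limit [f] is not assumed measurable. It agrees almost everywhere with the upper limit of the
    [P n], which is, and the integral does not see the difference. *)
Lemma Rdominated D (P : nat -> T -> R) f g : measurable D ->
  (forall n, measurable_fun D (P n)) ->
  mu.-integrable D (EFin \o g) ->
  {ae mu, forall x, D x -> P n x @[n --> \oo] --> f x} ->
  {ae mu, forall x, D x -> forall n, `|P n x| <= g x} ->
  \int[mu]_(x in D) P n x @[n --> \oo] --> \int[mu]_(x in D) f x.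
Proof.
move=> mD mP g1 cvP Pg.
pose F x := fine (limn_esup (fun n => (P n x)%:E)).
have mF : measurable_fun D F.
  by apply: measurableT_comp => //; apply: measurable_fun_limn_esup => n;
     exact/measurable_EFinP.
have fF : {ae mu, forall x, D x -> f x = F x}.
  apply: ae_imply1 cvP => x cv Dx; rewrite /F.
  have cvE : (P n x)%:E @[n --> \oo] --> (f x)%:E by apply: cvg_EFin; [exact: nearW|exact: cv].
  by rewrite is_cvg_limn_esupE ?(cvg_lim _ cvE)//; apply/cvg_ex; eexists; exact: cvE.
rewrite (ae_eq_Rintegral fF).
have mPE n : measurable_fun D (EFin \o P n) by exact/measurable_EFinP.
have mFE : measurable_fun D (EFin \o F) by exact/measurable_EFinP.
have cvF : {ae mu, forall x, D x -> (fun n => (EFin \o P n) x) @ \oo --> (EFin \o F) x}.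
  apply: (ae_imply2 _ cvP fF) => x cv fx Dx; rewrite /= -fx//.
  by apply: cvg_EFin; [exact: nearW|exact: cv].
have PgE : {ae mu, forall x n, D x -> (`|(EFin \o P n) x| <= (EFin \o g) x)%E}.
  by apply: ae_imply1 Pg => x h n Dx; rewrite /= lee_fin; exact: h.
have [F1 _ cvI] := dominated_convergence mD mPE mFE cvF g1 PgE.
rewrite /Rintegral; apply: fine_cvg; rewrite fineK ?integrable_fin_num//.
Qed.

Lemma Rdominated_integrable D (P : nat -> T -> R) f g : measurable D ->
  (forall n, measurable_fun D (P n)) -> measurable_fun D f ->
  mu.-integrable D (EFin \o g) ->
  {ae mu, forall x, D x -> P n x @[n --> \oo] --> f x} ->
  {ae mu, forall x, D x -> forall n, `|P n x| <= g x} ->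
  mu.-integrable D (EFin \o f).
Proof.
move=> mD mP mf g1 cvP Pg.
have mPE n : measurable_fun D (EFin \o P n) by exact/measurable_EFinP.
have mFE : measurable_fun D (EFin \o f) by exact/measurable_EFinP.
have cvF : {ae mu, forall x, D x -> (fun n => (EFin \o P n) x) @ \oo --> (EFin \o f) x}.
  apply: ae_imply1 cvP => x cv Dx.
  by apply: cvg_EFin; [exact: nearW|exact: cv].
have PgE : {ae mu, forall x n, D x -> (`|(EFin \o P n) x| <= (EFin \o g) x)%E}.
  by apply: ae_imply1 Pg => x h n Dx; rewrite /= lee_fin; exact: h.
by have [] := dominated_convergence mD mPE mFE cvF g1 PgE.
Qed.

Lemma ae_mrestr D (mD : measurable D) (P : T -> Prop) :
  {ae mrestr mu mD, forall x, P x} <-> {ae mu, forall x, D x -> P x}.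
Proof.
split => -[N [mN N0 sN]].
  exists (N `&` D); split => //; first exact: measurableI.
  by move=> x /= /not_implyP[Dx nPx]; split => //; exact: sN.
exists (N `|` ~` D); split.
- by apply: measurableU => //; exact: measurableC.
- rewrite /mrestr/= setIUl setICl setU0; apply/eqP; rewrite -measure_le0 -N0.
  by apply: le_measure; rewrite ?inE//; exact: measurableI.
- move=> x /= nPx; have [Dx|] := pselect (D x); last by right.
  by left; apply: sN => /=; exact/not_implyP.
Qed.

Definition sqint D f :=
  measurable_fun D f /\ mu.-integrable D (EFin \o (fun x => f x ^+ 2)).

Lemma sqintS D D' f : measurable D -> measurable D' -> D' `<=` D ->
  sqint D f -> sqint D' f.
Proof.
move=> mD mD' DD' [mf f2]; split; first exact: measurable_funS mf.
exact: integrableS f2.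
Qed.

Lemma sqint_le D f g : measurable D -> measurable_fun D f ->
  (forall x, D x -> `|f x| <= `|g x|) -> sqint D g -> sqint D f.
Proof.
move=> mD mf fg [mg g2]; split => //; apply: integrable_le g2 => //.
  exact: measurable_funX.
by move=> x Dx /=; rewrite normrX -[leRHS]real_normK ?num_real// lerXn2r ?nnegrE ?fg.
Qed.

Lemma sqint_mul D f g : measurable D -> sqint D f -> sqint D g ->
  mu.-integrable D (EFin \o (fun x => f x * g x)).
Proof.
move=> mD [mf f2] [mg g2].
apply: (@integrable_le _ _ (fun x => f x ^+ 2 + g x ^+ 2)) => //.
- exact: measurable_funM.
- move=> x Dx; rewrite normrM -[in leRHS](real_normK (num_real (f x))).
  by rewrite -[in leRHS](real_normK (num_real (g x))); nra.
- exact: integrableDr.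
Qed.

Lemma sqintD D f g : measurable D -> sqint D f -> sqint D g ->
  sqint D (fun x => f x + g x).
Proof.
move=> mD [mf f2] [mg g2]; split; first exact: measurable_funD.
apply: (@integrable_le _ _ (fun x => 2 * (f x ^+ 2) + 2 * (g x ^+ 2))) => //.
- by apply: measurable_funX; exact: measurable_funD.
- by move=> x Dx; rewrite ger0_norm ?sqr_ge0//; exact: sqrD_le.
- by apply: integrableDr => //; exact: integrableZr.
Qed.

Lemma sqintZ D k f : measurable D -> sqint D f -> sqint D (fun x => k * f x).
Proof.
move=> mD [mf f2]; split; first exact: measurable_funM.
have -> : (fun x => (k * f x) ^+ 2) = (fun x => k ^+ 2 * (f x ^+ 2)).
  by apply/funext => x; rewrite exprMn.
exact: integrableZr.
Qed.

Lemma sqintB D f g : measurable D -> sqint D f -> sqint D g ->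
  sqint D (fun x => f x - g x).
Proof.
move=> mD f2 g2; have -> : (fun x => f x - g x) = (fun x => f x + -1 * g x).
  by apply/funext => x; rewrite mulN1r.
by apply: sqintD => //; exact: sqintZ.
Qed.

Lemma sqint0 D : measurable D -> sqint D (fun=> 0).
Proof.
move=> mD; split => //; apply: (@eq_integrable _ _ _ _ _ mD (cst 0%E)).
  by move=> x _ /=; rewrite expr0n.
exact: integrable0.
Qed.

Lemma sqint_sum D (I : Type) (s : seq I) (f : I -> T -> R) : measurable D ->
  (forall i, sqint D (f i)) -> sqint D (fun x => \sum_(i <- s) f i x).
Proof.
move=> mD f2; elim: s => [|i s ih].
  rewrite (_ : (fun x => _) = fun=> 0); first exact: sqint0.
  by apply/funext => x; rewrite big_nil.
rewrite (_ : (fun x => _) = fun x => f i x + \sum_(i <- s) f i x).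
  exact: sqintD.
by apply/funext => x; rewrite big_cons.
Qed.

Lemma sqint_bounded D f g M : measurable D -> sqint D f -> measurable_fun D g ->
  (forall x, D x -> `|g x| <= M) -> sqint D (fun x => g x * f x).
Proof.
move=> mD [mf f2] mg gM; apply: (@sqint_le _ _ (fun x => M * f x)) => //.
- exact: measurable_funM.
- move=> x Dx; rewrite !normrM ler_wpM2r//.
  by rewrite (le_trans (gM x Dx))// ler_norm.
- exact: sqintZ.
Qed.

Lemma integrable_bounded D f g M : measurable D ->
  mu.-integrable D (EFin \o f) -> measurable_fun D g ->
  (forall x, D x -> `|g x| <= M) ->
  mu.-integrable D (EFin \o (fun x => g x * f x)).
Proof.
move=> mD f1 mg gM; have mf := integrable_mf f1.
apply: (@integrable_le _ _ (fun x => `|M| * `|f x|)) => //.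
- exact: measurable_funM.
- move=> x Dx; rewrite !normrM ler_wpM2r//.
  by rewrite (le_trans (gM x Dx))// ler_norm.
- by apply: integrableZr => //; exact: integrable_norm.
Qed.

Lemma sqint_L1 D f : measurable D -> (mu D < +oo)%E -> sqint D f ->
  mu.-integrable D (EFin \o f).
Proof.
move=> mD Dfin [mf f2].
apply: (@integrable_le _ _ (fun x => 1 + f x ^+ 2)) => //.
  by move=> x Dx; rewrite -(real_normK (num_real (f x))); nra.
apply: integrableDr => //; apply: measurable_bounded_integrable => //.
by exists 1; split; rewrite ?num_real// => M M1 x _ /=; rewrite normr1 ltW.
Qed.

(** Evaluate the quadratic at its minimiser [- b / c]; when [c = 0] and [b] is nonzero, evaluate it
    where the remaining affine function is [-1]. Both the integral and the weighted discrete
    Cauchy-Schwarz inequalities rest on this. *)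
Lemma discriminant (a b c : R) : 0 <= c ->
  (forall t, 0 <= a + 2 * t * b + t ^+ 2 * c) -> b ^+ 2 <= a * c.
Proof.
move=> c0 h; have [c00|c00] := eqVneq c 0.
  have [->|b0] := eqVneq b 0; first by rewrite c00 expr0n mulr0.
  have := h (- (a + 1) / (2 * b)); rewrite c00 mulr0 addr0.
  have -> : 2 * (- (a + 1) / (2 * b)) * b = - (a + 1) by field.
  lra.
have cp : 0 < c by rewrite lt_neqAle eq_sym c00.
have := h (- b / c).
have -> : a + 2 * (- b / c) * b + (- b / c) ^+ 2 * c = (a * c - b ^+ 2) / c by field.
by rewrite pmulr_lge0 ?invr_gt0// subr_ge0.
Qed.

Lemma cauchy_schwarz D f g : measurable D -> sqint D f -> sqint D g ->
  (\int[mu]_(x in D) (f x * g x)) ^+ 2 <=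
  (\int[mu]_(x in D) (f x ^+ 2)) * (\int[mu]_(x in D) (g x ^+ 2)).
Proof.
move=> mD f2 g2; apply: discriminant.
  by apply: Rintegral_ge0 => x _; exact: sqr_ge0.
move=> t; have fg := sqint_mul mD f2 g2.
rewrite -!RintegralZl//; try exact: g2.2.
rewrite -!RintegralD//; try exact: f2.2; try exact: integrableZr fg;
  try (by apply: integrableZr => //; exact: g2.2); last first.
  by apply: integrableDr => //; [exact: f2.2|exact: integrableZr].
apply: Rintegral_ge0 => x _.
have -> : f x ^+ 2 + 2 * t * (f x * g x) + t ^+ 2 * g x ^+ 2 = (f x + t * g x) ^+ 2 by ring.
exact: sqr_ge0.
Qed.

Lemma integrable_le_ae D f g : measurable D -> measurable_fun D f ->
  {ae mu, forall x, D x -> `|f x| <= g x} ->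
  mu.-integrable D (EFin \o g) -> mu.-integrable D (EFin \o f).
Proof.
move=> mD mf fg g1.
apply: (@Rdominated_integrable _ (fun=> f) _ g) => //.
  by apply: aeW => x _; exact: cvg_cst.
by apply: ae_imply1 fg => x h Dx n; exact: h.
Qed.

Lemma le_Rintegral_ae D f g : measurable D ->
  mu.-integrable D (EFin \o f) -> mu.-integrable D (EFin \o g) ->
  {ae mu, forall x, D x -> f x <= g x} ->
  \int[mu]_(x in D) f x <= \int[mu]_(x in D) g x.
Proof.
move=> mD f1 g1 fg; rewrite -subr_ge0 -RintegralB//.
rewrite (@ae_eq_Rintegral _ _ (fun x => `|g x - f x|)).
  exact: Rintegral_ge0.
by apply: ae_imply1 fg => x h Dx; rewrite ger0_norm// subr_ge0 h.
Qed.

Lemma Rintegral_eq0_ae D f : measurable D -> mu.-integrable D (EFin \o f) ->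
  (forall x, D x -> 0 <= f x) -> \int[mu]_(x in D) f x <= 0 ->
  {ae mu, forall x, D x -> f x = 0}.
Proof.
move=> mD f1 f0 I0.
have I00 : (\int[mu]_(x in D) `|(EFin \o f) x| = 0)%E.
  rewrite (eq_integral (EFin \o f)).
    rewrite RintegralE//; congr EFin; apply/eqP; rewrite eq_le I0/=.
    exact: Rintegral_ge0.
  by move=> x /set_mem Dx /=; rewrite ger0_norm// f0.
have := (@ae_eq_integral_abs _ _ _ mu D mD (EFin \o f) (measurable_int _ f1)).1 I00.
by apply: ae_imply1 => x /= h Dx; have [] := h Dx.
Qed.

Lemma geometric_sqr_cvg (F : nat -> R) (K : R) :
  (forall n k, (F (n + k)%N - F n) ^+ 2 <= K / 2 ^+ n) -> cvgn F.
Proof.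
move=> FK; apply/cauchy_cvgP; apply: cauchy_exP => e e0.
have : K / 2 ^+ n @[n --> \oo] --> (K * 0 : R).
  have -> : (fun n => K / 2 ^+ n) = (fun n => K * (geometric 1 2^-1) n).
    by apply/funext => n; rewrite /geometric/= mul1r exprVn.
  apply: cvgMr; apply: cvg_geometric.
  by rewrite ger0_norm ?invr_ge0// invf_lt1 ?ltr1n.
rewrite mulr0 => /cvgrPdist_lt /(_ (e ^+ 2)).
rewrite exprn_gt0// => /(_ isT)[n _ /(_ n (leqnn n))].
rewrite sub0r normrN => Kn; exists (F n); exists n => // m /= nm.
rewrite /ball/= -(subnKC nm) -ltr_sqr ?nnegrE ?(ltW e0)//.
rewrite real_normK ?num_real//; rewrite -sqrrN opprB.
by rewrite (le_lt_trans (FK n _))// (le_lt_trans (ler_norm _)).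
Qed.

(** An upper limit is measurable and defined everywhere. It also does not mention the domain, so one
    and the same function is the [L^2] limit on every interval [[0, T]]. *)
Definition pointwise_lim (F : nat -> T -> R) x :=
  fine (limn_esup (fun n => (F n x)%:E)).

(** If [h] dominates [sum_j 2^j (F (j+1) - F j)^2], then
    [(F (n+k) - F n)^2 <= 2 h / 2^n]. *)
Lemma L2_complete D (F : nat -> T -> R) (C : R) : measurable D ->
  (forall n, sqint D (F n)) ->
  (forall n, \int[mu]_(x in D) ((F n.+1 x - F n x) ^+ 2) <= C / 4 ^+ n) ->
  sqint D (pointwise_lim F) /\
  \int[mu]_(x in D) ((F n x - pointwise_lim F x) ^+ 2) @[n --> \oo] --> (0 : R).
Proof.
move=> mD F2 FC.
pose dF j x := F j.+1 x - F j x.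
have dF2 j : sqint D (dF j) by exact: sqintB.
pose P N x := \sum_(j <- iota 0 N) 2 ^+ j * dF j x ^+ 2.
have PS N x : P N.+1 x = P N x + 2 ^+ N * dF N x ^+ 2.
  by rewrite /P -addn1 iotaD big_cat/= big_seq1 add0n.
have P1 N : mu.-integrable D (EFin \o P N).
  by apply: integrable_sumr => // j; apply: integrableZr => //; exact: (dF2 j).2.
have C0 : 0 <= C.
  have := FC 0%N; rewrite expr0 divr1; apply: le_trans.
  by apply: Rintegral_ge0 => x _; exact: sqr_ge0.
(* The terms [2^j * C / 4^j] add up to [C * (2 - 2 / 2^N)]. *)
have IP N : \int[mu]_(x in D) P N x <= C * (2 - 2 / 2 ^+ N).
  rewrite /P Rintegral_sum//; last first.
    by move=> j; apply: integrableZr => //; exact: (dF2 j).2.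
  elim: N => [|N ih]; first by rewrite big_nil expr0 divr1 subrr mulr0.
  rewrite -addn1 iotaD big_cat/= big_seq1 add0n RintegralZl//; last exact: (dF2 N).2.
  have := lerD ih (ler_wpM2l (exprn_ge0 N (ler0n R 2)) (FC N)).
  move/le_trans; apply; rewrite le_eqVlt; apply/orP; left; apply/eqP.
  have -> : (4 : R) ^+ N = 2 ^+ N * 2 ^+ N by rewrite -exprMn -natrM.
  by rewrite addn1 exprS; field; rewrite expf_neq0.
have [h [h1 h0 Pcv Ph Ih]] : exists h : T -> R, [/\ mu.-integrable D (EFin \o h),
    forall x, D x -> 0 <= h x,
    {ae mu, forall x, D x -> P n x @[n --> \oo] --> h x},
    {ae mu, forall x, D x -> forall n, P n x <= h x}
    & \int[mu]_(x in D) h x <= C * 2].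
  apply: (levi mD P1).
  - by move=> n x _; rewrite /P sumr_ge0// => j _; rewrite mulr_ge0 ?sqr_ge0// exprn_ge0.
  - by move=> n x _; rewrite PS lerDl mulr_ge0 ?sqr_ge0// exprn_ge0.
  - move=> n; apply: (le_trans (IP n)); rewrite ler_wpM2l// gerBl.
    by rewrite divr_ge0 ?exprn_ge0.
(* Each use of [sqrD_le] doubles the remaining tail; the weights [2^j] in [P] absorb this
   doubling. *)
have key x k : forall n, (F (n + k)%N x - F n x) ^+ 2 <= 2 / 2 ^+ n * (P (n + k)%N x - P n x).
  elim: k => [n|k ih n]; first by rewrite addn0 !subrr expr0n mulr0.
  have := ih n.+1; rewrite -addSnnS [2 ^+ n.+1]exprS.
  have -> : P n x = P n.+1 x - 2 ^+ n * dF n x ^+ 2 by rewrite PS addrK.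
  have p0 : 0 < 2 ^+ n :> R by rewrite exprn_gt0.
  move: (P (n.+1 + k)%N x) (P n.+1 x) (F (n.+1 + k)%N x) => u v w ihn.
  have -> : w - F n x = (w - F n.+1 x) + dF n x by rewrite /dF addrA subrK.
  apply: (le_trans (sqrD_le _ _)).
  have -> : 2 / 2 ^+ n * (u - (v - 2 ^+ n * dF n x ^+ 2)) =
     2 * (2 / (2 * 2 ^+ n) * (u - v)) + 2 * dF n x ^+ 2.
    by field; rewrite gt_eqF.
  by rewrite lerD2r ler_wpM2l.
have key2 : {ae mu, forall x, D x -> forall n k,
    (F (n + k)%N x - F n x) ^+ 2 <= 2 * h x / 2 ^+ n}.
  apply: ae_imply1 Ph => x Phx Dx n k; apply: (le_trans (key x k n)).
  rewrite mulrAC ler_wpM2r ?invr_ge0 ?exprn_ge0// ler_wpM2l//.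
  rewrite (@le_trans _ _ (P (n + k)%N x))// ?Phx// gerBl.
  by rewrite /P sumr_ge0// => j _; rewrite mulr_ge0 ?sqr_ge0// exprn_ge0.
set f := pointwise_lim F.
have mf : measurable_fun D f.
  apply: measurableT_comp => //; apply: measurable_fun_limn_esup => n.
  by apply/measurable_EFinP; exact: (F2 n).1.
have cvF : {ae mu, forall x, D x -> F n x @[n --> \oo] --> f x}.
  apply: ae_imply1 key2 => x hx Dx; have /cvg_ex[l cv] := geometric_sqr_cvg (hx Dx).
  have cvE : (F n x)%:E @[n --> \oo] --> l%:E by apply: cvg_EFin; [exact: nearW|exact: cv].
  by rewrite /f /pointwise_lim is_cvg_limn_esupE ?(cvg_lim _ cvE).
have fF : {ae mu, forall x, D x -> forall n, (F n x - f x) ^+ 2 <= 2 * h x / 2 ^+ n}.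
  apply: (ae_imply2 _ key2 cvF) => x hx cv Dx n.
  have cvk : (F (n + k)%N x - F n x) ^+ 2 @[k --> \oo] --> (f x - F n x) ^+ 2.
    have cvn : F (n + k)%N x @[k --> \oo] --> f x.
      exact: (cvg_comp (addn n) (F ^~ x) (cvg_addnl n) (cv Dx)).
    have cvd : F (n + k)%N x - F n x @[k --> \oo] --> f x - F n x.
      by apply: cvgB => //; exact: cvg_cst.
    by rewrite expr2; under eq_cvg do rewrite expr2; exact: cvgM.
  rewrite -sqrrN opprB -(cvg_lim _ cvk)//; apply: limr_le.
    by apply/cvg_ex; eexists; exact: cvk.
  by apply: nearW => k; exact: hx.
have mfn n : measurable_fun D (fun x => (F n x - f x) ^+ 2).
  by apply: measurable_funX; apply: measurable_funB => //; exact: (F2 n).1.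
have fn1 n : mu.-integrable D (EFin \o (fun x => (F n x - f x) ^+ 2)).
  apply: (@integrable_le_ae _ _ (fun x => 2 / 2 ^+ n * h x)) => //.
    apply: ae_imply1 fF => x hx Dx; rewrite ger0_norm ?sqr_ge0//.
    by rewrite mulrAC; exact: hx.
  exact: integrableZr.
have f2 : sqint D f.
  have -> : f = fun x => F 0%N x - (F 0%N x - f x) by apply/funext => x; rewrite subKr.
  by apply: sqintB => //; split => //; apply: measurable_funB => //; exact: (F2 0%N).1.
split => //.
apply: (@squeeze_cvgr _ _ _ _ (fun=> 0) (fun n => geometric (4 * C) 2^-1 n)).
- apply: nearW => n; apply/andP; split; first by apply: Rintegral_ge0 => x _; exact: sqr_ge0.
  apply: (@le_trans _ _ (\int[mu]_(x in D) (2 / 2 ^+ n * h x))).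
    apply: le_Rintegral_ae => //; first exact: integrableZr.
    by apply: ae_imply1 fF => x hx Dx; rewrite mulrAC; exact: hx.
  rewrite RintegralZl// /geometric/= exprVn.
  have -> : 4 * C * (2 ^+ n)^-1 = 2 / 2 ^+ n * (C * 2) by ring.
  by rewrite ler_wpM2l// divr_ge0 ?exprn_ge0.
- exact: cvg_cst.
- apply: cvg_geometric; by rewrite ger0_norm ?invr_ge0// invf_lt1 ?ltr1n.
Qed.

End integration.

Lemma integral_mrestr d (T : measurableType d) (R : realType)
    (mu : {measure set T -> \bar R}) D (mD : measurable D) (f : T -> \bar R) :
  (\int[mrestr mu mD]_x f x = \int[mu]_(x in D) f x)%E.
Proof.
have -> : (\int[mu]_(x in D) f x = \int[mrestr mu mD]_(x in D) f x)%E.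
  apply: eq_measure_integral => A mA AD.
  by rewrite /= /mrestr; congr (mu _); rewrite setIidl.
rewrite [RHS]integral_mkcond; apply: ae_eq_integral_nomeas.
by apply/ae_mrestr; apply: aeW => x Dx _; rewrite patchT// inE.
Qed.

(** * Absolutely continuous functions *)

Section absolute_continuity.
Context (R : realType).
Notation mu := (@lebesgue_measure R).
Implicit Types (f g F G : R -> R) (t : R).

Lemma itv_bounded_integrable f M (a b : R) : measurable_fun `[a, b] f ->
  (forall x, a <= x <= b -> `|f x| <= M) -> mu.-integrable `[a, b] (EFin \o f).
Proof.
move=> mf fM; apply: measurable_bounded_integrable => //.
  by rewrite /= lebesgue_measure_itv/=; case: ifPn => // _; rewrite -EFinB ltry.
exists M; split; rewrite ?num_real// => K MK x /=; rewrite in_itv/= => xab.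
by rewrite (le_trans (fM x xab))// ltW.
Qed.

Lemma continuous_itv_bounded f (a b : R) : {within `[a, b], continuous f} ->
  exists2 M, 0 <= M & forall x, a <= x <= b -> `|f x| <= M.
Proof.
move=> cf; have := compact_bounded (continuous_compact cf (@segment_compact R a b)).
move=> [M [_ Mf]]; exists (`|M| + 1); first by rewrite addr_ge0.
move=> x xab; apply: (Mf (`|M| + 1)); first by rewrite ltr_pwDr// ler_norm.
by exists x => //=; rewrite in_itv.
Qed.

Lemma continuous_itv_measurable f (a b : R) :
  {within `[a, b], continuous f} -> measurable_fun `[a, b] f.
Proof. by move=> cf; apply: subspace_continuous_measurable_fun. Qed.

Lemma integrable_itvS f (a b c e : R) : a <= c -> e <= b ->
  mu.-integrable `[a, b] (EFin \o f) -> mu.-integrable `[c, e] (EFin \o f).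
Proof.
move=> ac eb; apply: integrableS => //.
by apply: subset_itv; rewrite bnd_simp.
Qed.

Lemma sqint_itvS f (a b c e : R) : a <= c -> e <= b ->
  sqint mu `[a, b] f -> sqint mu `[c, e] f.
Proof.
by move=> ac eb; apply: sqintS => //; apply: subset_itv; rewrite bnd_simp.
Qed.

Lemma RintegralB_itv f (a b c : R) : mu.-integrable `[a, c] (EFin \o f) ->
  a <= b -> b <= c ->
  \int[mu]_(x in `[a, c]) f x - \int[mu]_(x in `[a, b]) f x =
  \int[mu]_(x in `[b, c]) f x.
Proof.
move=> f1 ab bc; rewrite Rintegral_itvB ?bnd_simp//.
by apply: Rintegral_itv_obnd_cbnd; apply: integrableS f1 => //; apply: subset_itv; rewrite bnd_simp.
Qed.

Lemma patch_itv f (a b x : R) : (f \_ `[a, b]) x = if a <= x <= b then f x else 0.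
Proof. by rewrite /patch mem_setE in_itv. Qed.

(** Fubini on the triangle [x < y]. *)
Lemma Rintegral_mul_primitives f g t :
  mu.-integrable `[0, t] (EFin \o f) -> mu.-integrable `[0, t] (EFin \o g) ->
  \int[mu]_(x in `[0, t]) (f x * (\int[mu]_(y in `[x, t]) g y)) =
  \int[mu]_(y in `[0, t]) (g y * (\int[mu]_(x in `[0, y]) f x)).
Proof.
move=> f1 g1; pose F := f \_ `[0, t]; pose G := g \_ `[0, t].
have F1 : mu.-integrable setT (EFin \o F).
  by rewrite /F -restrict_EFin; apply/(integrable_mkcond _ _).1.
have G1 : mu.-integrable setT (EFin \o G).
  by rewrite /G -restrict_EFin; apply/(integrable_mkcond _ _).1.
have mF := integrable_mf F1; have mG := integrable_mf G1.
pose k (z : measurableTypeR R * measurableTypeR R) : R := F z.1 * G z.2 * (z.1 < z.2)%R%:R.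
have mk : measurable_fun [set: measurableTypeR R * measurableTypeR R] (EFin \o k).
  apply/measurable_EFinP; apply: measurable_funM.
    by apply: measurable_funM; apply: measurableT_comp.
  apply: (@measurableT_comp _ _ _ _ _ _ (fun b : bool => b%:R : R)) => //.
  by apply: measurable_fun_ltr.
have k1 : ((mu \x mu)%E).-integrable setT (EFin \o k).
  apply/integrable12ltyP => //.
  apply: (@le_lt_trans _ _ (\int[mu]_x (`|F x|%:E * \int[mu]_y `|G y|%:E))%E).
    apply: ge0_le_integral => //=.
    - by move=> x _; apply: integral_ge0.
    - apply: (@measurable_fun_fubini_tonelli_F _ _ (measurableTypeR R)
        (measurableTypeR R) _ mu (fun z => `|(k z)%:E|%E)) => //.
      exact: measurableT_comp.
    - apply: emeasurable_funM => //; do 2 apply: measurableT_comp => //.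
    - move=> x _; rewrite -ge0_integralZl//; last by do 2 apply: measurableT_comp => //.
      apply: ge0_le_integral => //.
      + apply/measurable_EFinP; apply: measurableT_comp => //.
        rewrite /k /=; apply: measurable_funM; first by apply: measurable_funM.
        apply: (@measurableT_comp _ _ _ _ _ _ (fun b : bool => b%:R : R)) => //.
        by apply: measurable_fun_ltr.
      + by apply: emeasurable_funM => //; do 2 apply: measurableT_comp => //.
      + move=> y _; rewrite /k/= -EFinM lee_fin !normrM.
        by case: (x < y); rewrite ?normr1 ?normr0 ?mulr1 ?mulr0// mulr_ge0.
  have G1' : (\int[mu]_y `|G y|%:E)%E \is a fin_num.
    have := integrable_abse G1; exact: integrable_fin_num.
  rewrite -(fineK G1') ge0_integralZr//; last 2 first.
    by do 2 apply: measurableT_comp => //.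
    by rewrite lee_fin fine_ge0// integral_ge0.
  by rewrite fineK// lte_mul_pinfty//; [exact: integral_ge0
    |exact: (integrable_fin_num measurableT (integrable_abse F1))
    |rewrite ltey_eq G1'].
have E1 x : (\int[mu]_y (EFin \o k) (x, y) =
    ((fun x => f x * (\int[mu]_(y in `[x, t]) g y)) \_ `[0, t] x)%:E)%E.
  rewrite /k /= patch_itv; have [/andP[x0 xt]|x0t] := boolP (0 <= x <= t); last first.
    by rewrite integral0_eq// => y _; rewrite /F patch_itv (negbTE x0t) !mul0r.
  have g1x : mu.-integrable `[x, t] (EFin \o g) by apply: integrable_itvS g1.
  rewrite EFinM -RintegralE// -integral_itv_obnd_cbnd; last first.
    by apply: measurable_funS (measurable_int _ g1x) => //; apply: subset_itv; rewrite bnd_simp.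
  rewrite -integralZl//; last first.
    by apply: integrableS g1x => //; apply: subset_itv; rewrite bnd_simp.
  rewrite [RHS]integral_mkcond; apply: eq_integral => y _.
  rewrite /F /G !patch_itv x0 xt/= /patch mem_setE in_itv/=.
  have [xy|xy] := ltP x y => /=; last by rewrite mulr0.
  by rewrite (le_trans x0 (ltW xy))/=; case: ifPn; rewrite ?mulr0 ?mulr1// mul0r.
have E2 y : (\int[mu]_x (EFin \o k) (x, y) =
    ((fun y => g y * (\int[mu]_(x in `[0, y]) f x)) \_ `[0, t] y)%:E)%E.
  rewrite /k /= patch_itv; have [/andP[y0 yt]|y0t] := boolP (0 <= y <= t); last first.
    by rewrite integral0_eq// => x _; rewrite /G patch_itv (negbTE y0t) mulr0 mul0r.
  have f1y : mu.-integrable `[0, y] (EFin \o f) by apply: integrable_itvS f1.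
  rewrite EFinM -RintegralE// -integral_itv_bndo_bndc; last first.
    by apply: measurable_funS (measurable_int _ f1y) => //; apply: subset_itv; rewrite bnd_simp.
  rewrite -integralZl//; last first.
    by apply: integrableS f1y => //; apply: subset_itv; rewrite bnd_simp.
  rewrite [RHS]integral_mkcond; apply: eq_integral => x _.
  rewrite /F /G !patch_itv y0 yt/= /patch mem_setE in_itv/=.
  have [xy|xy] := ltP x y => /=; last by rewrite mulr0 andbF.
  by rewrite andbT (le_trans (ltW xy) yt) andbT; case: ifPn; rewrite ?mul0r ?mulr1// mulrC.
rewrite /Rintegral; congr fine.
rewrite integral_mkcond [RHS]integral_mkcond !restrict_EFin.
transitivity (\int[mu]_x \int[mu]_y (EFin \o k) (x, y))%E.
  by apply: eq_integral => x _; exact/esym/E1.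
by rewrite (Fubini k1); apply: eq_integral => y _; exact: E2.
Qed.

(** Absolute continuity is encoded by its integral representation, with the derivative [f] as part
    of the data. The product and exponential rules then become statements about integrals, free of
    pointwise differentiation. *)
Definition ac t f F := mu.-integrable `[0, t] (EFin \o f) /\
  forall x, 0 <= x <= t -> F x = F 0 + \int[mu]_(y in `[0, x]) f y.

Lemma ac_integrable t f F : ac t f F -> mu.-integrable `[0, t] (EFin \o f).
Proof. by case. Qed.

Lemma acS s t f F : s <= t -> ac t f F -> ac s f F.
Proof.
move=> st [f1 Ff]; split; first exact: integrable_itvS f1.
by move=> x /andP[x0 xs]; apply: Ff; rewrite x0 (le_trans xs).
Qed.

Lemma ac_incr s x t f F : ac t f F -> 0 <= s -> s <= x -> x <= t ->
  F x - F s = \int[mu]_(y in `[s, x]) f y.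
Proof.
move=> [f1 Ff] s0 sx xt.
rewrite (Ff x) ?xt ?(le_trans s0)// (Ff s) ?s0 ?(le_trans sx)//.
rewrite opprD addrACA subrr add0r RintegralB_itv//.
exact: integrable_itvS f1.
Qed.

Lemma ac_continuous t f F : 0 <= t -> ac t f F -> {within `[0, t], continuous F}.
Proof.
move=> t0 [f1 Ff].
have c := parameterized_integral_continuous t0 f1.
apply: (@subspace_eq_continuous _ _ _
  (fun x => F 0 + parameterized_integral mu 0 x f)).
  by move=> x; rewrite inE/= in_itv/= => xt; rewrite /parameterized_integral -Ff.
by move=> x; apply: cvgD; [exact: cvg_cst|exact: c].
Qed.

Lemma ac_measurable t f F : 0 <= t -> ac t f F -> measurable_fun `[0, t] F.
Proof. by move=> t0 /(ac_continuous t0)/continuous_itv_measurable. Qed.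

Lemma ac_bounded t f F : 0 <= t -> ac t f F ->
  exists2 M, 0 <= M & forall x, 0 <= x <= t -> `|F x| <= M.
Proof. by move=> t0 /(ac_continuous t0)/continuous_itv_bounded. Qed.

Lemma eq_ac t f F f' F' : ac t f F ->
  (forall x, 0 <= x <= t -> f x = f' x) -> (forall x, 0 <= x <= t -> F x = F' x) ->
  ac t f' F'.
Proof.
move=> [f1 Ff] ff FF; split.
  by apply: eq_integrable f1 => // x; rewrite inE/= in_itv/= => xt; rewrite /= ff.
move=> x /andP[x0 xt]; have tt : 0 <= t by exact: le_trans xt.
rewrite -!FF ?x0 ?lexx ?tt// Ff ?x0//; congr (_ + _).
apply: eq_Rintegral => y; rewrite inE/= in_itv/= => /andP[y0 yx].
by rewrite ff// y0 (le_trans yx).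
Qed.

Lemma ac_mulr_integrable t f F g : 0 <= t -> ac t f F ->
  mu.-integrable `[0, t] (EFin \o g) ->
  mu.-integrable `[0, t] (EFin \o (fun x => F x * g x)).
Proof.
move=> t0 Ff g1; have [M M0 FM] := ac_bounded t0 Ff.
apply: (integrable_bounded (M := M)) => //; first exact: ac_measurable Ff.
Qed.

(** In the integral of [F g], write [F y - F 0] as an integral of [f] and exchange the order of
    integration over the triangle: it becomes the integral of [f y (G x - G y)], and the boundary
    terms appear. *)
Lemma ac_mul t f F g G : 0 <= t -> ac t f F -> ac t g G ->
  ac t (fun x => f x * G x + F x * g x) (fun x => F x * G x).
Proof.
move=> t0 aF aG.
have i1 : mu.-integrable `[0, t] (EFin \o (fun x => f x * G x)).
  apply: eq_integrable (ac_mulr_integrable t0 aG aF.1) => // x _ /=.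
  by rewrite mulrC.
have i2 := ac_mulr_integrable t0 aF aG.1.
split; first exact: integrableDr.
move=> x /andP[x0 xt].
have {}aF := acS xt aF; have {}aG := acS xt aG.
rewrite RintegralD//; last 2 first.
- exact: integrable_itvS i1.
- exact: integrable_itvS i2.
have -> : \int[mu]_(y in `[0, x]) (F y * g y) = F 0 * \int[mu]_(y in `[0, x]) g y
    + \int[mu]_(y in `[0, x]) (g y * (F y - F 0)).
  rewrite -RintegralZl//; last exact: aG.1.
  rewrite -RintegralD//.
  - by apply: eq_Rintegral => y _; ring.
  - by apply: integrableZr => //; exact: aG.1.
  - have -> : (fun y => g y * (F y - F 0)) = (fun y => F y * g y - F 0 * g y).
      by apply/funext => y; ring.
    apply: integrableBr => //; first exact: integrable_itvS i2.
    by apply: integrableZr => //; exact: aG.1.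
have -> : \int[mu]_(y in `[0, x]) (g y * (F y - F 0)) =
   \int[mu]_(y in `[0, x]) (f y * (G x - G y)).
  transitivity (\int[mu]_(y in `[0, x]) (g y * (\int[mu]_(z in `[0, y]) f z))).
    apply: eq_Rintegral => y; rewrite inE/= in_itv/= => /andP[y0 yx].
    by rewrite (ac_incr aF).
  rewrite -(Rintegral_mul_primitives aF.1 aG.1).
  apply: eq_Rintegral => y; rewrite inE/= in_itv/= => /andP[y0 yx].
  by rewrite (ac_incr aG).
have -> : \int[mu]_(y in `[0, x]) (f y * (G x - G y)) =
   G x * \int[mu]_(y in `[0, x]) f y - \int[mu]_(y in `[0, x]) (f y * G y).
  rewrite -RintegralZl//; last exact: aF.1.
  rewrite -RintegralB//.
  - by apply: eq_Rintegral => y _; ring.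
  - by apply: integrableZr => //; exact: aF.1.
  - exact: integrable_itvS i1.
have := ac_incr aF (lexx 0) x0 (lexx x); have := ac_incr aG (lexx 0) x0 (lexx x).
by move=> <- <-; ring.
Qed.

Lemma ac_cst t c : ac t (fun=> 0) (fun=> c).
Proof.
split; first by apply: (itv_bounded_integrable (M := 0)) => // x _; rewrite normr0.
by move=> x _; rewrite /Rintegral integral0_eq// addr0.
Qed.

Lemma ac_add t f F g G : ac t f F -> ac t g G ->
  ac t (fun x => f x + g x) (fun x => F x + G x).
Proof.
move=> aF aG; split; first by apply: integrableDr => //; [exact: aF.1|exact: aG.1].
move=> x /andP[x0 xt]; rewrite RintegralD//.
- by rewrite addrACA -aF.2 ?x0// -aG.2 ?x0.
- exact: integrable_itvS aF.1.
- exact: integrable_itvS aG.1.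
Qed.

Lemma ac_scale t c f F : ac t f F -> ac t (fun x => c * f x) (fun x => c * F x).
Proof.
move=> aF; split; first by apply: integrableZr => //; exact: aF.1.
move=> x /andP[x0 xt]; rewrite RintegralZl//.
- by rewrite -mulrDr -aF.2 ?x0.
- exact: integrable_itvS aF.1.
Qed.

Lemma ac_primitive t f c : mu.-integrable `[0, t] (EFin \o f) ->
  ac t f (fun x => c + \int[mu]_(y in `[0, x]) f y).
Proof.
move=> f1; split=> // x _; congr (_ + _).
by rewrite set_itv1 Rintegral_set1 addr0.
Qed.

(** The powers [F^n / n!] are absolutely continuous; sum their integral
    representations by dominated convergence. *)
Lemma ac_exp t f F : 0 <= t -> ac t f F ->
  ac t (fun x => f x * expR (F x)) (fun x => expR (F x)).
Proof.
move=> t0 aF; have [M M0 FM] := ac_bounded t0 aF.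
pose p n x : R := \sum_(0 <= i < n) F x ^+ i / i`!%:R.
have ap n : ac t (fun x => f x * p n x) (p n.+1).
  elim: n => [|n ih].
    apply: eq_ac (ac_cst t 1) _ _ => x _.
      by rewrite /p big_geq// mulr0.
    by rewrite /p big_nat1 expr0 divr1.
  have aFn : ac t (fun x => f x * (F x ^+ n / n`!%:R)) (fun x => F x ^+ n.+1 / n.+1`!%:R).
    elim: n {ih} => [|n ih].
      by apply: eq_ac aF _ _ => x _; rewrite ?expr0 ?expr1 divr1 ?mulr1.
    have := ac_scale (n.+2%:R^-1) (ac_mul t0 aF ih).
    move=> h; apply: eq_ac h _ _ => x _; rewrite ?factS ?natrM.
      have n1 : n.+1%:R != 0 :> R by rewrite pnatr_eq0.
      have n2 : n.+2%:R != 0 :> R by rewrite pnatr_eq0.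
      have n3 : n`!%:R != 0 :> R by rewrite pnatr_eq0 -lt0n fact_gt0.
      rewrite !exprS -[n.+2%:R]natr1; field.
      by rewrite n3 [1 + _]addrC !natr1 n1 n2.
    have n1 : n.+1%:R != 0 :> R by rewrite pnatr_eq0.
    have n2 : n.+2%:R != 0 :> R by rewrite pnatr_eq0.
    have n3 : n`!%:R != 0 :> R by rewrite pnatr_eq0 -lt0n fact_gt0.
    by rewrite [F x ^+ n.+2]exprS !invfM; ring.
  apply: eq_ac (ac_add ih aFn) _ _ => x _; rewrite /p [in RHS]big_nat_recr//=.
  by rewrite mulrDr.
have cvp x : p n x @[n --> \oo] --> expR (F x).
  have -> : (fun n => p n x) = series (exp_coeff (F x)).
    by apply/funext => n; rewrite /p /series/=; apply: eq_bigr => i _; rewrite /exp_coeff/=.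
  exact: is_cvg_series_exp_coeff.
have pM n x : 0 <= x <= t -> `|p n x| <= expR M.
  move=> xt; apply: (@le_trans _ _ (\sum_(0 <= i < n) M ^+ i / i`!%:R)).
    rewrite /p (le_trans (ler_norm_sum _ _ _))//; apply: ler_sum => i _.
    rewrite normrM normrX [`| _^-1|]ger0_norm ?invr_ge0//.
    by rewrite ler_wpM2r ?invr_ge0// lerXn2r ?nnegrE// FM.
  have -> : \sum_(0 <= i < n) M ^+ i / i`!%:R = series (exp_coeff M) n.
    by rewrite /series/=; apply: eq_bigr => i _; rewrite /exp_coeff/=.
  apply: nondecreasing_cvgn_le; last exact: is_cvg_series_exp_coeff.
  by apply/nondecreasing_seqP => k; rewrite /series/= big_nat_recr//= lerDl exp_coeff_ge0.
have mp n : measurable_fun `[0, t] (p n).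
  case: n => [|n]; last exact: ac_measurable (ap n).
  by rewrite (_ : p 0%N = fun=> 0)//; apply/funext => x; rewrite /p big_geq.
have mE : measurable_fun `[0, t] (fun x => expR (F x)).
  by apply: measurableT_comp => //; exact: ac_measurable aF.
split.
  rewrite (_ : _ \o _ = EFin \o (fun x => expR (F x) * f x)); last first.
    by apply/funext => x /=; rewrite mulrC.
  apply: (integrable_bounded (M := expR M)) => //; first exact: aF.1.
  move=> x /=; rewrite in_itv/= => xt; rewrite ger0_norm ?expR_ge0//.
  by rewrite ler_expR (le_trans (ler_norm _))// FM.
move=> x /andP[x0 xt].
have c1 : p n.+1 x @[n --> \oo] --> expR (F x).
  by have := cvp x; rewrite -[X in X -> _]cvg_shiftS.
have c0 : p n.+1 0 @[n --> \oo] --> expR (F 0).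
  by have := cvp 0; rewrite -[X in X -> _]cvg_shiftS.
have cI : \int[mu]_(y in `[0, x]) (f y * p n y) @[n --> \oo] -->
    \int[mu]_(y in `[0, x]) (f y * expR (F y)).
  apply: (@Rdominated _ (measurableTypeR R) R mu `[0, x] (fun n y => f y * p n y)
    (fun y => f y * expR (F y)) (fun y => expR M * `|f y|)) => //.
  - move=> n; apply: measurable_funM; first exact: integrable_mf (integrable_itvS (lexx 0) xt aF.1).
    by apply: measurable_funS (mp n) => //; apply: subset_itvl; rewrite bnd_simp.
  - by apply: integrableZr => //; apply: integrable_norm; exact: integrable_itvS aF.1.
  - by apply: aeW => y _; apply: cvgMr; exact: cvp.
  - apply: aeW => y /=; rewrite in_itv/= => /andP[y0 yx] n.
    by rewrite normrM mulrC ler_wpM2r// pM// y0 (le_trans yx).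
apply: (Rcvg_unique c1).
have -> : (fun n => p n.+1 x) = fun n => p n.+1 0 + \int[mu]_(y in `[0, x]) (f y * p n y).
  by apply/funext => n; rewrite -(ap n).2 ?x0.
exact: cvgD.
Qed.

End absolute_continuity.
(** * Orthonormal systems *)

Section orthonormal_systems.
Context d (T : measurableType d) (R : realType).
Context (mu : {measure set T -> \bar R}) (D : set T) (mD : measurable D).
Implicit Types (f g : T -> R) (psi : nat -> T -> R) (c : nat -> R).

Definition dot f g := \int[mu]_(x in D) (f x * g x).

Lemma dotC f g : dot f g = dot g f.
Proof. by apply: eq_Rintegral => x _; rewrite mulrC. Qed.

Lemma dotDl f g h : sqint mu D f -> sqint mu D g -> sqint mu D h ->
  dot (fun x => f x + g x) h = dot f h + dot g h.
Proof.
move=> f2 g2 h2; rewrite /dot -RintegralD//; try exact: sqint_mul.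
by apply: eq_Rintegral => x _; rewrite mulrDl.
Qed.

Lemma dotBl f g h : sqint mu D f -> sqint mu D g -> sqint mu D h ->
  dot (fun x => f x - g x) h = dot f h - dot g h.
Proof.
move=> f2 g2 h2; rewrite /dot -RintegralB//; try exact: sqint_mul.
by apply: eq_Rintegral => x _; rewrite mulrBl.
Qed.

Lemma dotZl a f g : sqint mu D f -> sqint mu D g ->
  dot (fun x => a * f x) g = a * dot f g.
Proof.
move=> f2 g2; rewrite /dot -RintegralZl//; try exact: sqint_mul.
by apply: eq_Rintegral => x _; rewrite mulrA.
Qed.

Lemma dot_sqr f : dot f f = \int[mu]_(x in D) (f x ^+ 2).
Proof. by apply: eq_Rintegral => x _; rewrite expr2. Qed.

Lemma dot_ge0 f : 0 <= dot f f.
Proof. by rewrite dot_sqr; apply: Rintegral_ge0 => x _; exact: sqr_ge0. Qed.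

Lemma dot_cs f g : sqint mu D f -> sqint mu D g ->
  dot f g ^+ 2 <= dot f f * dot g g.
Proof. by move=> f2 g2; rewrite !dot_sqr; exact: cauchy_schwarz. Qed.

Lemma dot_eq0 f : sqint mu D f -> dot f f = 0 -> {ae mu, forall x, D x -> f x = 0}.
Proof.
move=> f2 f0; have : {ae mu, forall x, D x -> f x ^+ 2 = 0}.
  apply: Rintegral_eq0_ae => //; first exact: f2.2.
    by move=> x _; exact: sqr_ge0.
  by rewrite -dot_sqr f0.
apply: ae_imply1 => x h Dx; apply/eqP.
by have := h Dx; move/eqP; rewrite sqrf_eq0.
Qed.

Lemma eq_dot f f' g g' : {ae mu, forall x, D x -> f x = f' x} ->
  {ae mu, forall x, D x -> g x = g' x} -> dot f g = dot f' g'.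
Proof.
move=> ff gg; apply: ae_eq_Rintegral.
by apply: (ae_imply2 _ ff gg) => x h1 h2 Dx; rewrite h1// h2.
Qed.

Definition lincomb psi c (s : seq nat) x := \sum_(i <- s) c i * psi i x.

Definition orthonormal psi := (forall n, sqint mu D (psi n)) /\
  forall i j, dot (psi i) (psi j) = (i == j)%:R.

Definition total psi := forall f, sqint mu D f ->
  (forall n, dot f (psi n) = 0) -> dot f f = 0.

Lemma sqint_lincomb psi c s : orthonormal psi -> sqint mu D (lincomb psi c s).
Proof. by move=> [psi2 _]; apply: sqint_sum => // i; exact: sqintZ. Qed.

Lemma dot_lincombl psi c s g : orthonormal psi -> sqint mu D g ->
  dot (lincomb psi c s) g = \sum_(i <- s) c i * dot (psi i) g.
Proof.
move=> on g2; have psi2 := on.1; elim: s => [|i s ih].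
  rewrite big_nil /dot /lincomb (@eq_Rintegral _ _ _ mu D (fun=> 0)); last first.
    by move=> x _; rewrite big_nil mul0r.
  by rewrite /Rintegral integral0_eq.
rewrite big_cons -ih -dotZl// -dotDl//.
- by apply: eq_Rintegral => x _; rewrite /lincomb big_cons.
- exact: sqintZ.
- exact: sqint_lincomb.
Qed.

Lemma dot_lincomb_psi psi c s j : orthonormal psi -> uniq s ->
  dot (lincomb psi c s) (psi j) = if j \in s then c j else 0.
Proof.
move=> on us; rewrite dot_lincombl//; last exact: on.1.
under eq_bigr do rewrite on.2.
case: ifPn => js.
  rewrite (bigD1_seq j)//= eqxx mulr1 big1 ?addr0// => i ij.
  by rewrite (negbTE ij) mulr0.
rewrite big_seq big1// => i is_; case: eqP => [ij|_]; last by rewrite mulr0.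
by move: js; rewrite -ij is_.
Qed.

Lemma dot_lincomb psi c s : orthonormal psi -> uniq s ->
  dot (lincomb psi c s) (lincomb psi c s) = \sum_(i <- s) c i ^+ 2.
Proof.
move=> on us; rewrite dot_lincombl//; last exact: sqint_lincomb.
rewrite big_seq [RHS]big_seq; apply: eq_bigr => i is_.
by rewrite dotC dot_lincomb_psi// is_ expr2.
Qed.

(** Pythagoras for the projection onto finitely many modes. Bessel's inequality and the norm in the
    Riesz-Fischer theorem are both read off this identity. *)
Lemma dot_lincomb_dist psi f s : orthonormal psi -> sqint mu D f -> uniq s ->
  let c i := dot f (psi i) in
  dot (fun x => lincomb psi c s x - f x) (fun x => lincomb psi c s x - f x) =
  dot f f - \sum_(i <- s) c i ^+ 2.
Proof.
move=> on f2 us c; have S2 := sqint_lincomb c s on.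
have d2 : sqint mu D (fun x => lincomb psi c s x - f x) by exact: sqintB.
rewrite dotBl// ![dot _ (fun x => _ - _)]dotC !dotBl// dot_lincomb//.
rewrite [dot f (lincomb _ _ _)]dotC dot_lincombl//.
have -> : \sum_(i <- s) c i * dot (psi i) f = \sum_(i <- s) c i ^+ 2.
  by apply: eq_bigr => i _; rewrite dotC expr2.
ring.
Qed.

Lemma bessel psi f s : orthonormal psi -> sqint mu D f -> uniq s ->
  \sum_(i <- s) dot f (psi i) ^+ 2 <= dot f f.
Proof.
by move=> on f2 us; rewrite -subr_ge0 -dot_lincomb_dist//; exact: dot_ge0.
Qed.

(** [L2_complete] asks for increments that decay like [4^-k], so the partial sums are taken along
    indices [N k] beyond which the tail of the series of squares is at most [4^-k]. *)
Lemma riesz_fischer psi c C : orthonormal psi ->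
  (forall n, \sum_(0 <= i < n) c i ^+ 2 <= C) ->
  exists2 f, sqint mu D f &
    (forall i, dot f (psi i) = c i) /\
    \sum_(0 <= i < n) c i ^+ 2 @[n --> \oo] --> dot f f.
Proof.
move=> on cC; pose u n := \sum_(0 <= i < n) c i ^+ 2.
have uS n : u n.+1 = u n + c n ^+ 2 by rewrite /u big_nat_recr.
have nd : nondecreasing_seq u.
  by apply/nondecreasing_seqP => n; rewrite uS lerDl sqr_ge0.
have cvu : cvgn u by apply: nondecreasing_is_cvgn => //; exists C => _ [n _ <-]; exact: cC.
have ul n : u n <= limn u by exact: nondecreasing_cvgn_le.
have /choice[N0 hN0] : forall k, exists N, limn u - u N <= 1 / 4 ^+ k.
  move=> k; have /cvgrPdist_le/(_ (1 / 4 ^+ k)) := cvu.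
  rewrite divr_gt0 ?exprn_gt0// => /(_ isT)[N _ /(_ N (leqnn N))] h.
  by exists N; rewrite (le_trans (ler_norm _)).
(* The maximum makes [N] nondecreasing and at least [N0 k]; the summand [k] makes it tend to
   infinity. *)
pose N k := (k + \max_(j < k.+1) N0 j)%N.
have NS k : (N k <= N k.+1)%N.
  rewrite /N addSn leqW// leq_add2l; apply/bigmax_leqP => j _.
  exact: (leq_bigmax (widen_ord (leqnSn k.+1) j)).
have hN k : limn u - u (N k) <= 1 / 4 ^+ k.
  apply: le_trans (hN0 k); rewrite lerB// nd// /N (leq_trans _ (leq_addl _ _))//.
  exact: (leq_bigmax (@ord_max k)).
pose S k := lincomb psi c (index_iota 0 (N k)).
have S2 k : sqint mu D (S k) by exact: sqint_lincomb.
have SB k x : S k.+1 x - S k x = lincomb psi c (index_iota (N k) (N k.+1)) x.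
  rewrite /S /lincomb [X in X - _](@big_cat_nat _ _ _ (N k))//=.
  by rewrite addrAC subrr add0r.
have [k|] := @L2_complete _ _ _ mu D S 1 mD S2; last set f := pointwise_lim _ => f2 cvf.
  rewrite (@eq_Rintegral _ _ _ mu D (fun x => lincomb psi c (index_iota (N k) (N k.+1)) x ^+ 2)); last first.
    by move=> x _; rewrite SB.
  rewrite -dot_sqr dot_lincomb ?iota_uniq//.
  have -> : \sum_(i <- index_iota (N k) (N k.+1)) c i ^+ 2 = u (N k.+1) - u (N k).
    by rewrite /u [X in X - _](@big_cat_nat _ _ _ (N k))//= addrAC subrr add0r.
  by apply: le_trans (hN k); rewrite lerB.
(* By Cauchy-Schwarz the coefficients of [S k] converge to those of [f], and they equal [c i] as
   soon as [N k] exceeds [i]. *)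
have co i : dot f (psi i) = c i.
  have cv0 : (dot (S k) (psi i) - dot f (psi i)) ^+ 2 @[k --> \oo] --> (0 : R).
    apply: (squeeze_cvgr _ (cvg_cst 0) cvf).
    apply: nearW => k; rewrite sqr_ge0/= -dotBl//; last exact: on.1.
    apply: (le_trans (dot_cs _ _)); [exact: sqintB|exact: on.1|].
    by rewrite on.2 eqxx mulr1 dot_sqr.
  have cvc : (dot (S k) (psi i) - dot f (psi i)) ^+ 2 @[k --> \oo] --> (c i - dot f (psi i)) ^+ 2.
    apply: cvg_near_cst; exists i.+1 => // k /= ik.
    rewrite dot_lincomb_psi ?iota_uniq// mem_index_iota leq0n/=.
    by rewrite (leq_trans ik)// leq_addr.
  have /eqP : (c i - dot f (psi i)) ^+ 2 = 0 by exact: (Rcvg_unique cvc cv0).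
  by rewrite sqrf_eq0 subr_eq0 => /eqP.
exists f => //; split => //.
have cvs : u (N k) @[k --> \oo] --> dot f f.
  have -> : (fun k => u (N k)) =
     fun k => dot f f - \int[mu]_(x in D) ((S k x - f x) ^+ 2).
    apply/funext => k; rewrite -dot_sqr /S.
    have -> : c = fun i => dot f (psi i) by apply/funext => i; rewrite co.
    rewrite dot_lincomb_dist ?iota_uniq// subKr /u.
    by apply: eq_bigr => i _; rewrite co.
  by rewrite -[X in _ --> X]subr0; apply: cvgB => //; exact: cvg_cst.
have Noo : N k @[k --> \oo] --> \oo.
  apply/cvgnyPge => M; near=> k; rewrite /N (leq_trans _ (leq_addr _ _))//.
  by near: k; exact: nbhs_infty_ge.
have cvs' : u (N k) @[k --> \oo] --> limn u by apply: cvg_comp Noo _; exact: cvu.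
by rewrite (Rcvg_unique cvs cvs').
Unshelve. all: by end_near. Qed.

Lemma eq_coef_ae psi f g : orthonormal psi -> total psi ->
  sqint mu D f -> sqint mu D g ->
  (forall n, dot f (psi n) = dot g (psi n)) -> {ae mu, forall x, D x -> f x = g x}.
Proof.
move=> on tot f2 g2 fg; have d2 : sqint mu D (fun x => f x - g x) by exact: sqintB.
have := dot_eq0 d2; rewrite tot//; last first.
  by move=> n; rewrite dotBl ?fg ?subrr//; exact: on.1.
move=> /(_ erefl); apply: ae_imply1 => x h Dx; apply/eqP; rewrite -subr_eq0.
by apply/eqP; exact: h.
Qed.

(** The function that Riesz-Fischer builds from the coefficients of [f] shares them with [f], so
    totality identifies the two almost everywhere. *)
Lemma parseval psi f : orthonormal psi -> total psi -> sqint mu D f ->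
  \sum_(0 <= i < n) dot f (psi i) ^+ 2 @[n --> \oo] --> dot f f.
Proof.
move=> on tot f2.
have [|g g2 [co cvg]] := @riesz_fischer psi (fun i => dot f (psi i)) (dot f f) on.
  by move=> n; apply: bessel => //; exact: iota_uniq.
have fg : {ae mu, forall x, D x -> f x = g x} by apply: (eq_coef_ae on tot) => // n; rewrite co.
by rewrite (eq_dot fg fg).
Qed.

(** Polarisation of [parseval]. *)
Lemma parseval2 psi f g : orthonormal psi -> total psi ->
  sqint mu D f -> sqint mu D g ->
  \sum_(0 <= i < n) dot f (psi i) * dot g (psi i) @[n --> \oo] --> dot f g.
Proof.
move=> on tot f2 g2.
have p2 : sqint mu D (fun x => f x + g x) by exact: sqintD.
have m2 : sqint mu D (fun x => f x - g x) by exact: sqintB.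
have -> : dot f g = (dot (fun x => f x + g x) (fun x => f x + g x) -
    dot (fun x => f x - g x) (fun x => f x - g x)) * 4^-1.
  rewrite dotDl// dotBl// [dot f (fun x => f x + _)]dotC.
  rewrite [dot g (fun x => f x + _)]dotC [dot f (fun x => f x - _)]dotC.
  rewrite [dot g (fun x => f x - _)]dotC ![dot (fun x => f x - _) _]dotBl//.
  by rewrite !dotDl// [dot g f]dotC; field.
have -> : (fun n => \sum_(0 <= i < n) dot f (psi i) * dot g (psi i)) =
   fun n => (\sum_(0 <= i < n) dot (fun x => f x + g x) (psi i) ^+ 2 -
     \sum_(0 <= i < n) dot (fun x => f x - g x) (psi i) ^+ 2) * 4^-1.
  apply/funext => n; rewrite -sumrB mulr_suml; apply: eq_bigr => i _.
  by have pi2 := on.1 i; rewrite dotDl// dotBl//; field.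
by apply: cvgM; [apply: cvgB; exact: parseval|exact: cvg_cst].
Qed.

End orthonormal_systems.

(** * Integration by parts and vanishing primitives *)

Section primitives.
Context (R : realType).
Notation mu := (@lebesgue_measure R).
Implicit Types (f g F G : R -> R) (t : R).

Lemma ac_is_derive t F f : 0 <= t -> (forall x, is_derive x (1 : R) F (f x)) ->
  continuous f -> ac t f F.
Proof.
move=> t0 dF cf; have cF : continuous F.
  by move=> x; apply/differentiable_continuous/derivable1_diffP; have [] := dF x.
have f1 x : mu.-integrable `[0, x] (EFin \o f).
  by apply: continuous_compact_integrable; [exact: segment_compact|exact: continuous_subspaceT].
split=> // x /andP[x0 xt]; move: x0; rewrite le_eqVlt => /predU1P[<-|x0].
  by rewrite set_itv1 Rintegral_set1 addr0.
have := @continuous_FTC2 _ f F 0 x x0 (continuous_subspaceT cf).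
rewrite /Rintegral => ->; first by rewrite -EFinB/= addrC subrK.
  split; first by move=> y _; have [] := dF y.
    by apply: cvg_at_right_filter; exact: cF.
  by apply: cvg_at_left_filter; exact: cF.
by move=> y _; rewrite derive1E; have [_ ->] := dF y.
Qed.

Lemma Rintegral_by_parts t f F g G : 0 <= t -> ac t f F -> ac t g G ->
  \int[mu]_(x in `[0, t]) (f x * G x) =
  F t * G t - F 0 * G 0 - \int[mu]_(x in `[0, t]) (F x * g x).
Proof.
move=> t0 aF aG; have aFG := ac_mul t0 aF aG.
have := aFG.2 t; rewrite t0 lexx => /(_ isT) ->; rewrite RintegralD//.
- by rewrite [F 0 * _ + _]addrC addrK addrK.
- apply: eq_integrable (ac_mulr_integrable t0 aG aF.1) => // x _ /=.
  by rewrite mulrC.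
- exact: ac_mulr_integrable t0 aF aG.1.
Qed.

Lemma ac_sqint t f F : 0 <= t -> ac t f F -> sqint mu `[0, t] F.
Proof.
move=> t0 aF; have mF := ac_measurable t0 aF; have [M M0 FM] := ac_bounded t0 aF.
split=> //; apply: (itv_bounded_integrable (M := M ^+ 2)).
  exact: measurable_funX.
by move=> x xt; rewrite normrX lerXn2r ?nnegrE// FM.
Qed.

(** Lebesgue differentiation: after extension by zero to the line, the primitive is identically
    zero, and its derivative is [f] almost everywhere. *)
Lemma primitive0_ae t f : 0 < t -> mu.-integrable `[0, t] (EFin \o f) ->
  (forall x, 0 <= x <= t -> \int[mu]_(y in `[0, x]) f y = 0) ->
  {ae mu, forall x, `[0, t]%classic x -> f x = 0}.
Proof.
move=> t0 f1 F0; pose g := f \_ `[0, t].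
have g1 : mu.-integrable setT (EFin \o g).
  by rewrite /g -restrict_EFin; apply/(integrable_mkcond _ _).1.
have lg : locally_integrable [set: R] g by exact: integrable_locally.
have gy y : mu.-integrable `]-oo, y] (EFin \o g) by apply: integrableS g1.
have G0 x : \int[mu]_(y in `]-oo, x]) g y = 0.
  rewrite Rintegral_mkcond.
  have [x0|x0] := ltP x 0.
    rewrite (@eq_Rintegral _ _ _ mu setT (fun=> 0)) /Rintegral ?integral0//.
    move=> y _; rewrite /patch mem_setE in_itv/=; case: ifPn => // yx.
    by rewrite -/(g y) /g patch_itv leNgt (le_lt_trans yx).
  transitivity (\int[mu]_(y in `[0, (Num.min x t)]) f y); last first.
    by apply: F0; rewrite le_min x0 (ltW t0)/= ge_min lexx orbT.
  rewrite [RHS]Rintegral_mkcond; apply: eq_Rintegral => y _.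
  rewrite /patch !mem_setE !in_itv/= le_min -/(g y) /g patch_itv.
  by case: (y <= x) => //=; rewrite ?andbT ?andbF.
have := FTC1Ny gy lg; apply: ae_imply1 => x [_ +] xt.
have -> : (fun x => \int[mu]_(y in `]-oo, x]) g y) = cst 0 by apply/funext.
by rewrite derive1_cst /g patch_itv; move: xt; rewrite /= in_itv/= => ->.
Qed.

End primitives.

(** * Cosine and sine bases of L^2(0,1) *)

Section fourier.
Context (R : realType).
Notation mu := (@lebesgue_measure R).
Notation I01 := (`[0%R, 1%R]%classic : set (measurableTypeR R)).
Implicit Types (f g F G : R -> R) (t : R).

Lemma is_derive_cosM (w x : R) :
  is_derive x 1 (fun x => cos (w * x)) (- w * sin (w * x)).
Proof.
have h : is_derive x 1 (fun x => w * x) w.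
  by apply: is_derive_eq; rewrite /GRing.scale/= mulr1.
have := @is_derive1_comp _ _ (fun y => w * y) _ _ _ (is_derive_cos (w * x)) h.
by move=> h2; apply: is_derive_eq; rewrite mulrC mulNr mulrN.
Qed.

Lemma is_derive_sinM (w x : R) :
  is_derive x 1 (fun x => sin (w * x)) (w * cos (w * x)).
Proof.
have h : is_derive x 1 (fun x => w * x) w.
  by apply: is_derive_eq; rewrite /GRing.scale/= mulr1.
have := @is_derive1_comp _ _ (fun y => w * y) _ _ _ (is_derive_sin (w * x)) h.
by move=> h2; apply: is_derive_eq; rewrite mulrC.
Qed.

Lemma continuous_sinM (w : R) : continuous (fun x => sin (w * x)).
Proof.
move=> x; apply: (@continuous_comp _ _ _ (fun y => w * y)); last exact: continuous_sin.
exact: mulrl_continuous.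
Qed.

Lemma continuous_cosM (w : R) : continuous (fun x => cos (w * x)).
Proof.
move=> x; apply: (@continuous_comp _ _ _ (fun y => w * y)); last exact: continuous_cos.
exact: mulrl_continuous.
Qed.

Lemma ac_cosM (w t : R) : 0 <= t ->
  ac t (fun x => - w * sin (w * x)) (fun x => cos (w * x)).
Proof.
move=> t0; apply: ac_is_derive => //; first exact: is_derive_cosM.
move=> x; apply: cvgM; first exact: cvg_cst.
exact: continuous_sinM.
Qed.

Lemma ac_sinM (w t : R) : 0 <= t ->
  ac t (fun x => w * cos (w * x)) (fun x => sin (w * x)).
Proof.
move=> t0; apply: ac_is_derive => //; first exact: is_derive_sinM.
move=> x; apply: cvgM; first exact: cvg_cst.
exact: continuous_cosM.
Qed.

Lemma sin_natpi n : sin (n%:R * pi) = 0 :> R.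
Proof.
elim: n => [|n ih]; first by rewrite mul0r sin0.
by rewrite -natr1 mulrDl mul1r sinD sinpi mulr0 addr0 ih mul0r.
Qed.

Lemma cos_natpi n : cos (n%:R * pi) = (-1) ^+ n :> R.
Proof.
elim: n => [|n ih]; first by rewrite mul0r cos0.
by rewrite -natr1 mulrDl mul1r cosD sinpi mulr0 subr0 ih cospi exprSr.
Qed.

(** Let [A] and [B] be the cosine and sine integrals. Two integrations by parts, whose boundary
    terms vanish with the sine, give [w B = v A] and [v B = w A]; as [v^2] differs from [w^2], both
    are zero. *)
Lemma cos_orth m n : m != n ->
  \int[mu]_(x in I01) (cos (m%:R * pi * x) * cos (n%:R * pi * x)) = 0 /\
  \int[mu]_(x in I01) (sin (m%:R * pi * x) * sin (n%:R * pi * x)) = 0.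
Proof.
move=> mn; set w : R := m%:R * pi; set v : R := n%:R * pi.
have vw : v ^+ 2 - w ^+ 2 != 0.
  have p0 : pi != 0 :> R by rewrite gt_eqF ?pi_gt0.
  rewrite subr_sqr /v /w -mulrBl -mulrDl -natrD.
  have h1 : n%:R - m%:R != 0 :> R by rewrite subr_eq0 eqr_nat eq_sym.
  have h2 : (n + m)%:R != 0 :> R.
    by rewrite pnatr_eq0; move: mn; case: (m) => [|m']; case: (n).
  exact: mulf_neq0 (mulf_neq0 h1 p0) (mulf_neq0 h2 p0).
set A := (X in X = _ /\ _); set B := (X in _ /\ X = _).
have i1 (w' v' : R) : mu.-integrable `[0, 1] (EFin \o (fun x => sin (w' * x) * sin (v' * x))).
  exact: sqint_mul (ac_sqint ler01 (ac_sinM _ ler01)) (ac_sqint ler01 (ac_sinM _ ler01)).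
have i2 (w' v' : R) : mu.-integrable `[0, 1] (EFin \o (fun x => cos (w' * x) * cos (v' * x))).
  exact: sqint_mul (ac_sqint ler01 (ac_cosM _ ler01)) (ac_sqint ler01 (ac_cosM _ ler01)).
have E1 : w * B = v * A.
  have := Rintegral_by_parts ler01 (ac_cosM w ler01) (ac_sinM v ler01).
  rewrite !mulr0 sin0 !mulr1 sin_natpi !mulr0 subrr sub0r.
  have -> : \int[mu]_(x in `[0, 1]) (- w * sin (w * x) * sin (v * x)) = - w * B.
    by rewrite -RintegralZl//; apply: eq_Rintegral => x _; rewrite mulrA.
  have -> : \int[mu]_(x in `[0, 1]) (cos (w * x) * (v * cos (v * x))) = v * A.
    by rewrite -RintegralZl//; apply: eq_Rintegral => x _; rewrite mulrCA.
  by rewrite mulNr => /oppr_inj.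
have E2 : v * B = w * A.
  have := Rintegral_by_parts ler01 (ac_cosM v ler01) (ac_sinM w ler01).
  rewrite !mulr0 sin0 !mulr1 sin_natpi !mulr0 subrr sub0r.
  have -> : \int[mu]_(x in `[0, 1]) (- v * sin (v * x) * sin (w * x)) = - v * B.
    by rewrite -RintegralZl//; apply: eq_Rintegral => x _; rewrite -mulrA [sin _ * sin _]mulrC.
  have -> : \int[mu]_(x in `[0, 1]) (cos (v * x) * (w * cos (w * x))) = w * A.
    by rewrite -RintegralZl//; apply: eq_Rintegral => x _; rewrite mulrCA [cos _ * cos _]mulrC.
  by rewrite mulNr => /oppr_inj.
have A0 : (v ^+ 2 - w ^+ 2) * A = 0.
  by transitivity (v * (v * A) - w * (w * A)); [ring|rewrite -E1 -E2; ring].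
have B0 : (v ^+ 2 - w ^+ 2) * B = 0.
  by transitivity (v * (v * B) - w * (w * B)); [ring|rewrite E1 E2; ring].
split; [move/eqP: A0|move/eqP: B0]; by rewrite mulf_eq0 (negbTE vw) => /eqP.
Qed.

(** Integration by parts shows that the two integrals are equal, and [cos^2 + sin^2 = 1] gives their
    sum. *)
Lemma cos_sqr_int n :
  \int[mu]_(x in I01) (cos (n.+1%:R * pi * x) * cos (n.+1%:R * pi * x)) = 2^-1 /\
  \int[mu]_(x in I01) (sin (n.+1%:R * pi * x) * sin (n.+1%:R * pi * x)) = 2^-1.
Proof.
set w : R := n.+1%:R * pi.
have w0 : w != 0 by rewrite mulf_neq0 ?pnatr_eq0 ?gt_eqF ?pi_gt0.
set A := (X in X = _ /\ _); set B := (X in _ /\ X = _).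
have i1 (w' v' : R) : mu.-integrable `[0, 1] (EFin \o (fun x => sin (w' * x) * sin (v' * x))).
  exact: sqint_mul (ac_sqint ler01 (ac_sinM _ ler01)) (ac_sqint ler01 (ac_sinM _ ler01)).
have i2 (w' v' : R) : mu.-integrable `[0, 1] (EFin \o (fun x => cos (w' * x) * cos (v' * x))).
  exact: sqint_mul (ac_sqint ler01 (ac_cosM _ ler01)) (ac_sqint ler01 (ac_cosM _ ler01)).
have E1 : w * B = w * A.
  have := Rintegral_by_parts ler01 (ac_cosM w ler01) (ac_sinM w ler01).
  rewrite !mulr0 sin0 !mulr1 sin_natpi !mulr0 subrr sub0r.
  have -> : \int[mu]_(x in `[0, 1]) (- w * sin (w * x) * sin (w * x)) = - w * B.
    by rewrite -RintegralZl//; apply: eq_Rintegral => x _; rewrite mulrA.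
  have -> : \int[mu]_(x in `[0, 1]) (cos (w * x) * (w * cos (w * x))) = w * A.
    by rewrite -RintegralZl//; apply: eq_Rintegral => x _; rewrite mulrCA.
  by rewrite mulNr => /oppr_inj.
have AB : A + B = 1.
  rewrite -RintegralD//.
  rewrite (@eq_Rintegral _ _ _ mu `[0, 1] (fun=> 1)); last by move=> x _; rewrite -!expr2 cos2Dsin2.
  by rewrite Rintegral_cst//= lebesgue_measure_itv/= lte01 -EFinB subr0/= mulr1.
have := mulfI w0 E1 => BA; move: AB; rewrite BA => AA.
by split; lra.
Qed.

Definition amp (n : nat) : R := if n == 0%N then 1 else Num.sqrt 2.

(** Orthonormal eigenfunctions of the Neumann and Dirichlet Laplacians. *)
Definition cosmode n x : R := amp n * cos (n%:R * pi * x).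
Definition sinmode n x : R := Num.sqrt 2 * sin (n.+1%:R * pi * x).

Lemma sqrt2_sqr : Num.sqrt 2 * Num.sqrt 2 = 2 :> R.
Proof. by rewrite -expr2 sqr_sqrtr. Qed.

Lemma amp_sqr n : amp n ^+ 2 <= 2.
Proof. by rewrite /amp; case: eqP => _; rewrite ?expr1n ?ler1n// sqr_sqrtr. Qed.

Lemma sqint_cosmode n : sqint mu I01 (cosmode n).
Proof. by apply: sqintZ => //; exact: ac_sqint (ac_cosM _ ler01). Qed.

Lemma sqint_sinmode n : sqint mu I01 (sinmode n).
Proof. by apply: sqintZ => //; exact: ac_sqint (ac_sinM _ ler01). Qed.

Lemma orthonormal_cosmode : orthonormal mu I01 cosmode.
Proof.
split; first exact: sqint_cosmode.
have c2 n : sqint mu I01 (fun x => cos (n%:R * pi * x)).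
  exact: ac_sqint (ac_cosM _ ler01).
move=> i j; rewrite /cosmode dotZl//; last exact: sqintZ.
rewrite dotC dotZl//.
have [<-|ij] := eqVneq i j; last by rewrite /dot (cos_orth _).1 ?mulr0// eq_sym.
case: i => [|i]; last by rewrite /dot (cos_sqr_int i).1 /amp/= mulrA sqrt2_sqr mulfV.
rewrite /amp/= !mul1r /dot (@eq_Rintegral _ _ _ mu I01 (fun=> 1)); last first.
  by move=> x _; rewrite !mul0r cos0 mulr1.
by rewrite Rintegral_cst//= lebesgue_measure_itv/= lte01 -EFinB subr0/= mulr1.
Qed.

Lemma orthonormal_sinmode : orthonormal mu I01 sinmode.
Proof.
split; first exact: sqint_sinmode.
have c2 n : sqint mu I01 (fun x => sin (n%:R * pi * x)).
  exact: ac_sqint (ac_sinM _ ler01).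
move=> i j; rewrite /sinmode dotZl//; last exact: sqintZ.
rewrite dotC dotZl//.
have [<-|ij] := eqVneq i j; last by rewrite /dot (cos_orth _).2 ?mulr0// eq_sym.
by rewrite /dot (cos_sqr_int i).2 mulrA sqrt2_sqr mulfV.
Qed.

Lemma within_mul_continuous F g (a b : R) : {within `[a, b], continuous F} ->
  continuous g -> {within `[a, b], continuous (fun x => F x * g x)}.
Proof.
move=> cF cg x; apply: cvgM; first exact: cF.
exact: (continuous_subspaceT cg).
Qed.

End fourier.

(** * Completeness of the cosine and sine systems *)

Section totality.
Context (R : realType).
Notation mu := (@lebesgue_measure R).
Notation I01 := (`[0%R, 1%R]%classic : set (measurableTypeR R)).
Implicit Types (f g F G H : R -> R).

(** The kernels [q^k] concentrate at [x0], where [q] attains its maximum [1]. *)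
Lemma peak H (x0 : R) : {within `[0, 1], continuous H} -> 0 < x0 < 1 ->
  (forall k, \int[mu]_(x in I01)
    (H x * (1 - (cos (pi * x) - cos (pi * x0)) ^+ 2 / 4) ^+ k) = 0) -> H x0 <= 0.
Proof.
move=> cH /andP[x00 x01] I0; rewrite leNgt; apply/negP => Hx0.
have [M M0 HM] := continuous_itv_bounded cH.
have pi0 := pi_gt0 R.
pose c := H x0 / 2; have c0 : 0 < c by rewrite divr_gt0.
have cHx0 : {for x0, continuous H}.
  have [h _ _] := (continuous_within_itvP _ ltr01).1 cH.
  by apply: h; rewrite in_itv/= x00.
have [d /= d0 Hd] : exists2 d : R, 0 < d & forall x, `|x0 - x| < d -> c < H x.
  have : \forall x \near x0, c < H x.
    by apply: cvgr_gt cHx0 _ _; rewrite /c ltr_pdivrMr// mulr_natr mulr2n ltrDl.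
  by move=> /nbhs_ballP[d /= d0 h]; exists d => // x xd; exact: h.
(* A radius that keeps the neighbourhood of [x0] inside [(0, 1)] and inside the set where
   [H > c]. *)
pose dl := Num.min (d / 2) (Num.min (x0 / 2) ((1 - x0) / 2)).
have dl0 : 0 < dl by rewrite !lt_min !divr_gt0// subr_gt0.
have dld : dl < d by rewrite gt_min; apply/orP; left; lra.
have dlx : dl < x0 by rewrite !gt_min; apply/orP; right; apply/orP; left; lra.
have dlx1 : dl < 1 - x0 by rewrite !gt_min; apply/orP; right; apply/orP; right; lra.
pose y x : R := cos (pi * x).
have ymono u v : 0 <= u <= 1 -> 0 <= v <= 1 -> (y u < y v) = (v < u).
  move=> /andP[u0 u1] /andP[v0 v1]; rewrite /y ltr_cos ?in_itv/=; last 2 first.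
  - by apply/andP; split; [rewrite mulr_ge0// ltW|rewrite -[leRHS]mulr1 ler_pM2l].
  - by apply/andP; split; [rewrite mulr_ge0// ltW|rewrite -[leRHS]mulr1 ler_pM2l].
  by rewrite ltr_pM2l.
(* The cosine is strictly decreasing on [[0, pi]], so [y x] differs from [y x0] by at least [eta]
   when [x] leaves the [dl]-neighbourhood. *)
pose eta := Num.min (y (x0 - dl) - y x0) (y x0 - y (x0 + dl)).
have eta0 : 0 < eta.
  by rewrite lt_min !subr_gt0 !ymono ?ltrBlDr ?ltrDl ?dl0//; apply/andP; split; lra.
have y1 x : `|y x| <= 1 by exact: cos_max.
have eta2 : eta <= 2.
  rewrite ge_min; apply/orP; left.
  by have := y1 (x0 - dl); have := y1 x0; rewrite !ler_norml; lra.
have [d' /= d'0 Hd'] : exists2 d' : R, 0 < d' &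
    forall x, `|x0 - x| < d' -> `|y x0 - y x| < eta / 2.
  have cy : {for x0, continuous y} by exact: continuous_cosM.
  have : \forall x \near x0, `|y x0 - y x| < eta / 2.
    by have /cvgrPdist_lt := cy; apply; rewrite divr_gt0.
  by move=> /nbhs_ballP[d' /= d'0 h]; exists d' => // x xd; exact: h.
pose d2 := Num.min (d' / 2) dl.
have d20 : 0 < d2 by rewrite lt_min dl0 divr_gt0.
have d2d : d2 < d' by rewrite gt_min; apply/orP; left; lra.
have d2dl : d2 <= dl by rewrite ge_min lexx orbT.
pose J := `[x0 - d2, x0 + d2]%classic : set (measurableTypeR R).
pose q x : R := 1 - (y x - y x0) ^+ 2 / 4.
have q01 x : 0 <= q x <= 1.
  have : (y x - y x0) ^+ 2 <= 4.
    have := y1 x; have := y1 x0; rewrite !ler_norml => /andP[? ?] /andP[? ?]; nra.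
  by have := sqr_ge0 (y x - y x0); rewrite /q; lra.
(* [r] bounds [q] from above where the deviation of [y] is at least [eta]; [rho] bounds it from
   below where the deviation is at most [eta / 2]. The contradiction comes from [r < rho]. *)
pose r := 1 - eta ^+ 2 / 4; pose rho := 1 - eta ^+ 2 / 16.
have r0 : 0 <= r by rewrite /r; nra.
have rrho : r < rho by rewrite /r /rho; nra.
have rho0 : 0 < rho by exact: le_lt_trans rrho.
have far x : 0 <= x <= 1 -> ~~ (x0 - dl <= x <= x0 + dl) -> q x <= r.
  move=> x1; rewrite negb_and -!ltNge => xx.
  have : eta <= `|y x - y x0|.
    case/orP: xx => xx.
      have : y (x0 - dl) < y x by rewrite ymono//; apply/andP; split; lra.
      move=> h; rewrite ge_min; apply/orP; left.
      by rewrite (le_trans _ (ler_norm _))// lerB// ltW.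
    have : y x < y (x0 + dl) by rewrite ymono//; apply/andP; split; lra.
    move=> h; rewrite ge_min; apply/orP; right.
    by rewrite distrC (le_trans _ (ler_norm _))// lerB// ltW.
  move=> h; have : eta ^+ 2 <= (y x - y x0) ^+ 2.
    by rewrite -[leRHS]real_normK ?num_real// lerXn2r ?nnegrE// ltW.
  by rewrite /q /r; lra.
have close x : x0 - d2 <= x <= x0 + d2 -> rho <= q x.
  move=> xx; have : `|y x0 - y x| < eta / 2.
    by apply: Hd'; rewrite ltr_norml; apply/andP; split; lra.
  move=> h; have : (y x - y x0) ^+ 2 <= (eta / 2) ^+ 2.
    by rewrite -[leLHS]real_normK ?num_real// distrC lerXn2r ?nnegrE// ltW// divr_gt0.
  by rewrite /q /rho; lra.
have cq : continuous q.
  move=> x; apply: cvgB; first exact: cvg_cst.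
  apply: cvgM; last exact: cvg_cst.
  have cyx : y z - y x0 @[z --> x] --> y x - y x0.
    by apply: cvgB; [exact: continuous_cosM|exact: cvg_cst].
  exact: (continuous_comp cyx (@exprn_continuous R 2 _)).
have cqk k : continuous (fun x => q x ^+ k).
  by move=> x; apply: (@continuous_comp _ _ _ q (fun y => y ^+ k)); [exact: cq|exact: exprn_continuous].
have iJ : mu.-integrable I01 (EFin \o \1_J).
  apply: (itv_bounded_integrable (M := 1)).
    have mJ : measurable J by exact: measurable_itv.
    have miJ : measurable_fun setT (\1_J : measurableTypeR R -> R) by exact: measurable_indic.
    exact: measurable_funTS.
  by move=> x _; rewrite indicE ger0_norm// lern1 leq_b1.
(* Bound [H q^k] below by [c rho^k] on [J] and by [- M r^k] far from [x0]; in between it is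
   nonnegative. Its integral is [0] by hypothesis, and [J] has length [2 d2]. *)
have key k : 2 * c * d2 * rho ^+ k <= M * r ^+ k.
  have : \int[mu]_(x in I01) ((c * rho ^+ k) * \1_J x - M * r ^+ k) <=
         \int[mu]_(x in I01) (H x * q x ^+ k).
    apply: le_Rintegral => //.
    - apply: integrableBr => //; first exact: integrableZr.
      apply: (itv_bounded_integrable (M := `|M * r ^+ k|)) => //.
    - apply: continuous_compact_integrable; first exact: segment_compact.
      exact: within_mul_continuous.
    move=> x; rewrite /= in_itv/= => x1; have qk0 : 0 <= q x ^+ k by rewrite exprn_ge0; case/andP: (q01 x).
    have Mr0 : 0 <= M * r ^+ k by rewrite mulr_ge0// exprn_ge0.
    rewrite indicE mem_setE in_itv/=.
    have [xJ|xJ] := boolP (x0 - d2 <= x <= x0 + d2).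
      rewrite mulr1; have cHx : c < H x.
        by apply: Hd; rewrite ltr_norml; apply/andP; split; lra.
      rewrite (@le_trans _ _ (c * rho ^+ k)) ?gerBl//.
      apply: ler_pM; [exact: ltW|by rewrite exprn_ge0// ltW|exact: ltW|].
      by rewrite lerXn2r ?nnegrE ?close// ltW// (lt_le_trans rho0)// close.
    rewrite mulr0 sub0r.
    have [xd|xd] := boolP (x0 - dl <= x <= x0 + dl).
      rewrite (@le_trans _ _ 0) ?oppr_le0// mulr_ge0// ltW// (lt_trans c0)// Hd//.
      by rewrite ltr_norml; apply/andP; split; lra.
    have := HM x x1; rewrite ler_norml => /andP[Hx _].
    have h : q x ^+ k <= r ^+ k by rewrite lerXn2r ?nnegrE ?far//; case/andP: (q01 x).
    rewrite (@le_trans _ _ (- M * q x ^+ k))//.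
      by rewrite mulNr lerN2 ler_wpM2l.
    by rewrite ler_wpM2r.
  rewrite I0 RintegralB//; last 2 first.
  - exact: integrableZr.
  - by apply: (itv_bounded_integrable (M := `|M * r ^+ k|)).
  rewrite RintegralZl// Rintegral_cst//= lebesgue_measure_itv/= lte01 -EFinB subr0/= mulr1.
  have -> : \int[mu]_(x in I01) \1_J x = 2 * d2.
    have mJ : measurable J by exact: measurable_itv.
    have -> : \int[mu]_(x in I01) \1_J x = fine (mu (J `&` I01)).
      by rewrite /Rintegral integral_indic.
    rewrite setIidl; last first.
      by apply: subset_itv; rewrite bnd_simp; lra.
    rewrite lebesgue_measure_itv/= lte_fin ifT; last by lra.
    by rewrite -EFinB/=; ring.
  by move=> h; lra.
have : M * (r / rho) ^+ n @[n --> \oo] --> (0 : R).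
  apply: (@cvg_geometric _ M (r / rho)).
  by rewrite ger0_norm ?ltr_pdivrMr ?mul1r// divr_ge0// ltW.
move=> /cvgr_lt/(_ (2 * c * d2)).
rewrite !mulr_gt0// => /(_ isT)[n _ /(_ n (leqnn n))].
rewrite /= expr_div_n mulrA ltr_pdivrMr ?exprn_gt0// => h.
by have := lt_le_trans h (key n); rewrite ltxx.
Qed.

(** Multiplying a sine of integer frequency by the kernel of [peak] gives a combination of sines
    with frequencies shifted by at most [2]. Hence [F sin(pi x)] integrates to zero against every
    power of the kernel, and [sin(pi x0) > 0]. Integer frequencies [z] make room for negative
    shifts. *)
Lemma sines_le0 F : {within `[0, 1], continuous F} ->
  (forall n, \int[mu]_(x in I01) (F x * sin (n%:R * pi * x)) = 0) ->
  forall x0, 0 < x0 < 1 -> F x0 <= 0.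
Proof.
move=> cF F0 x0 x01; pose y : R := cos (pi * x0).
pose q x : R := 1 - (cos (pi * x) - y) ^+ 2 / 4.
pose K k (z : int) x := F x * (sin (z%:~R * pi * x) * q x ^+ k).
have cq : continuous q.
  move=> x; apply: cvgB; first exact: cvg_cst.
  apply: cvgM; last exact: cvg_cst.
  have cyx : cos (pi * z) - y @[z --> x] --> cos (pi * x) - y.
    by apply: cvgB; [exact: continuous_cosM|exact: cvg_cst].
  exact: (continuous_comp cyx (@exprn_continuous R 2 _)).
have cqk k : continuous (fun x => q x ^+ k).
  by move=> x; apply: (@continuous_comp _ _ _ q (fun y => y ^+ k)); [exact: cq|exact: exprn_continuous].
have iK k z : mu.-integrable I01 (EFin \o K k z).
  apply: continuous_compact_integrable; first exact: segment_compact.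
  have cg : continuous (fun x => sin (z%:~R * pi * x) * q x ^+ k).
    by move=> x; apply: cvgM; [exact: continuous_sinM|exact: cqk].
  exact: within_mul_continuous.
have K0 k : forall z, \int[mu]_(x in I01) K k z x = 0.
  elim: k => [z|k ih z].
    case: z => n.
      by rewrite -[RHS](F0 n); apply: eq_Rintegral => x _; rewrite /K expr0 mulr1.
    rewrite (@eq_Rintegral _ _ _ mu I01 (fun x => -1 * (F x * sin (n.+1%:R * pi * x)))); last first.
      by move=> x _; rewrite /K expr0 mulr1 NegzE mulrNz !mulNr sinN mulrN mul1r.
    rewrite RintegralZl ?F0 ?mulr0//.
    by have := iK 0%N (Posz n.+1); rewrite /K; apply: eq_integrable => // x _ /=; rewrite expr0 mulr1.
  (* With [th = pi x], [q = 1 - 1/8 - y^2/4 + (y/2) cos th - (1/8) cos(2 th)]; each cosine times the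
     sine splits into two sines with half the coefficient. *)
  have KE x : K k.+1 z x = (1 - 8^-1 - y ^+ 2 / 4) * K k z x +
     (y / 4 * K k (z + 1) x + (y / 4 * K k (z - 1) x +
      (- 16^-1 * K k (z + 2) x + - 16^-1 * K k (z - 2) x))).
    have -> : K k.+1 z x = F x * q x ^+ k * (sin (z%:~R * pi * x) * q x).
      by rewrite /K exprS; ring.
    have D1 (m : int) : sin ((z + m)%:~R * pi * x) =
       sin (z%:~R * pi * x) * cos (m%:~R * (pi * x)) + cos (z%:~R * pi * x) * sin (m%:~R * (pi * x)).
      have -> : (z + m)%:~R * pi * x = z%:~R * pi * x + m%:~R * (pi * x) by rewrite intrD; ring.
      by rewrite sinD.
    rewrite /K !D1 /q.
    have -> : (1%:~R * (pi * x) : R) = pi * x by ring.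
    have -> : ((-1)%:~R * (pi * x) : R) = - (pi * x) by ring.
    have -> : ((-2)%:~R * (pi * x) : R) = - (pi * x + pi * x) by ring.
    have -> : (2%:~R * (pi * x) : R) = pi * x + pi * x by ring.
    rewrite !sinN !cosN !sinD !cosD.
    have := cos2Dsin2 (pi * x); move: (cos (pi * x)) (sin (pi * x)) => c s cs1.
    have ss : s * s = 1 - c * c by rewrite -cs1 !expr2; ring.
    move: (sin (z%:~R * _ * _)) (cos (z%:~R * _ * _)) (F x) (q x ^+ k) => S C f qq.
    by rewrite ss; field.
  under eq_Rintegral do rewrite KE.
  by rewrite !RintegralD ?RintegralZl ?ih ?mulr0 ?addr0//;
    repeat (first [exact: integrableZr|apply: integrableDr => //]).
have [x00 x011] := andP x01.
have s0 : 0 < sin (pi * x0) :> R.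
  by rewrite sin_gt0_pi// mulr_gt0 ?pi_gt0//= gtr_pMr// pi_gt0.
have : F x0 * sin (pi * x0) <= 0.
  apply: (@peak (fun x => F x * sin (pi * x))) => //.
    by apply: within_mul_continuous => //; exact: continuous_sinM.
  move=> k; rewrite -[RHS](K0 k 1); apply: eq_Rintegral => x _.
  by rewrite /K mul1r mulrA.
by rewrite pmulr_lle0.
Qed.

Lemma sines_eq0 F : {within `[0, 1], continuous F} ->
  (forall n, \int[mu]_(x in I01) (F x * sin (n%:R * pi * x)) = 0) ->
  forall x0, 0 < x0 < 1 -> F x0 = 0.
Proof.
move=> cF F0 x0 x01; apply/eqP; rewrite eq_le (sines_le0 cF F0 x01)/=.
rewrite -oppr_le0; apply: (@sines_le0 (fun x => - F x)) => //.
  by move=> x; apply: cvgN; exact: cF.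
move=> n; rewrite (@eq_Rintegral _ _ _ mu I01 (fun x => -1 * (F x * sin (n%:R * pi * x)))).
  rewrite RintegralZl ?F0 ?mulr0//.
  apply: continuous_compact_integrable; first exact: segment_compact.
  by apply: within_mul_continuous => //; exact: continuous_sinM.
by move=> x _; rewrite mulN1r mulNr.
Qed.

Lemma within01_eq0 F : {within `[0, 1], continuous F} ->
  (forall x, 0 < x < 1 -> F x = 0) -> forall x, 0 <= x <= 1 -> F x = 0.
Proof.
move=> cF F0 x /andP[]; rewrite le_eqVlt => /predU1P[<- _|x0].
  have [_ h _] := (continuous_within_itvP _ ltr01).1 cF.
  apply: (Rcvg_unique h); apply: cvg_near_cst.
  by near=> z; apply: F0; apply/andP; split; near: z; [exact: nbhs_right_gt|exact: nbhs_right_lt].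
rewrite le_eqVlt => /predU1P[->|x1]; last by apply: F0; rewrite x0.
have [_ _ h] := (continuous_within_itvP _ ltr01).1 cF.
apply: (Rcvg_unique h); apply: cvg_near_cst.
by near=> y; apply: F0; apply/andP; split; near: y; [exact: nbhs_left_gt|exact: nbhs_left_lt].
Unshelve. all: by end_near. Qed.

Lemma mI01 : measurable I01.
Proof. exact: measurable_itv. Qed.

Lemma I01_fin : (mu I01 < +oo)%E.
Proof. by rewrite /= lebesgue_measure_itv/= lte01 -EFinB ltry. Qed.

Lemma I01_1 : fine (mu I01) = 1.
Proof. by rewrite /= lebesgue_measure_itv/= lte01 -EFinB subr0. Qed.

Lemma sqint01_integrable f : sqint mu I01 f -> mu.-integrable I01 (EFin \o f).
Proof. by move=> f2; apply: sqint_L1 => //; exact: I01_fin. Qed.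

(** The primitive [F] of [f] vanishes at [0], and at [1] because [f] is orthogonal to the constant
    mode. Integration by parts then makes the continuous function [F] orthogonal to all sines, so
    [F = 0] and [f = 0] almost everywhere. *)
Lemma total_cosmode : total mu I01 (@cosmode R).
Proof.
move=> f f2 f0; have f1 := sqint01_integrable f2.
have fc n : \int[mu]_(x in I01) (f x * cos (n%:R * pi * x)) = 0.
  have c2 : sqint mu I01 (fun x => cos (n%:R * pi * x)).
    exact: ac_sqint (ac_cosM _ ler01).
  have := f0 n; rewrite dotC /cosmode dotZl// dotC => /eqP.
  rewrite mulf_eq0 => /orP[/eqP|/eqP//]; rewrite /amp.
  by case: ifP => _ /eqP; rewrite ?oner_eq0// sqrtr_eq0 leNgt ltr0n.
pose F x := 0 + \int[mu]_(y in `[0, x]) f y.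
have aF : ac 1 f F by exact: ac_primitive.
have F0 : F 0 = 0 by rewrite /F set_itv1 Rintegral_set1 addr0.
have F1 : F 1 = 0.
  rewrite /F add0r -[RHS](fc 0%N); apply: eq_Rintegral => x _.
  by rewrite !mul0r cos0 mulr1.
have cF := ac_continuous ler01 aF.
have Fs n : \int[mu]_(x in I01) (F x * sin (n%:R * pi * x)) = 0.
  case: n => [|n].
    rewrite (@eq_Rintegral _ _ _ mu I01 (fun=> 0)) /Rintegral ?integral0//.
    by move=> x _; rewrite !mul0r sin0 mulr0.
  pose w : R := n.+1%:R * pi.
  have w0 : w != 0 by rewrite mulf_neq0 ?pnatr_eq0 ?gt_eqF ?pi_gt0.
  have := Rintegral_by_parts ler01 aF (ac_cosM w ler01).
  rewrite fc F0 F1 !mul0r subrr sub0r => /esym/eqP; rewrite oppr_eq0 => /eqP.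
  have -> : \int[mu]_(x in `[0, 1]) (F x * (- w * sin (w * x))) =
      \int[mu]_(x in `[0, 1]) (- w * (F x * sin (w * x))).
    by apply: eq_Rintegral => x _; rewrite mulrCA.
  rewrite RintegralZl//.
    by move=> /eqP; rewrite mulf_eq0 oppr_eq0 (negbTE w0) => /eqP.
  exact: sqint_mul (ac_sqint ler01 aF) (ac_sqint ler01 (ac_sinM _ ler01)).
have Fz x : 0 <= x <= 1 -> F x = 0.
  by apply: within01_eq0 => // z; exact: sines_eq0.
have fz : {ae mu, forall x, `[0, 1]%classic x -> f x = 0}.
  apply: primitive0_ae => // x x1; have := Fz x x1; by rewrite /F add0r.
rewrite (eq_dot fz fz) /dot (@eq_Rintegral _ _ _ mu I01 (fun=> 0)) /Rintegral ?integral0//.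
by move=> x _; rewrite mulr0.
Qed.

(** Reduction to the cosines: the sines vanish at both ends, so integration by parts makes the
    primitive of [f], minus its mean, orthogonal to every cosine. It is therefore zero, and its
    value at [0] shows that the mean is zero too. *)
Lemma total_sinmode : total mu I01 (@sinmode R).
Proof.
move=> f f2 f0; have f1 := sqint01_integrable f2.
have s2 w : sqint mu I01 (fun x => sin (w * x)) by exact: ac_sqint (ac_sinM _ ler01).
have c2 w : sqint mu I01 (fun x => cos (w * x)) by exact: ac_sqint (ac_cosM _ ler01).
have fs n : \int[mu]_(x in I01) (f x * sin (n.+1%:R * pi * x)) = 0.
  have := f0 n; rewrite dotC /sinmode dotZl// dotC => /eqP.
  by rewrite mulf_eq0 sqrtr_eq0 leNgt ltr0n/= => /eqP.
pose F x := 0 + \int[mu]_(y in `[0, x]) f y.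
have aF : ac 1 f F by exact: ac_primitive.
have F0 : F 0 = 0 by rewrite /F set_itv1 Rintegral_set1 addr0.
have cF := ac_continuous ler01 aF.
have F2 := ac_sqint ler01 aF.
pose m := \int[mu]_(x in I01) F x.
pose K x := F x - m.
have aK : ac 1 f K by apply: eq_ac (ac_add aF (ac_cst 1 (- m))) _ _ => x _; rewrite ?addr0.
have cK := ac_continuous ler01 aK; have K2 := ac_sqint ler01 aK.
have FK n : \int[mu]_(x in I01) (K x * cos (n%:R * pi * x)) = 0.
  case: n => [|n].
    rewrite (@eq_Rintegral _ _ _ mu I01 (fun x => F x - m)); last first.
      by move=> x _; rewrite !mul0r cos0 mulr1.
    rewrite RintegralB//; last 2 first.
      exact: sqint01_integrable.
      by apply: (itv_bounded_integrable (M := `|m|)).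
    by rewrite Rintegral_cst// I01_1 mulr1 subrr.
  pose w : R := n.+1%:R * pi.
  have w0 : w != 0 by rewrite mulf_neq0 ?pnatr_eq0 ?gt_eqF ?pi_gt0.
  have := Rintegral_by_parts ler01 aK (ac_sinM w ler01).
  rewrite fs !mulr0 mulr1 sin0 sin_natpi !mulr0 subrr sub0r => /esym/eqP.
  rewrite oppr_eq0 => /eqP.
  have -> : \int[mu]_(x in `[0, 1]) (K x * (w * cos (w * x))) =
      \int[mu]_(x in `[0, 1]) (w * (K x * cos (w * x))).
    by apply: eq_Rintegral => x _; rewrite mulrCA.
  rewrite RintegralZl//; last exact: sqint_mul.
  by move=> /eqP; rewrite mulf_eq0 (negbTE w0) => /eqP.
have KK : dot mu I01 K K = 0.
  apply: total_cosmode => // n; rewrite dotC /cosmode dotZl// dotC /dot FK.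
  by rewrite mulr0.
have K0 := @dot_eq0 _ _ _ mu I01 (measurable_itv _) K K2 KK.
have Kz x : 0 <= x <= 1 -> K x = 0.
  apply: within01_eq0 => // z z1; apply/eqP; rewrite -sqrf_eq0 eq_le sqr_ge0 andbT.
  (* From almost everywhere to every interior point: [K ^+ 2] is continuous and integrates to zero
     against all the kernels. *)
  apply: (@peak (fun x => K x ^+ 2)) => //.
    rewrite (_ : (fun x => K x ^+ 2) = fun x => K x * K x); last first.
      by apply/funext => u; rewrite expr2.
    by move=> u; apply: cvgM; exact: cK.
  move=> k; rewrite (@ae_eq_Rintegral _ _ _ mu I01 _ (fun=> 0)) /Rintegral ?integral0//.
  by apply: ae_imply1 K0 => u h Iu; rewrite h// expr0n mul0r.
have m0 : m = 0.
  by have := Kz 0; rewrite lexx ler01 => /(_ isT); rewrite /K F0 sub0r => /eqP; rewrite oppr_eq0 => /eqP.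
have fz : {ae mu, forall x, `[0, 1]%classic x -> f x = 0}.
  apply: primitive0_ae => // x x1; have := Kz x x1; by rewrite /K m0 subr0 /F add0r.
rewrite (eq_dot fz fz) /dot (@eq_Rintegral _ _ _ mu I01 (fun=> 0)) /Rintegral ?integral0//.
by move=> x _; rewrite mulr0.
Qed.

End totality.
(** * H^1(0,1) in terms of Fourier coefficients *)

Section L2_interface.
Context (R : realType).
Notation mu := (@lebesgue_measure R).
Notation I01 := (`[0%R, 1%R]%classic : set (measurableTypeR R)).
Notation nu := (@lebesgue_on R `]0, 1[).
Implicit Types (f g h : L2 R).

Lemma endpoints_null : mu.-negligible ([set 0; 1] : set (measurableTypeR R)).
Proof.
have m1 (x : R) : measurable ([set x] : set (measurableTypeR R)).
  by rewrite -set_itv1; exact: measurable_itv.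
exists [set 0; 1]; split => //; first exact: measurableU.
by apply: null_set_setU; [exact: m1|exact: m1|exact: lebesgue_measure_set1|exact: lebesgue_measure_set1].
Qed.

Lemma ae_not_endpoint : {ae mu, forall x : R, ~ [set 0; 1] x}.
Proof.
have [N [mN N0 sN]] := endpoints_null.
by exists N; split => // x /= nx; apply: sN; exact: contrapT.
Qed.

(** [L2 R] lives on the open interval, whereas primitives and [ac] use the closed one; the two
    endpoints form a null set. *)
Lemma ae_I01 (P : R -> Prop) :
  {ae nu, forall x, P x} <-> {ae mu, forall x, I01 x -> P x}.
Proof.
rewrite (ae_mrestr mu (measurable_itv `]0, 1[) P); split; last first.
  apply: ae_imply1 => x h x01; apply: h.
  by move: x01; rewrite /= !in_itv/= => /andP[/ltW -> /ltW ->].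
move=> h; apply: (ae_imply2 _ h ae_not_endpoint) => x hx x01 Ix; apply: hx.
move: Ix; rewrite /= !in_itv/= => /andP[x0 x1].
rewrite !lt_neqAle x0 x1 !andbT; apply/andP; split; apply/eqP => xx; apply: x01.
  by left.
by right.
Qed.

Lemma integral_I01 (F : R -> \bar R) :
  (\int[nu]_x F x = \int[mu]_(x in I01) F x)%E.
Proof.
rewrite integral_mrestr integral_mkcond [RHS]integral_mkcond.
apply: ae_eq_integral_nomeas; have [N [mN N0 sN]] := endpoints_null.
exists N; split => // x h; apply: sN; apply: contrapT => x01; apply: h => _.
rewrite /patch !mem_setE !in_itv/= !lt_neqAle.
have [x0|x0] := eqVneq x 0; first by exfalso; apply: x01; left.
have [x1|x1] := eqVneq x 1; first by exfalso; apply: x01; right.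
by [].
Qed.

Lemma Rintegral_I01 (F : R -> R) : \int[nu]_x F x = \int[mu]_(x in I01) F x.
Proof. by rewrite /Rintegral integral_I01. Qed.

Lemma innerE f g : inner f g = dot mu I01 f g.
Proof. exact: Rintegral_I01. Qed.

Lemma L2_measurable f : measurable_fun (setT : set (measurableTypeR R)) f.
Proof. exact: measurable_funPT. Qed.

Lemma L2_sqint f : sqint mu I01 f.
Proof.
have mf := L2_measurable f; split; first exact: measurable_funTS.
have /integrableP[_ foo] := Lfun2_integrable_sqr (LfunP f).
apply/integrableP; split; last by rewrite -integral_I01.
by apply/measurable_EFinP; apply: measurable_funX; exact: measurable_funTS.
Qed.

Lemma poweR2_abse (u : R) : (`|u%:E| `^ 2 = (u ^+ 2)%:E)%E.
Proof. by rewrite abse_EFin poweR_EFin powR_mulrn// real_normK ?num_real. Qed.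

Lemma L2normE f : L2norm f = Num.sqrt (dot mu I01 f f).
Proof.
rewrite /L2norm unlock /Lnorm integral_I01.
under eq_integral do rewrite poweR2_abse.
rewrite (RintegralE (@mI01 R) (L2_sqint f).2)//= -dot_sqr.
by rewrite powR12_sqrt// dot_ge0.
Qed.

Lemma L2norm_ge0 f : 0 <= L2norm f.
Proof. by rewrite L2normE sqrtr_ge0. Qed.

Lemma L2norm_sqr f : L2norm f ^+ 2 = dot mu I01 f f.
Proof. by rewrite L2normE sqr_sqrtr// dot_ge0. Qed.

Lemma eqL2P f (F : R -> R) : (f =L2 F) <-> {ae mu, forall x, I01 x -> f x = F x}.
Proof.
rewrite -(ae_I01 (fun x => f x = F x)); split; apply: ae_imply1 => x //.
by move=> h; exact: h.
Qed.

Lemma L2_of_sqint (F : R -> R) : sqint mu I01 F ->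
  exists f : L2 R, forall x, I01 x -> f x = F x.
Proof.
move=> [mF F2]; pose G := F \_ I01.
have mG : measurable_fun setT G by apply/(measurable_restrictT _ _).1.
have GL : G \in Lfun nu 2%:E.
  rewrite inE; apply/andP; split; rewrite inE//= /finite_norm unlock /Lnorm.
  rewrite poweR_lty// integral_I01.
  under eq_integral do rewrite poweR2_abse.
  have /integrable_lty : mu.-integrable I01 (EFin \o (fun x => F x ^+ 2)) by [].
  move=> /(_ (@mI01 R)); apply: le_lt_trans.
  rewrite le_eqVlt; apply/orP; left; apply/eqP; apply: eq_integral => x xI.
  by rewrite /G patchT.
exists (Lfun_Sub (lee1n 2) GL) => x xI.
by rewrite Lfun_valP /G patchT// inE.
Qed.

Lemma L2Z a f x : (a *: f) x = a * f x.
Proof. by []. Qed.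

Lemma L2sum (I : Type) (s : seq I) (F : I -> L2 R) x :
  (\sum_(i <- s) F i) x = \sum_(i <- s) F i x.
Proof.
elim: s => [|i s ih]; first by rewrite !big_nil.
by rewrite !big_cons -ih.
Qed.

Definition coef f n : R := dot mu I01 f (@cosmode R n).

(** The Neumann eigenvalue of [cosmode n]. *)
Definition lam n : R := (n%:R * pi) ^+ 2.

Lemma lam_ge0 n : 0 <= lam n. Proof. exact: sqr_ge0. Qed.

Lemma lam0 : lam 0 = 0. Proof. by rewrite /lam mul0r expr0n. Qed.

Lemma coef_eq f g : (forall n, coef f n = coef g n) -> f =L2 g.
Proof.
move=> fg; apply/eqL2P; apply: (eq_coef_ae (@mI01 R)
  (@orthonormal_cosmode R) (@total_cosmode R)) => //; exact: L2_sqint.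
Qed.

Lemma eq_coef f g n : f =L2 g -> coef f n = coef g n.
Proof.
by move=> /eqL2P fg; apply: eq_dot => //; exact: aeW.
Qed.

Lemma coefB f g n : coef (f - g) n = coef f n - coef g n.
Proof.
rewrite /coef -dotBl//; [exact: L2_sqint|exact: L2_sqint|exact: sqint_cosmode].
Qed.

Lemma coef_parseval f g :
  \sum_(0 <= i < n) coef f i * coef g i @[n --> \oo] --> inner f g.
Proof.
rewrite innerE; apply: parseval2 => //; try exact: L2_sqint.
  exact: orthonormal_cosmode.
exact: total_cosmode.
Qed.

Lemma coef_bessel f n : \sum_(0 <= i < n) coef f i ^+ 2 <= L2norm f ^+ 2.
Proof.
rewrite L2norm_sqr; apply: bessel => //; last exact: iota_uniq.
  exact: orthonormal_cosmode.
exact: L2_sqint.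
Qed.

Lemma coef_norm f : \sum_(0 <= i < n) coef f i ^+ 2 @[n --> \oo] --> L2norm f ^+ 2.
Proof.
have := @coef_parseval f f; rewrite innerE -L2norm_sqr.
by under eq_fun do under eq_bigr do rewrite -expr2.
Qed.

Lemma L2_of_coef (c : nat -> R) C : (forall n, \sum_(0 <= i < n) c i ^+ 2 <= C) ->
  exists f : L2 R, forall n, coef f n = c n.
Proof.
move=> cC; have [F F2 [cF _]] := riesz_fischer (@mI01 R)
  (@orthonormal_cosmode R) cC.
have [f fF] := L2_of_sqint F2; exists f => n; rewrite -cF.
by apply: eq_dot; apply: aeW => x // xI; exact: fF.
Qed.

Lemma ac_primitive_L2 a g : ac 1 g (primitive a g).
Proof. by apply: ac_primitive; apply: sqint01_integrable; exact: L2_sqint. Qed.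

Lemma H1dataP f : is_H1 f -> f =L2 primitive (H1data f).1 (deriv1 f).
Proof.
move=> [a [g fg]]; rewrite /deriv1 /H1data.
by case: xgetP => [ag _ //|/(_ (a, g))].
Qed.

Lemma H1data_out f : ~ is_H1 f -> H1data f = (0, 0).
Proof.
move=> nf; rewrite /H1data; case: xgetP => [[a g] _ /= fg|//].
by exfalso; apply: nf; exists a, g.
Qed.

(** Because the sine vanishes at [0] and [1], integration by parts leaves no boundary term: the
    derivative is expanded in sines without any condition on the traces of [f]. *)
Lemma coef_deriv f a g n : f =L2 primitive a g ->
  dot mu I01 g (@sinmode R n) = - (n.+1%:R * pi) * coef f n.+1.
Proof.
move=> /eqL2P fg; have aF := ac_primitive_L2 a g; set w := n.+1%:R * pi.
have F2 := ac_sqint ler01 aF.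
have -> : coef f n.+1 = dot mu I01 (primitive a g) (@cosmode R n.+1).
  by apply: eq_dot => //; exact: aeW.
rewrite dotC /sinmode /cosmode dotZl//; last 2 first.
  exact: ac_sqint (ac_sinM _ ler01).
  exact: L2_sqint.
rewrite dotC [in RHS]dotC [in RHS]dotZl//; last exact: ac_sqint (ac_cosM _ ler01).
rewrite [in RHS]dotC /dot /amp/=.
have := Rintegral_by_parts ler01 aF (ac_sinM w ler01).
rewrite mulr1 !mulr0 sin0 /w sin_natpi !mulr0 subrr sub0r => ->.
have -> : \int[mu]_(x in `[0, 1]) (primitive a g x * (n.+1%:R * pi * cos (n.+1%:R * pi * x)))
   = \int[mu]_(x in `[0, 1]) (n.+1%:R * pi * (primitive a g x * cos (n.+1%:R * pi * x))).
  by apply: eq_Rintegral => x _; rewrite mulrCA.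
rewrite RintegralZl//; first by ring.
by apply: sqint_mul => //; exact: ac_sqint (ac_cosM _ ler01).
Qed.

Lemma deriv_parseval f h : is_H1 f -> is_H1 h ->
  \sum_(0 <= i < n) lam i * (coef f i * coef h i) @[n --> \oo] -->
  inner (deriv1 f) (deriv1 h).
Proof.
move=> Hf Hh; rewrite innerE.
have := parseval2 (@mI01 R) (@orthonormal_sinmode R) (@total_sinmode R)
  (L2_sqint (deriv1 f)) (L2_sqint (deriv1 h)).
(* [sinmode i] has frequency [i + 1] and pairs with cosine mode [i + 1]; the skipped mode
   contributes nothing since [lam 0 = 0]. *)
rewrite -[X in _ -> X]cvg_shiftS.
have -> // : (fun n => \sum_(0 <= i < n) dot mu I01 (deriv1 f) (@sinmode R i) *
    dot mu I01 (deriv1 h) (@sinmode R i)) =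
  fun n => \sum_(0 <= i < n.+1) lam i * (coef f i * coef h i).
apply/funext => n; rewrite big_nat_recl// lam0 mul0r add0r.
apply: eq_bigr => i _; rewrite (coef_deriv _ (H1dataP Hf)) (coef_deriv _ (H1dataP Hh)).
by rewrite /lam; ring.
Qed.

Lemma deriv_norm f : is_H1 f ->
  \sum_(0 <= i < n) lam i * coef f i ^+ 2 @[n --> \oo] --> L2norm (deriv1 f) ^+ 2.
Proof.
move=> Hf; have := @deriv_parseval f f Hf Hf; rewrite innerE -L2norm_sqr.
by under eq_fun do under eq_bigr do rewrite -expr2.
Qed.

Lemma deriv_bessel f n : is_H1 f ->
  \sum_(0 <= i < n) lam i * coef f i ^+ 2 <= L2norm (deriv1 f) ^+ 2.
Proof.
move=> Hf; have cv := deriv_norm Hf.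
rewrite -(cvg_lim (@Rhausdorff R) cv); apply: nondecreasing_cvgn_le.
  apply/nondecreasing_seqP => k; rewrite big_nat_recr//= lerDl.
  by rewrite mulr_ge0 ?lam_ge0 ?sqr_ge0.
by apply/cvg_ex; eexists; exact: cv.
Qed.

(** The bound makes the would-be sine coefficients of the derivative square-summable; Riesz-Fischer
    yields a derivative [g]. Its primitive has the cosine coefficients of [f] at positive
    frequencies, and the constant [a] is chosen to match the mean. *)
Lemma H1_of_coef f C :
  (forall n, \sum_(0 <= i < n) lam i * coef f i ^+ 2 <= C) -> is_H1 f.
Proof.
move=> fC; pose d n := - (n.+1%:R * pi) * coef f n.+1.
have [n|G G2 [cG _]] := @riesz_fischer _ _ _ mu I01 (@mI01 R) _ d C (@orthonormal_sinmode R).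
  have := fC n.+1; rewrite big_nat_recl// lam0 mul0r add0r; apply: le_trans.
  rewrite le_eqVlt; apply/orP; left; apply/eqP; apply: eq_bigr => i _.
  by rewrite /d /lam; ring.
have [g gG] := L2_of_sqint G2.
have gs n : dot mu I01 g (@sinmode R n) = d n.
  by rewrite -cG; apply: eq_dot; apply: aeW => x // xI; exact: gG.
pose a := coef f 0 - \int[mu]_(x in I01) primitive 0 g x.
have aF b := ac_primitive_L2 b g.
have [p pP] := L2_of_sqint (ac_sqint ler01 (aF a)).
exists a, g; have pe : p =L2 primitive a g by apply/eqL2P; exact: aeW.
suff fp : f =L2 p.
  by move/eqL2P: fp => fp; apply/eqL2P; apply: ae_imply1 fp => x h xI; rewrite h// pP.
apply: coef_eq => -[|n]; last first.
  have := coef_deriv n pe; rewrite gs /d => /mulfI -> //.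
  by rewrite oppr_eq0 mulf_neq0 ?pnatr_eq0 ?gt_eqF ?pi_gt0.
have -> : coef p 0 = \int[mu]_(x in I01) (a + primitive 0 g x).
  apply: eq_Rintegral => x xI; rewrite pP ?inE//; last by move: xI; rewrite inE.
  by rewrite /cosmode /amp/= !mul0r cos0 mulr1 mulr1 /primitive add0r.
rewrite RintegralD//; last 2 first.
- by apply: (itv_bounded_integrable (M := `|a|)).
- by apply: sqint01_integrable; exact: ac_sqint (aF 0).
by rewrite Rintegral_cst// I01_1 mulr1 /a subrK.
Qed.

Lemma int_cos_natpi n : \int[mu]_(x in I01) cos (n.+1%:R * pi * x) = 0.
Proof.
have w0 : n.+1%:R * pi != 0 :> R by rewrite mulf_neq0 ?pnatr_eq0 ?gt_eqF ?pi_gt0.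
have aS := ac_sinM (n.+1%:R * pi : R) ler01.
have := aS.2 1; rewrite ler01 lexx => /(_ isT).
rewrite mulr0 mulr1 sin0 sin_natpi add0r RintegralZl//.
  by move=> /esym/eqP; rewrite mulf_eq0 (negbTE w0) => /eqP.
by apply: sqint01_integrable; exact: ac_sqint (ac_cosM _ ler01).
Qed.

Lemma ac_shift t (c : R) : 0 <= t -> ac t (fun=> 1) (fun x => x + c).
Proof.
move=> t0; split; first by apply: (itv_bounded_integrable (M := 1)) => // x _; rewrite normr1.
move=> x /andP[x0 xt]; rewrite Rintegral_cst//= lebesgue_measure_itv/= lte_fin.
move: x0; rewrite le_eqVlt => /predU1P[<-|x0]; first by rewrite ltxx mulr0 addr0.
by rewrite x0 -EFinB/= mul1r subr0 add0r addrC.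
Qed.

(** Test the derivative against [x - 1] and [x], whose sine coefficients are
    explicit. *)
Lemma trace_series f : is_H1 f ->
  \sum_(0 <= i < n) coef f i * @cosmode R i 0 @[n --> \oo] --> trace f 0 /\
  \sum_(0 <= i < n) coef f i * @cosmode R i 1 @[n --> \oo] --> trace f 1.
Proof.
move=> Hf; have fP := H1dataP Hf; rewrite /trace.
set a := (H1data f).1; set g := (H1data f).2; rewrite -/(deriv1 f) -/g in fP *.
have aF : ac 1 g (primitive a g) by exact: ac_primitive_L2.
have g2 := L2_sqint g.
have ash c := ac_shift c (@ler01 R).
have sh2 c := ac_sqint ler01 (ash c).
have c0 : coef f 0 = \int[mu]_(x in I01) primitive a g x.
  rewrite /coef /dot; apply: ae_eq_Rintegral; move/eqL2P: fP; apply: ae_imply1 => x h xI.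
  by rewrite h// /cosmode /amp/= !mul0r cos0 !mulr1.
have bp c : dot mu I01 g (fun x => x + c) =
    primitive a g 1 * (1 + c) - primitive a g 0 * c - coef f 0.
  rewrite /dot (Rintegral_by_parts ler01 aF (ash c)) add0r c0; congr (_ - _).
  by apply: eq_Rintegral => x _; rewrite mulr1.
have sc c n : dot mu I01 (fun x => x + c) (@sinmode R n) =
   Num.sqrt 2 * (- ((-1) ^+ n.+1 * (1 + c) - c) / (n.+1%:R * pi)).
  set w : R := n.+1%:R * pi.
  have w0 : w != 0 by rewrite mulf_neq0 ?pnatr_eq0 ?gt_eqF ?pi_gt0.
  have s2 : sqint mu I01 (fun x => sin (w * x)) by exact: ac_sqint (ac_sinM _ ler01).
  rewrite dotC /sinmode dotZl//; congr (_ * _).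
  have := Rintegral_by_parts ler01 (ac_cosM w ler01) (ash c).
  rewrite mulr1 mulr0 cos0 /w cos_natpi add0r mul1r -/w.
  under [X in _ = _ - X -> _]eq_Rintegral do rewrite mulr1.
  rewrite int_cos_natpi subr0.
  have -> : \int[mu]_(x in `[0, 1]) (- w * sin (w * x) * (x + c)) =
     - w * dot mu I01 (fun x => sin (w * x)) (fun x => x + c).
    rewrite -RintegralZl//; last exact: sqint_mul.
    by apply: eq_Rintegral => x _; rewrite mulrA.
  by move=> h; apply: (mulfI w0); rewrite mulrCA mulfV// mulr1 -h mulNr opprK.
have gen c : \sum_(0 <= i < n) dot mu I01 g (@sinmode R i) * dot mu I01 (fun x => x + c) (@sinmode R i)
    @[n --> \oo] --> dot mu I01 g (fun x => x + c).
  exact: (parseval2 (@mI01 R) (@orthonormal_sinmode R) (@total_sinmode R) g2 (sh2 c)).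
have key c i : dot mu I01 g (@sinmode R i) * dot mu I01 (fun x => x + c) (@sinmode R i) =
   coef f i.+1 * (Num.sqrt 2 * ((-1) ^+ i.+1 * (1 + c) - c)).
  have w0 : i.+1%:R * pi != 0 :> R by rewrite mulf_neq0 ?pnatr_eq0 ?gt_eqF ?pi_gt0.
  rewrite (coef_deriv _ fP) sc; move: (i.+1%:R * pi) w0 => w w0.
  by field.
split.
  have h := gen (-1); rewrite bp subrr mulr0 sub0r mulrN1 opprK in h.
  rewrite -cvg_shiftS.
  have -> : (fun n => \sum_(0 <= i < n.+1) coef f i * @cosmode R i 0) =
     fun n => coef f 0 + \sum_(0 <= i < n) dot mu I01 g (@sinmode R i) *
        dot mu I01 (fun x => x + -1) (@sinmode R i).
    apply/funext => n; rewrite big_nat_recl//; congr (_ + _).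
      by rewrite /cosmode /amp/= mulr0 cos0 !mulr1.
    apply: eq_bigr => i _; rewrite key /cosmode /amp/= mulr0 cos0.
    by rewrite subrr mulr0 sub0r opprK.
  have -> : primitive a g 0 = coef f 0 + (primitive a g 0 - coef f 0) by rewrite addrC subrK.
  by apply: cvgD => //; exact: cvg_cst.
have h := gen 0; rewrite bp addr0 mulr1 mulr0 subr0 in h.
rewrite -cvg_shiftS.
have -> : (fun n => \sum_(0 <= i < n.+1) coef f i * @cosmode R i 1) =
   fun n => coef f 0 + \sum_(0 <= i < n) dot mu I01 g (@sinmode R i) *
      dot mu I01 (fun x => x + 0) (@sinmode R i).
  apply/funext => n; rewrite big_nat_recl//; congr (_ + _).
    by rewrite /cosmode /amp/= mul0r mul0r cos0 !mulr1.
  apply: eq_bigr => i _; rewrite key /cosmode /amp/= mulr1 cos_natpi.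
  by rewrite addr0 subr0 mulr1.
have -> : primitive a g 1 = coef f 0 + (primitive a g 1 - coef f 0) by rewrite addrC subrK.
by apply: cvgD => //; exact: cvg_cst.
Qed.

End L2_interface.
(** * The modes of the heat equation *)

Section heat_modes.
Context (R : realType).
Notation mu := (@lebesgue_measure R).
Notation I01 := (`[0%R, 1%R]%classic : set (measurableTypeR R)).
Implicit Types (f : L2 R) (v : R -> L2 R) (T kappa : R) (g W : R -> R) (a : nat -> R -> R).

Lemma natr_sqr_le_lam n : n%:R ^+ 2 <= lam R n.
Proof.
rewrite /lam exprMn ler_peMr ?sqr_ge0// exprn_ege1//.
by rewrite (le_trans _ (pi_ge2 R))// ler1n.
Qed.

Lemma cosmode_sqr n x : @cosmode R n x ^+ 2 <= 2.
Proof.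
by rewrite /cosmode exprMn -[leRHS]mulr1; apply: ler_pM; rewrite ?sqr_ge0 ?amp_sqr//.
Qed.

(** [4 / (lam i + k^2) <= 8 / (i + k)^2 <= 16 (1 / (i + k) - 1 / (i + k + 1))] *)
Lemma sum_resolvent k m N : (0 < k)%N ->
  \sum_(m <= i < N) 4 / (lam R i + k%:R ^+ 2) <= 16 / (m + k)%:R.
Proof.
move=> k0; have [Nm|mN] := leqP N m; first by rewrite big_geq// divr_ge0.
suff h : forall n, \sum_(m <= i < m + n) 4 / (lam R i + k%:R ^+ 2) <=
    16 / (m + k)%:R - 16 / (m + n + k)%:R.
  by rewrite -(subnKC (ltnW mN)) (le_trans (h _))// gerBl divr_ge0.
elim=> [|n ih]; first by rewrite addn0 big_geq// subrr.
rewrite addnS big_nat_recr ?leq_addr//=; apply: le_trans (lerD ih (lexx _)) _.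
set i := (m + n)%N.
suff : 4 / (lam R i + k%:R ^+ 2) <= 16 / (i + k)%:R - 16 / ((i + k)%:R + 1 : R).
  rewrite natr1 -addSn => h; apply: le_trans (lerD (lexx _) h) _.
  by rewrite addrA subrK.
have k1 : 1 <= k%:R :> R by rewrite ler1n.
have i0 : 0 <= i%:R :> R by rewrite ler0n.
have := natr_sqr_le_lam i; rewrite natrD.
move: (lam R i) (i%:R : R) (k%:R : R) i0 k1 => l x y x0 y1 xl.
have d0 : 0 < l + y ^+ 2 by nra.
have d1 : 0 < x + y by lra.
have -> : 16 / (x + y) - 16 / (x + y + 1) = 16 / ((x + y) * (x + y + 1)).
  by field; rewrite !gt_eqF//; lra.
have d2 : 0 < (x + y) * (x + y + 1) by rewrite mulr_gt0//; lra.
have h1 : (x + y) * (x + y + 1) <= (x + y) * (2 * (x + y)) by rewrite ler_wpM2l; lra.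
have h2 := sqr_ge0 (x - y).
by rewrite ler_pdivrMr// mulrAC ler_pdivlMr//; nra.
Qed.

(** Differentiate [W a^2]. The decay of [W] and of the mode give [- 2 (l + kappa) W a^2]; Young's
    inequality for [2 a G] takes back half of it and leaves [G^2 / (l + kappa)]. *)
Lemma mode_bound T kappa W W' l (G a : R -> R) : 0 <= T -> 0 < l + kappa ->
  ac T W' W -> (forall s, 0 <= s <= T -> 0 < W s) ->
  (forall s, 0 <= s <= T -> W' s <= - (2 * kappa) * W s) -> W 0 = 1 ->
  sqint mu `[0, T] G -> ac T (fun s => - l * a s + G s) a ->
  W T * a T ^+ 2 + (l + kappa) * \int[mu]_(s in `[0, T]) (W s * a s ^+ 2) <=
  a 0 ^+ 2 + (l + kappa)^-1 * \int[mu]_(s in `[0, T]) (W s * G s ^+ 2).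
Proof.
move=> T0 lk acW W_gt0 dW W0 G2 aca.
have acA := ac_mul T0 aca aca; have acWA := ac_mul T0 acW acA.
have WA1 : mu.-integrable `[0, T] (EFin \o (fun s => W s * a s ^+ 2)).
  by apply: ac_mulr_integrable acW _ => //; exact: (ac_sqint T0 aca).2.
have WG1 : mu.-integrable `[0, T] (EFin \o (fun s => W s * G s ^+ 2)).
  by apply: ac_mulr_integrable acW _ => //; exact: G2.2.
have := acWA.2 T; rewrite lexx T0 => /(_ isT); rewrite W0 mul1r -!expr2 => ->.
rewrite -addrA lerD2l -lerBrDr -!RintegralZl//.
rewrite -RintegralB//; try by apply: integrableZr.
apply: le_Rintegral => //; first exact: ac_integrable acWA.
  by apply: integrableBr => //; exact: integrableZr.
move=> s; rewrite /= in_itv/= => sT; have := dW s sT; have := W_gt0 s sT.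
move: (W s) (W' s) (a s) (G s) => w w' x y w0 ww'.
have h : 2 * x * y <= (l + kappa) * x ^+ 2 + (l + kappa)^-1 * y ^+ 2.
  have := sqr_ge0 ((l + kappa) * x - y); move: (l + kappa) lk => c c0 h.
  rewrite -(ler_pM2l c0) mulrDr (mulrA c c^-1) mulfV ?gt_eqF// mul1r; nra.
have h1 := ler_wpM2l (ltW w0) h.
have h2 := ler_wpM2r (sqr_ge0 x) ww'; nra.
Qed.

Definition heat_modes (g0 g1 : R -> R) (a : nat -> R -> R) T := forall n,
  ac T (fun s => - lam R n * a n s + (g1 s * cosmode n 1 - g0 s * cosmode n 0)) (a n).

Lemma heat_modesB g0 g1 a g0' g1' a' T : heat_modes g0 g1 a T -> heat_modes g0' g1' a' T ->
  heat_modes (fun s => g0 s - g0' s) (fun s => g1 s - g1' s)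
    (fun n s => a n s - a' n s) T.
Proof.
move=> h h' n; apply: eq_ac (ac_add (h n) (ac_scale (-1) (h' n))) _ _ => s _ /=.
  by ring.
by rewrite mulN1r.
Qed.

Lemma eq_heat_modes g0 g1 a a' T : heat_modes g0 g1 a T ->
  (forall n s, 0 <= s <= T -> a n s = a' n s) -> heat_modes g0 g1 a' T.
Proof. by move=> h e n; apply: eq_ac (h n) _ _ => s sT; rewrite ?e. Qed.

Lemma heat_modesS s T g0 g1 a : s <= T -> heat_modes g0 g1 a T -> heat_modes g0 g1 a s.
Proof. by move=> sT h n; exact: acS (h n). Qed.

(** Variation of constants in each mode. *)
Lemma heat_mode_exists g0 g1 (c : nat -> R) :
  (forall T, 0 <= T -> mu.-integrable `[0, T] (EFin \o g0)) ->
  (forall T, 0 <= T -> mu.-integrable `[0, T] (EFin \o g1)) ->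
  exists a, [/\ forall n, a n 0 = c n & forall T, 0 <= T -> heat_modes g0 g1 a T].
Proof.
move=> g01 g11.
pose G n s := g1 s * @cosmode R n 1 - g0 s * @cosmode R n 0.
have G1 n T : 0 <= T -> mu.-integrable `[0, T] (EFin \o G n).
  move=> T0; apply: integrableBr => //.
    have -> : (fun s => g1 s * @cosmode R n 1) = fun s => @cosmode R n 1 * g1 s.
      by apply/funext => s; rewrite mulrC.
    by apply: integrableZr => //; exact: g11.
  have -> : (fun s => g0 s * @cosmode R n 0) = fun s => @cosmode R n 0 * g0 s.
    by apply/funext => s; rewrite mulrC.
  by apply: integrableZr => //; exact: g01.
have acid (c' T : R) : 0 <= T -> ac T (fun=> c') (fun s => c' * s).
  move=> T0; apply: eq_ac (ac_scale c' (ac_shift 0 T0)) _ _ => s _ /=.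
    by rewrite mulr1.
  by rewrite addr0.
have acE (c' T : R) : 0 <= T -> ac T (fun s => c' * expR (c' * s)) (fun s => expR (c' * s)).
  by move=> T0; exact: ac_exp (acid c' T T0).
pose a n t := expR (- lam R n * t) *
  (c n + \int[mu]_(s in `[0, t]) (expR (lam R n * s) * G n s)).
exists a; split=> [n|T T0 n].
  by rewrite /a mulr0 expR0 mul1r set_itv1 Rintegral_set1 addr0.
have EG1 : mu.-integrable `[0, T] (EFin \o (fun s => expR (lam R n * s) * G n s)).
  by apply: ac_mulr_integrable (acE _ T T0) _ => //; exact: G1.
apply: eq_ac (ac_mul T0 (acE (- lam R n) T T0) (ac_primitive (c n) EG1)) _ _ => s _ //=.
rewrite mulrA [X in _ = _ + X](_ : _ = G n s)// [RHS]/=.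
rewrite -/(G n s) /a mulrA; congr (_ + _).
by rewrite mulNr expRN mulVf ?expR_eq0 ?mul1r.
Qed.

(** The weight in time that makes the feedback maps contractions. *)
Definition weight (kappa T : R) (u W : R -> R) := exists W',
  [/\ ac T W' W, forall s, 0 <= s <= T -> 0 < W s,
    forall s, 0 <= s <= T -> W' s <= - (2 * kappa) * (1 + u s ^+ 2) * W s & W 0 = 1].

(** The weight does not depend on [T], which lets one fixed point serve the whole half-line. *)
Lemma weight_exists kappa u : (forall T, 0 <= T -> sqint mu `[0, T] u) ->
  exists W, forall T, 0 <= T -> weight kappa T u W.
Proof.
move=> u2; pose th t := \int[mu]_(s in `[0, t]) (1 + u s ^+ 2).
exists (fun t => expR (- (2 * kappa) * th t)) => T T0.
have th1 : mu.-integrable `[0, T] (EFin \o (fun s => 1 + u s ^+ 2)).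
  apply: integrableDr => //; last exact: (u2 T T0).2.
  by apply: (itv_bounded_integrable (M := 1)) => // x _; rewrite normr1.
have acth : ac T (fun s => 1 + u s ^+ 2) th.
  by apply: eq_ac (ac_primitive 0 th1) _ _ => // s _; rewrite add0r.
exists (fun s => - (2 * kappa) * (1 + u s ^+ 2) * expR (- (2 * kappa) * th s)); split=> //.
- exact: ac_exp (ac_scale (- (2 * kappa)) acth).
- by move=> s _; exact: expR_gt0.
- by rewrite /th set_itv1 Rintegral_set1 mulr0 expR0.
Qed.

Lemma weight_decr T kappa u W : 0 <= T -> 0 <= kappa -> weight kappa T u W ->
  forall s, 0 <= s <= T -> W T <= W s <= 1.
Proof.
move=> T0 k0 [W' [acW W0 dW W1]].
have le x y : 0 <= x -> x <= y -> y <= T -> W y <= W x.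
  move=> x0 xy yT; rewrite -subr_le0 (ac_incr acW)//.
  rewrite -oppr_ge0 -mulN1r -RintegralZl//; last first.
    by apply: integrable_itvS acW.1.
  apply: Rintegral_ge0 => // z; rewrite /= in_itv/= => /andP[xz zy].
  have zT : 0 <= z <= T by rewrite (le_trans x0 xz) (le_trans zy).
  have := dW z zT; have := W0 z zT => wz h; rewrite mulN1r oppr_ge0 (le_trans h)//.
  by rewrite mulr_le0_ge0 ?(ltW wz)// mulr_le0_ge0 ?addr_ge0 ?sqr_ge0// oppr_le0 mulr_ge0.
move=> s /andP[s0 sT]; rewrite le//= -W1; exact: le.
Qed.

(** The heat estimates spend only the constant part of the decay rate; the part with [u^2] is kept
    for [drift_bound]. *)
Lemma weight_rate T kappa u W : 0 <= kappa -> weight kappa T u W -> exists W',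
  [/\ ac T W' W, forall s, 0 <= s <= T -> 0 < W s,
    forall s, 0 <= s <= T -> W' s <= - (2 * kappa) * W s & W 0 = 1].
Proof.
move=> k0 [W' [acW W0 dW W1]]; exists W'; split=> // s sT; apply: (le_trans (dW s sT)).
rewrite ler_wpM2r ?(ltW (W0 s sT))// mulNr lerN2 ler_peMr ?mulr_ge0//.
by rewrite lerDl sqr_ge0.
Qed.

End heat_modes.

(** * Weighted estimates for traces, energy and derivatives *)

Section heat_estimates.
Context (R : realType).
Notation mu := (@lebesgue_measure R).
Notation itv0 T := (`[0%R, T]%classic : set (measurableTypeR R)).
Implicit Types (f h : L2 R) (v : R -> L2 R) (T kappa : R) (g W : R -> R).

Lemma weighted_cauchy_schwarz (I : Type) (s : seq I) (p a b : I -> R) :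
  (forall i, 0 < p i) ->
  (\sum_(i <- s) a i * b i) ^+ 2 <=
  (\sum_(i <- s) a i ^+ 2 / p i) * (\sum_(i <- s) p i * b i ^+ 2).
Proof.
move=> p0; apply: discriminant.
  by apply: sumr_ge0 => i _; rewrite mulr_ge0 ?sqr_ge0 ?ltW.
move=> t; have -> : \sum_(i <- s) a i ^+ 2 / p i + 2 * t * \sum_(i <- s) a i * b i +
    t ^+ 2 * \sum_(i <- s) p i * b i ^+ 2 = \sum_(i <- s) p i * (a i / p i + t * b i) ^+ 2.
  rewrite !mulr_sumr -!big_split/=; apply: eq_bigr => i _; field; exact: lt0r_neq0.
by apply: sumr_ge0 => i _; rewrite mulr_ge0 ?sqr_ge0 ?ltW.
Qed.

Lemma resolvent_gt0 k n : (0 < k)%N -> 0 < lam R n + k%:R ^+ 2.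
Proof. by move=> k0; rewrite ltr_wpDl ?lam_ge0// exprn_gt0// ltr0n. Qed.

Lemma is_H1B f h : is_H1 f -> is_H1 h -> is_H1 (f - h).
Proof.
move=> Hf Hh; apply: (@H1_of_coef _ _
  (2 * L2norm (deriv1 f) ^+ 2 + 2 * L2norm (deriv1 h) ^+ 2)) => n.
apply: le_trans (lerD (ler_wpM2l (ler0n R 2) (deriv_bessel n Hf))
  (ler_wpM2l (ler0n R 2) (deriv_bessel n Hh))).
rewrite !mulr_sumr -big_split/=; apply: ler_sum => i _.
rewrite coefB; have := sqrD_le (coef f i) (- coef h i); rewrite sqrrN.
by move=> /(ler_wpM2l (lam_ge0 R i)); lra.
Qed.

Definition endpoint (x : R) := x = 0 \/ x = 1.

Lemma trace_cvg f x : endpoint x -> is_H1 f ->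
  \sum_(0 <= i < n) coef f i * cosmode i x @[n --> \oo] --> trace f x.
Proof. by move=> [->|->] /trace_series[]. Qed.

(** Outside [H^1] the default [(0, 0)] of [H1data] applies. The value [0] keeps
    [t |-> trace (v t) x] measurable across the null set of bad times. *)
Lemma trace_out f x : ~ is_H1 f -> trace f x = 0.
Proof.
move=> nf; rewrite /trace H1data_out// /primitive add0r.
by rewrite /Rintegral integral0_eq.
Qed.

Lemma deriv1_out f : ~ is_H1 f -> deriv1 f = 0.
Proof. by move=> nf; rewrite /deriv1 H1data_out. Qed.

(** [H1data] is a choice and so not additive by construction; the cosine series of the trace is. *)
Lemma traceB f h x : endpoint x -> is_H1 f -> is_H1 h ->
  trace (f - h) x = trace f x - trace h x.
Proof.
move=> ex Hf Hh; have c2 := trace_cvg ex (is_H1B Hf Hh).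
apply: (Rcvg_unique c2).
rewrite (_ : (fun n => _) = fun n => (\sum_(0 <= i < n) coef f i * cosmode i x) -
    \sum_(0 <= i < n) coef h i * cosmode i x).
  by apply: cvgB; exact: trace_cvg.
by apply/funext => n; rewrite -sumrB; apply: eq_bigr => i _; rewrite coefB mulrBl.
Qed.

Lemma H1_of_weighted f k C : (0 < k)%N ->
  (forall n, \sum_(0 <= i < n) (lam R i + k%:R ^+ 2) * coef f i ^+ 2 <= C) ->
  is_H1 f.
Proof.
move=> k0 fC; apply: (@H1_of_coef _ _ C) => n; apply: le_trans (fC n).
by apply: ler_sum => i _; rewrite ler_wpM2r ?sqr_ge0// lerDl sqr_ge0.
Qed.

(** Cauchy-Schwarz with weights [lam i + k^2]. The dual factor is at most half of the sum in
    [sum_resolvent], since the squared modes are at most [2]: this is the gain [8 / k]. *)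
Lemma partial_trace_sqr_le f x k n : endpoint x -> (0 < k)%N ->
  (\sum_(0 <= i < n) coef f i * cosmode i x) ^+ 2 <=
  8 / k%:R * \sum_(0 <= i < n) (lam R i + k%:R ^+ 2) * coef f i ^+ 2.
Proof.
move=> ex k0; under eq_bigr do rewrite mulrC.
apply: (le_trans (weighted_cauchy_schwarz _ _ _ (fun i => resolvent_gt0 i k0))).
apply: ler_wpM2r.
  by apply: sumr_ge0 => i _; rewrite mulr_ge0 ?sqr_ge0// ltW// resolvent_gt0.
have := sum_resolvent R 0 n k0; rewrite add0n => h.
rewrite -(ler_pM2l (ltr0n R 2)).
apply: (@le_trans _ _ (\sum_(0 <= i < n) 4 / (lam R i + k%:R ^+ 2))); last first.
  by rewrite (le_trans h)// mulrA -natrM.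
rewrite mulr_sumr; apply: ler_sum => i _; rewrite mulrA.
rewrite ler_wpM2r ?invr_ge0 ?(ltW (resolvent_gt0 i k0))//.
by have := cosmode_sqr i x; lra.
Qed.

Lemma trace_sqr_le f x k C : endpoint x -> (0 < k)%N ->
  (forall n, \sum_(0 <= i < n) (lam R i + k%:R ^+ 2) * coef f i ^+ 2 <= C) ->
  trace f x ^+ 2 <= 8 / k%:R * C.
Proof.
move=> ex k0 fC; have Hf := H1_of_weighted k0 fC.
have cv := trace_cvg ex Hf.
have cv2 : (\sum_(0 <= i < n) coef f i * cosmode i x) ^+ 2 @[n --> \oo] --> trace f x ^+ 2.
  by under eq_cvg do rewrite expr2; exact: cvgM.
rewrite -(cvg_lim (@Rhausdorff R) cv2); apply: limr_le.
  by apply/cvg_ex; eexists; exact: cv2.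
apply: nearW => n; apply: (le_trans (partial_trace_sqr_le f n ex k0)).
by rewrite ler_wpM2l// divr_ge0.
Qed.

(** The mode [0] is controlled by the trace, the others by the derivative. *)
Lemma L2norm_le_trace f x : endpoint x -> is_H1 f ->
  L2norm f ^+ 2 <= 2 * trace f x ^+ 2 + 17 * L2norm (deriv1 f) ^+ 2.
Proof.
move=> ex Hf; pose D := L2norm (deriv1 f) ^+ 2.
have lam1 i : (0 < i)%N -> 1 <= lam R i.
  move=> i0; apply: le_trans (natr_sqr_le_lam R i); rewrite exprn_ege1// ler1n//.
have Dle n : \sum_(1 <= i < n.+1) lam R i * coef f i ^+ 2 <= D.
  have := deriv_bessel n.+1 Hf; rewrite big_ltn// lam0 mul0r add0r.
  exact.
have modes n : \sum_(1 <= i < n.+1) coef f i ^+ 2 <= D.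
  apply: le_trans (Dle n); apply: ler_sum_nat => i /andP[i0 _].
  by rewrite ler_peMl ?sqr_ge0 ?lam1.
(* Weights with [k = 1]: the resolvent sum started at [1] contributes at most [4], and
   [lam i + 1 <= 2 * lam i] for [i >= 1]. *)
have osc n : (\sum_(1 <= i < n.+1) coef f i * cosmode i x) ^+ 2 <= 8 * D.
  under eq_bigr do rewrite mulrC.
  have k0 : (0 < 1)%N by [].
  apply: (le_trans (weighted_cauchy_schwarz _ _ _ (fun i => resolvent_gt0 i k0))).
  have -> : 8 * D = 4 * (2 * D) by rewrite mulrA -natrM.
  apply: ler_pM.
  - by apply: sumr_ge0 => i _; rewrite divr_ge0 ?sqr_ge0// ltW// resolvent_gt0.
  - by apply: sumr_ge0 => i _; rewrite mulr_ge0 ?sqr_ge0// ltW// resolvent_gt0.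
  - have h := sum_resolvent R 1 n.+1 k0.
    rewrite -(ler_pM2l (ltr0n R 2)).
    apply: (@le_trans _ _ (\sum_(1 <= i < n.+1) 4 / (lam R i + 1%:R ^+ 2))).
      rewrite mulr_sumr; apply: ler_sum => i _; rewrite mulrA.
      rewrite ler_wpM2r ?invr_ge0 ?(ltW (resolvent_gt0 i k0))//.
      by have := cosmode_sqr i x; lra.
    apply: (le_trans h); rewrite ler_pdivrMr//; lra.
  - apply: (@le_trans _ _ (2 * \sum_(1 <= i < n.+1) lam R i * coef f i ^+ 2)).
      rewrite mulr_sumr; apply: ler_sum_nat => i /andP[i0 _]; rewrite mulrA.
      by rewrite ler_wpM2r ?sqr_ge0//; have := lam1 i i0; rewrite expr1n; lra.
    by rewrite ler_wpM2l.
have cosmode0 : @cosmode R 0 x = 1 by rewrite /cosmode /amp/= !mul0r cos0 mulr1.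
have cvo : (\sum_(1 <= i < n.+1) coef f i * cosmode i x) ^+ 2 @[n --> \oo] -->
    (trace f x - coef f 0) ^+ 2.
  have : \sum_(1 <= i < n.+1) coef f i * cosmode i x @[n --> \oo] -->
      trace f x - coef f 0.
    have := trace_cvg ex Hf; rewrite -cvg_shiftS => cv.
    rewrite (_ : (fun n => _) = fun n => \sum_(0 <= i < n.+1) coef f i * cosmode i x - coef f 0).
      by apply: cvgB => //; exact: cvg_cst.
    by apply/funext => n; rewrite [in RHS]big_ltn// cosmode0 mulr1 addrC addKr.
  by move=> cv; under eq_cvg do rewrite expr2; exact: cvgM.
have h8 : (trace f x - coef f 0) ^+ 2 <= 8 * D.
  rewrite -(cvg_lim (@Rhausdorff R) cvo); apply: limr_le.
    by apply/cvg_ex; eexists; exact: cvo.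
  exact: nearW.
have hc0 : coef f 0 ^+ 2 <= 2 * trace f x ^+ 2 + 16 * D.
  have := sqrD_le (trace f x) (coef f 0 - trace f x); rewrite addrC subrK.
  by move: h8; rewrite -sqrrN opprB; lra.
rewrite -(cvg_lim (@Rhausdorff R) (@coef_norm R f)); apply: limr_le.
  by apply/cvg_ex; eexists; exact: coef_norm.
exists 1%N => // -[//|n] _; rewrite big_ltn// -/D.
by have := modes n; lra.
Qed.

Section measurability.
Variables (D : set (measurableTypeR R)) (v : R -> L2 R).
Hypothesis mD : measurable D.
Hypothesis mv : forall n, measurable_fun D (fun t => coef (v t) n).

Let M := [set t : measurableTypeR R | D t /\ is_H1 (v t)].

Lemma measurable_coef_sum (F : nat -> R) N :
  measurable_fun D (fun t => \sum_(0 <= i < N) F i * coef (v t) i ^+ 2).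
Proof.
by apply: measurable_sum => i; apply: measurable_funM => //; exact: measurable_funX.
Qed.

(** Membership in [H^1] means that the partial sums of [lam i * coef ^+ 2] stay below some integer,
    which is a countable union of countable intersections. *)
Lemma measurable_H1set : measurable M.
Proof.
pose S N t := \sum_(0 <= i < N) lam R i * coef (v t) i ^+ 2.
have -> : M = \bigcup_(K in setT) \bigcap_(N in setT) (D `&` (S N) @^-1` `]-oo, K%:R]).
  apply/seteqP; split => [t [Dt Ht]|t [K _ hK]].
    have [K hK] : exists K : nat, L2norm (deriv1 (v t)) ^+ 2 <= K%:R.
      by exists (Num.truncn (L2norm (deriv1 (v t)) ^+ 2)).+1; rewrite ltW// truncnS_gt.
    exists K => // N _; split => //=; rewrite in_itv/=.
    by rewrite (le_trans _ hK)//; exact: deriv_bessel.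
  split; first by have [] := hK 0%N I.
  by apply: (@H1_of_coef _ _ K%:R) => n; have [_] := hK n I; rewrite /= in_itv.
apply: bigcup_measurable => K _; apply: bigcap_measurable; first by exists 0%N.
by move=> N _; apply: measurable_coef_sum.
Qed.

(** Multiplying the approximants by the indicator of the [H^1] times makes them converge at every
    time, with limit [0] elsewhere, in agreement with the default values. *)
Lemma measurable_H1cvg (P : nat -> R -> R) (F : R -> R) :
  (forall n, measurable_fun D (P n)) ->
  (forall t, is_H1 (v t) -> P n t @[n --> \oo] --> F t) ->
  (forall t, ~ is_H1 (v t) -> F t = 0) -> measurable_fun D F.
Proof.
move=> mP cv F0; apply: (@measurable_fun_cvg _ (measurableTypeR R) R D (fun n t => \1_M t * P n t)).
  move=> n; apply: measurable_funM => //; apply: measurable_indic.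
  exact: measurable_H1set.
move=> t Dt; rewrite indicE; have [tM|tM] := boolP (t \in M).
  under eq_cvg do rewrite mul1r.
  by apply: cv; move: tM; rewrite inE => -[].
under eq_cvg do rewrite mul0r.
rewrite F0; first exact: cvg_cst.
by move=> Ht; move/negP: tM; apply; rewrite inE.
Qed.

Lemma measurable_trace x : endpoint x -> measurable_fun D (fun t => trace (v t) x).
Proof.
move=> ex; apply: (measurable_H1cvg (P := fun n t => \sum_(0 <= i < n) coef (v t) i * cosmode i x)).
- by move=> n; apply: measurable_sum => i; apply: measurable_funM.
- by move=> t; exact: trace_cvg.
- by move=> t; exact: trace_out.
Qed.

Lemma measurable_L2norm_sqr : measurable_fun D (fun t => L2norm (v t) ^+ 2).
Proof.
apply: (@measurable_fun_cvg _ (measurableTypeR R) R D (fun n t => \sum_(0 <= i < n) coef (v t) i ^+ 2)).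
  by move=> n; apply: measurable_sum => i; exact: measurable_funX.
by move=> t _; exact: coef_norm.
Qed.

Lemma L2norm0 : L2norm (0 : L2 R) = 0.
Proof.
rewrite L2normE /dot; under eq_Rintegral do rewrite mul0r.
by rewrite /Rintegral integral0_eq// sqrtr0.
Qed.

Lemma measurable_deriv_sqr : measurable_fun D (fun t => L2norm (deriv1 (v t)) ^+ 2).
Proof.
apply: (measurable_H1cvg (P := fun n t => \sum_(0 <= i < n) lam R i * coef (v t) i ^+ 2)).
- by move=> n; exact: measurable_coef_sum.
- by move=> t; exact: deriv_norm.
- by move=> t nt; rewrite deriv1_out// L2norm0 expr0n.
Qed.

End measurability.

Lemma H1norm_sqr f : H1norm f ^+ 2 = L2norm f ^+ 2 + L2norm (deriv1 f) ^+ 2.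
Proof. by rewrite sqr_sqrtr// addr_ge0 ?sqr_ge0. Qed.

Lemma bnd_coef_sqr g0 g1 n (s : R) :
  (g1 s * cosmode n 1 - g0 s * cosmode n 0) ^+ 2 <= 4 * (g0 s ^+ 2 + g1 s ^+ 2).
Proof.
apply: (le_trans (sqrD_le _ _)); rewrite sqrrN (exprMn 2 (g1 s)) (exprMn 2 (g0 s)).
have := ler_wpM2l (sqr_ge0 (g1 s)) (cosmode_sqr n (1 : R)).
have := ler_wpM2l (sqr_ge0 (g0 s)) (cosmode_sqr n (0 : R)).
by move: (_ * cosmode n 1 ^+ 2) (_ * cosmode n 0 ^+ 2) => x y; lra.
Qed.

Lemma sqint_bnd_coef T g0 g1 n : sqint mu `[0, T] g0 -> sqint mu `[0, T] g1 ->
  sqint mu `[0, T] (fun s => g1 s * @cosmode R n 1 - g0 s * cosmode n 0).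
Proof.
move=> g02 g12; have h c (g : R -> R) : sqint mu `[0, T] g -> sqint mu `[0, T] (fun s => g s * c).
  move=> g2; rewrite (_ : (fun s => g s * c) = fun s => c * g s); first exact: sqintZ.
  by apply/funext => s; rewrite mulrC.
by apply: sqintB => //; exact: h.
Qed.

(** The sum of [mode_bound] over a range of modes. Started at [0] it gives the energy estimate;
    started at a large [m] it gives tails that are small uniformly in time. *)
Lemma modes_bound T k u W g0 g1 a m N : 0 <= T -> (0 < k)%N ->
  weight (k%:R ^+ 2) T u W -> sqint mu `[0, T] g0 -> sqint mu `[0, T] g1 ->
  heat_modes g0 g1 a T ->
  \sum_(m <= i < N) (W T * a i T ^+ 2 +
    (lam R i + k%:R ^+ 2) * \int[mu]_(s in `[0, T]) (W s * a i s ^+ 2)) <=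
  \sum_(m <= i < N) a i 0 ^+ 2 +
    16 / (m + k)%:R * \int[mu]_(s in `[0, T]) (W s * (g0 s ^+ 2 + g1 s ^+ 2)).
Proof.
move=> T0 k0 wW g02 g12 ha.
have [W' [acW W_gt0 dW W0]] := weight_rate (sqr_ge0 _) wW.
have gg1 : mu.-integrable `[0, T] (EFin \o (fun s => W s * (g0 s ^+ 2 + g1 s ^+ 2))).
  apply: ac_mulr_integrable acW _ => //; apply: integrableDr => //; [exact: g02.2|exact: g12.2].
set Q := \int[mu]_(s in _) (W s * (g0 s ^+ 2 + g1 s ^+ 2)).
have Q0 : 0 <= Q.
  apply: Rintegral_ge0 => // s; rewrite /= in_itv/= => sT.
  by rewrite mulr_ge0 ?addr_ge0 ?sqr_ge0// ltW// W_gt0.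
apply: (@le_trans _ _ (\sum_(m <= i < N) (a i 0 ^+ 2 + 4 / (lam R i + k%:R ^+ 2) * Q))).
  apply: ler_sum => i _; have p0 := resolvent_gt0 i k0.
  have G2 := sqint_bnd_coef i g02 g12.
  apply: (le_trans (mode_bound T0 p0 acW W_gt0 dW W0 G2 (ha i))).
  rewrite lerD2l [4 / _]mulrC -mulrA ler_pM2l ?invr_gt0// -RintegralZl//.
  apply: le_Rintegral => //.
  - by apply: ac_mulr_integrable acW _ => //; exact: G2.2.
  - exact: integrableZr.
  - move=> s; rewrite /= in_itv/= => sT; rewrite [leRHS]mulrCA.
    by rewrite ler_wpM2l ?(ltW (W_gt0 _ sT))//; exact: bnd_coef_sqr.
rewrite big_split/= -mulr_suml lerD2l ler_wpM2r//.
exact: sum_resolvent.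
Qed.

(** Monotone convergence turns the bounds on time integrals into one integrable [h] that dominates
    all partial sums at almost every time. Regularity in [H^1], trace bounds and integrability of
    the [H^1] norm are all read off [h]. *)
Lemma heat_energy T k u W g0 g1 v : 0 <= T -> (0 < k)%N ->
  weight (k%:R ^+ 2) T u W -> sqint mu `[0, T] g0 -> sqint mu `[0, T] g1 ->
  heat_modes g0 g1 (fun n t => coef (v t) n) T ->
  exists h : R -> R, [/\ mu.-integrable `[0, T] (EFin \o h),
    {ae mu, forall t, `[0, T]%classic t -> forall n,
      \sum_(0 <= i < n) (lam R i + k%:R ^+ 2) * coef (v t) i ^+ 2 <= (W t)^-1 * h t}
    & \int[mu]_(s in `[0, T]) h s <= L2norm (v 0) ^+ 2 +
       16 / k%:R * \int[mu]_(s in `[0, T]) (W s * (g0 s ^+ 2 + g1 s ^+ 2))].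
Proof.
move=> T0 k0 wW g02 g12 ha.
have [W' [acW W_gt0 _ W0]] := wW.
pose P n s := \sum_(i <- index_iota 0 n)
  (lam R i + k%:R ^+ 2) * (W s * coef (v s) i ^+ 2).
have Pi i : mu.-integrable `[0, T] (EFin \o (fun s => W s * coef (v s) i ^+ 2)).
  by apply: ac_mulr_integrable acW _ => //; exact: (ac_sqint T0 (ha i)).2.
have PZ i : mu.-integrable `[0, T] (EFin \o (fun s =>
    (lam R i + k%:R ^+ 2) * (W s * coef (v s) i ^+ 2))) by exact: integrableZr.
have P1 n : mu.-integrable `[0, T] (EFin \o P n) by apply: integrable_sumr.
have Pge0 i s : `[0, T]%classic s -> 0 <= (lam R i + k%:R ^+ 2) * (W s * coef (v s) i ^+ 2).
  rewrite /= in_itv/= => sT.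
  by rewrite mulr_ge0 ?(ltW (resolvent_gt0 _ k0))// mulr_ge0 ?sqr_ge0// ltW// W_gt0.
have [h [h1 h0 _ Ph Ih]] : exists h : R -> R, [/\ mu.-integrable (itv0 T) (EFin \o h),
    forall x, itv0 T x -> 0 <= h x,
    {ae mu, forall x, itv0 T x -> P n x @[n --> \oo] --> h x},
    {ae mu, forall x, itv0 T x -> forall n, P n x <= h x}
    & \int[mu]_(x in itv0 T) h x <= L2norm (v 0) ^+ 2 +
       16 / k%:R * \int[mu]_(s in `[0, T]) (W s * (g0 s ^+ 2 + g1 s ^+ 2))].
  apply: (levi _ P1) => //.
  - by move=> n s sT; apply: sumr_ge0 => i _; exact: Pge0.
  - by move=> n s sT; rewrite /P [leRHS]big_nat_recr//= lerDl; exact: Pge0.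
  - move=> n; have := modes_bound 0 n T0 k0 wW g02 g12 ha.
    rewrite add0n => /(fun e => le_trans e (lerD (coef_bessel (v 0) n) (lexx _))).
    apply: le_trans; rewrite Rintegral_sum//; apply: ler_sum => i _.
    rewrite RintegralZl// lerDr mulr_ge0 ?sqr_ge0// ltW// W_gt0//.
    by rewrite T0 lexx.
exists h; split => //; apply: ae_imply1 Ph => s hs sT n.
have Ws : 0 < W s by apply: W_gt0; move: sT; rewrite /= in_itv.
rewrite ler_pdivlMl// mulr_sumr; apply: le_trans (hs sT n).
by apply: ler_sum => i _; rewrite [leRHS]mulrCA.
Qed.


(** For qualitative results, where no contraction is sought, [k = 1] and a zero input suffice. *)
Lemma unit_weight : exists W : R -> R, forall T, 0 <= T -> weight (1%:R ^+ 2) T (fun=> 0) W.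
Proof. by apply: weight_exists => T _; apply: sqint0. Qed.

Section solution.
Variables (T : R) (u W g0 g1 : R -> R) (v : R -> L2 R).
Hypotheses (T0 : 0 <= T) (g02 : sqint mu `[0, T] g0) (g12 : sqint mu `[0, T] g1).
Hypothesis hv : heat_modes g0 g1 (fun n t => coef (v t) n) T.

Lemma measurable_coef n : measurable_fun (itv0 T) (fun t => coef (v t) n).
Proof. exact: ac_measurable (hv n). Qed.

Lemma heat_H1_ae : {ae mu, forall t, `[0, T]%classic t -> is_H1 (v t)}.
Proof.
have [W1 hW] := unit_weight.
have [h [_ hh _]] := heat_energy T0 (isT : 0 < 1)%N (hW T T0) g02 g12 hv.
by apply: ae_imply1 hh => t ht tT; apply: (@H1_of_weighted (v t) 1%N) => // n; exact: ht.
Qed.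

(** The two gains in [1 / k] meet here: [8 / k] from [trace_sqr_le] and [16 / k] from
    [heat_energy]. *)
Lemma heat_trace k x : endpoint x -> (0 < k)%N -> weight (k%:R ^+ 2) T u W ->
  sqint mu `[0, T] (fun t => trace (v t) x) /\
  \int[mu]_(t in `[0, T]) (W t * trace (v t) x ^+ 2) <= 8 / k%:R *
    (L2norm (v 0) ^+ 2 +
     16 / k%:R * \int[mu]_(s in `[0, T]) (W s * (g0 s ^+ 2 + g1 s ^+ 2))).
Proof.
move=> ex k0 wW; have [W' [acW W_gt0 _ W0]] := wW.
have [h [h1 hh Ih]] := heat_energy T0 k0 wW g02 g12 hv.
have mt : measurable_fun (itv0 T) (fun t => trace (v t) x).
  by apply: measurable_trace => // n; exact: measurable_coef.
have key : {ae mu, forall t, itv0 T t -> W t * trace (v t) x ^+ 2 <= 8 / k%:R * h t}.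
  apply: ae_imply1 hh => t ht tT.
  have Wt : 0 < W t by apply: W_gt0; move: tT; rewrite /= in_itv.
  have := trace_sqr_le ex k0 (ht tT).
  move: (8 / k%:R) => c hc; rewrite -ler_pdivlMl//.
  by rewrite mulrCA.
have WTt t : itv0 T t -> W T <= W t.
  by rewrite /= in_itv/= => tT; have /andP[] := weight_decr T0 (sqr_ge0 _) wW tT.
have WT : 0 < W T by rewrite W_gt0// T0 lexx.
have t2 : sqint mu (itv0 T) (fun t => trace (v t) x).
  split => //; apply: (@integrable_le_ae _ (measurableTypeR R) _ _ _ _ (fun t => (W T)^-1 * (8 / k%:R * h t))) => //.
  - exact: measurable_funX.
  - apply: ae_imply1 key => t ht tT; rewrite ger0_norm ?sqr_ge0// ler_pdivlMl//.
    by apply: le_trans (ht tT); rewrite ler_wpM2r ?sqr_ge0// WTt.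
  - by do 2 apply: integrableZr => //.
split=> //; apply: (@le_trans _ _ (\int[mu]_(t in `[0, T]) (8 / k%:R * h t))).
  apply: le_Rintegral_ae => //; last exact: integrableZr.
  by apply: ac_mulr_integrable acW _ => //; exact: t2.2.
by rewrite RintegralZl// ler_wpM2l// divr_ge0.
Qed.

Lemma heat_sup k : (0 < k)%N -> weight (k%:R ^+ 2) T u W ->
  W T * L2norm (v T) ^+ 2 <= L2norm (v 0) ^+ 2 +
     16 / k%:R * \int[mu]_(s in `[0, T]) (W s * (g0 s ^+ 2 + g1 s ^+ 2)).
Proof.
move=> k0 wW; have [W' [acW W_gt0 _ W0]] := wW.
have cv : W T * (\sum_(0 <= i < n) coef (v T) i ^+ 2) @[n --> \oo] --> W T * L2norm (v T) ^+ 2.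
  by apply: cvgMr; exact: coef_norm.
rewrite -(cvg_lim (@Rhausdorff R) cv); apply: limr_le.
  by apply/cvg_ex; eexists; exact: cv.
apply: nearW => n; have := modes_bound 0 n T0 k0 wW g02 g12 hv.
rewrite add0n => /(fun e => le_trans e (lerD (coef_bessel (v 0) n) (lexx _))).
apply: le_trans; rewrite mulr_sumr; apply: ler_sum => i _.
rewrite lerDl mulr_ge0 ?(ltW (resolvent_gt0 _ k0))//.
apply: Rintegral_ge0 => // s; rewrite /= in_itv/= => sT.
by rewrite mulr_ge0 ?sqr_ge0// ltW// W_gt0.
Qed.

(** With [k = 1] the weighted sums of [heat_energy] converge exactly to the squared [H^1] norm, and
    [W] is bounded below by its final value. *)
Lemma H1norm_integrable :
  mu.-integrable `[0, T] (EFin \o (fun t => H1norm (v t) ^+ 2)).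
Proof.
have [W1 hW] := unit_weight.
have wW := hW T T0; have [W' [acW W_gt0 _ W0]] := wW.
have [h [h1 hh Ih]] := heat_energy T0 (isT : 0 < 1)%N wW g02 g12 hv.
have WT : 0 < W1 T by rewrite W_gt0// T0 lexx.
apply: (@integrable_le_ae _ (measurableTypeR R) _ _ _ _ (fun t => (W1 T)^-1 * h t)) => //.
- have -> : (fun t => H1norm (v t) ^+ 2) = fun t =>
      L2norm (v t) ^+ 2 + L2norm (deriv1 (v t)) ^+ 2 by apply/funext => t; exact: H1norm_sqr.
  apply: measurable_funD.
    by apply: measurable_L2norm_sqr => // n; exact: measurable_coef.
  by apply: measurable_deriv_sqr => // n; exact: measurable_coef.
- apply: ae_imply1 hh => t ht tT; rewrite ger0_norm ?sqr_ge0//.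
  have tT' : 0 <= t <= T by move: tT; rewrite /= in_itv.
  have Ht : is_H1 (v t) by apply: (@H1_of_weighted (v t) 1%N) => // n; exact: ht.
  have cv : \sum_(0 <= i < n) coef (v t) i ^+ 2 +
      \sum_(0 <= i < n) lam R i * coef (v t) i ^+ 2 @[n --> \oo] --> H1norm (v t) ^+ 2.
    by rewrite H1norm_sqr; apply: cvgD; [exact: coef_norm|exact: deriv_norm].
  have h0 : 0 <= h t.
    by have := ht tT 0%N; rewrite big_geq// pmulr_rge0// invr_gt0 W_gt0.
  apply: (@le_trans _ _ ((W1 t)^-1 * h t)); last first.
    rewrite ler_wpM2r// lef_pV2 ?posrE ?W_gt0 ?T0 ?lexx//.
    by have /andP[] := weight_decr T0 (sqr_ge0 _) wW tT'.
  rewrite -(cvg_lim (@Rhausdorff R) cv); apply: limr_le.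
    by apply/cvg_ex; eexists; exact: cv.
  apply: nearW => n; apply: le_trans (ht tT n); rewrite -big_split/=.
  by apply: ler_sum => i _; rewrite mulrDl expr1n mul1r addrC.
- exact: integrableZr.
Qed.

End solution.

End heat_estimates.
(** * Weak solutions *)

Section simple_functions.
Context (R : realType).

Definition simple (V : Type) (s : R -> V) := finite_set (range s) /\
  forall h, measurable (s @^-1` [set h] : set (measurableTypeR R)).

Lemma simple_cst (V : Type) (c : V) : simple (fun=> c).
Proof.
split=> [|h]; first by apply: finite_image_cst.
have [->|ch] := pselect (c = h).
  by rewrite (_ : _ @^-1` _ = setT)//; apply/seteqP; split.
by rewrite (_ : _ @^-1` _ = set0)//; apply/seteqP; split.
Qed.

Lemma simple2 (V1 V2 V : Type) (F : V1 -> V2 -> V) s1 s2 :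
  simple s1 -> simple s2 -> simple (fun t => F (s1 t) (s2 t)).
Proof.
move=> [f1 m1] [f2 m2]; split=> [|h]; first exact: finite_image11.
rewrite (_ : _ @^-1` _ = \bigcup_(y in [set y | (range s1 `*` range s2) y /\ F y.1 y.2 = h])
  (s1 @^-1` [set y.1] `&` s2 @^-1` [set y.2])); last first.
  apply/seteqP; split => [t /= Fh|t [[y1 y2] [_ /= Fh] [/= -> ->]]//].
  by exists (s1 t, s2 t) => //; split => //; split; exists t.
apply: fin_bigcup_measurable; last by move=> y _; apply: measurableI; [exact: m1|exact: m2].
by apply: sub_finite_set (finite_setX f1 f2) => y [].
Qed.

Lemma simple_comp (V : Type) (s : R -> V) (a : R -> R) :
  simple s -> measurable_fun (setT : set (measurableTypeR R)) a -> simple (s \o a).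
Proof.
move=> [f m] ma; split=> [|h].
  by apply: sub_finite_set f => _ [t _ <-]; exists (a t).
by have := ma measurableT _ (m h); rewrite setTI.
Qed.

Lemma simple_itv (i : interval R) : simple (fun x => x \in i).
Proof.
split=> [|h]; first exact: finite_finset.
case: h.
  rewrite (_ : _ @^-1` _ = [set` i]); first exact: measurable_itv.
  by apply/seteqP; split.
rewrite (_ : _ @^-1` _ = ~` [set` i]); first by apply: measurableC; exact: measurable_itv.
by apply/seteqP; split => x /=; [move=> ->|move/negP/negbTE].
Qed.

(** A staircase with steps of width and height [delta], starting at [- K] and lengthened one step at
    a time. *)
Lemma quantizer (K delta : R) : 0 < delta ->
  exists2 q : R -> R, simple q & forall x, `|x| <= K -> `|q x - x| <= delta.
Proof.
move=> d0; have h n : exists2 q : R -> R, simple q &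
    forall x, - K <= x < - K + n%:R * delta -> `|q x - x| <= delta.
  elim: n => [|n [q sq qd]].
    exists (fun=> 0); first exact: simple_cst.
    by move=> x /andP[x1 x2]; exfalso; lra.
  pose y := - K + n%:R * delta.
  exists (fun x => if x \in `[y, y + delta] then y else q x).
    exact: (simple2 (fun (b : bool) z => if b then y else z) (simple_itv _) sq).
  move=> x /andP[x1 x2]; rewrite in_itv/=.
  case: ifPn => [/andP[yx xy]|].
    by rewrite ler0_norm; lra.
  rewrite negb_and -!ltNge => /orP[xy|xy]; first by apply: qd; rewrite x1.
  by exfalso; move: x2 xy; rewrite /y -natr1 mulrDl; lra.
have [q sq qd] := h (Num.truncn (2 * K / delta)).+1.
exists q => // x; rewrite ler_norml => /andP[x1 x2]; apply: qd; rewrite x1/=.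
have := truncnS_gt (2 * K / delta); rewrite ltr_pdivrMr//; lra.
Qed.

End simple_functions.

(** * Equivalence of weak solutions and systems of modes *)

Section weak_solutions.
Context (R : realType).
Notation mu := (@lebesgue_measure R).
Notation I01 := (`[0%R, 1%R]%classic : set (measurableTypeR R)).
Notation itv0 T := (`[0%R, T]%classic : set (measurableTypeR R)).
Implicit Types (f h : L2 R) (v : R -> L2 R) (T kappa : R) (g W : R -> R).

Lemma L2mode_exists n : exists f : L2 R, forall x, I01 x -> f x = cosmode n x.
Proof. exact: L2_of_sqint (sqint_cosmode R n). Qed.

Definition L2mode n : L2 R := projT1 (cid (L2mode_exists n)).

Lemma L2modeE n x : I01 x -> L2mode n x = cosmode n x.
Proof. exact: (projT2 (cid (L2mode_exists n))). Qed.

Lemma coef_L2mode n i : coef (L2mode n) i = (i == n)%:R.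
Proof.
rewrite /coef (@eq_dot _ _ _ mu I01 _ (@cosmode R n) _ (@cosmode R i)).
- by rewrite (orthonormal_cosmode R).2 eq_sym.
- by apply: aeW => x xI; exact: L2modeE.
- exact: aeW.
Qed.

Lemma inner_L2mode f n : inner f (L2mode n) = coef f n.
Proof.
rewrite innerE; apply: eq_dot; first exact: aeW.
by apply: aeW => x xI; exact: L2modeE.
Qed.

Lemma sum_delta (c : nat -> R) n N : (n < N)%N ->
  \sum_(0 <= i < N) c i * (i == n)%:R = c n.
Proof.
move=> nN; rewrite (bigD1_seq n) ?mem_index_iota ?iota_uniq//=.
rewrite eqxx mulr1 big1 ?addr0// => i /negbTE ->; exact: mulr0.
Qed.

Lemma is_H1_L2mode n : is_H1 (L2mode n).
Proof.
apply: (@H1_of_coef _ _ (lam R n)) => N.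
have [Nn|nN] := leqP N n.
  rewrite big_seq big1 ?lam_ge0// => i; rewrite mem_index_iota => /= iN.
  by rewrite coef_L2mode (ltn_eqF (leq_trans iN Nn)) expr0n mulr0.
rewrite (eq_bigr (fun i => lam R i * (i == n)%:R)) ?sum_delta// => i _.
by rewrite coef_L2mode -natrX; case: eqP.
Qed.

Lemma trace_L2mode n x : endpoint x -> trace (L2mode n) x = cosmode n x.
Proof.
move=> ex; apply: (Rcvg_unique (trace_cvg ex (is_H1_L2mode n))).
apply: cvg_near_cst; exists n.+1 => // N /= nN.
under eq_bigr do rewrite coef_L2mode mulrC.
exact: sum_delta.
Qed.

Lemma inner_deriv_L2mode f n : is_H1 f ->
  inner (deriv1 f) (deriv1 (L2mode n)) = lam R n * coef f n.
Proof.
move=> Hf; apply: (Rcvg_unique (deriv_parseval Hf (is_H1_L2mode n))).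
apply: cvg_near_cst; exists n.+1 => // N /= nN.
under eq_bigr do rewrite coef_L2mode mulrA.
exact: sum_delta.
Qed.

Lemma coef_le f n : `|coef f n| <= L2norm f.
Proof.
rewrite -ler_sqr ?nnegrE ?L2norm_ge0// real_normK ?num_real//.
apply: le_trans (coef_bessel f n.+1); rewrite big_nat_recr//= lerDr.
by apply: sumr_ge0 => i _; exact: sqr_ge0.
Qed.

Lemma in_CL2_coef v n T : in_CL2 v -> {within `[0, T], continuous (fun t => coef (v t) n)}.
Proof.
move=> cv; apply/subspace_continuousP => t; rewrite /= in_itv/= => /andP[t0 tT].
apply/cvgrPdist_le => e e0.
have := cv t t0 => /cvgrPdist_le/(_ e e0).
rewrite !near_withinE; apply: filterS => s hs sT.
have /hs : 0 <= s by move: sT; rewrite /= in_itv/= => /andP[].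
rewrite sub0r normrN ger0_norm ?L2norm_ge0//; apply: le_trans.
by rewrite distrC -coefB; exact: coef_le.
Qed.

(** Test the weak identity with the [n]-th cosine mode, whose trace and derivative pairing are
    explicit. *)
Lemma modes_of_weak g0 g1 v T : 0 <= T -> weak_heat g0 g1 v ->
  heat_modes g0 g1 (fun n t => coef (v t) n) T.
Proof.
move=> T0 [cv hv g01 g11 eqv] n.
have ac_ : mu.-integrable `[0, T] (EFin \o (fun t => coef (v t) n)).
  have c := in_CL2_coef (n := n) (T := T) cv; have [M _ hM] := continuous_itv_bounded c.
  by apply: (itv_bounded_integrable (M := M)) => //; exact: continuous_itv_measurable.
have gc (c : R) (g : R -> R) : mu.-integrable `[0, T] (EFin \o g) ->
    mu.-integrable `[0, T] (EFin \o (fun s => g s * c)).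
  by move=> h; rewrite (_ : (fun s => g s * c) = fun s => c * g s);
    [exact: integrableZr|apply/funext => s; rewrite mulrC].
have G1 : mu.-integrable `[0, T] (EFin \o
    (fun s => g1 s * @cosmode R n 1 - g0 s * @cosmode R n 0)).
  by apply: integrableBr => //; apply: gc; [exact: g11|exact: g01].
split; first by apply: integrableDr => //; exact: integrableZr.
move=> t /andP[t0 tT].
rewrite RintegralD//; last 2 first.
- by apply: integrableZr => //; exact: integrable_itvS ac_.
- exact: integrable_itvS G1.
have := eqv _ (is_H1_L2mode n) t t0; rewrite !inner_L2mode.
have -> : \int[mu]_(s in `[0, t]) inner (deriv1 (v s)) (deriv1 (L2mode n)) =
    \int[mu]_(s in `[0, t]) (lam R n * coef (v s) n).
  (* [in_L2H1] speaks of open time intervals: the horizon [t + 1] takes in the endpoint [t], and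
     time [0] is discarded as a null set. *)
  apply: ae_eq_Rintegral; have [hH _ _] := hv (t + 1) (ltr_wpDl t0 ltr01).
  apply: (ae_imply2 _ hH (@ae_not_endpoint R)) => s Hs s0; rewrite /= in_itv/= => /andP[s1 s2].
  apply: inner_deriv_L2mode; apply: Hs; rewrite (le_lt_trans s2) ?ltrDl// andbT.
  by rewrite lt_neqAle s1 andbT; apply/eqP => s00; apply: s0; left.
rewrite !trace_L2mode; [|by left|by right].
rewrite RintegralZl//; last exact: integrable_itvS ac_.
have -> : \int[mu]_(x in `[0, t]) (- lam R n * coef (v x) n) =
   - (lam R n * \int[mu]_(x in `[0, t]) coef (v x) n).
  by rewrite RintegralZl ?mulNr//; exact: integrable_itvS ac_.
by move=> e; rewrite addrCA -e addrCA addNr addr0.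
Qed.


Lemma trace_bound f x : endpoint x -> is_H1 f ->
  exists M, forall n, `|\sum_(0 <= i < n) coef f i * cosmode i x| <= M.
Proof.
move=> ex Hf; have cv := trace_cvg ex Hf.
have /cvg_seq_bounded : cvgn (fun n => \sum_(0 <= i < n) coef f i * cosmode i x).
  by apply/cvg_ex; eexists; exact: cv.
move=> [M [_ /(_ (M + 1))]]; rewrite ltrDl => /(_ ltr01) h.
by exists (M + 1) => n; exact: h.
Qed.

(** Add the first [N] mode equations with the coefficients of [phi] as factors and let [N] grow by
    dominated convergence. The gradient terms are dominated through [2 x y <= x^2 + y^2], the
    boundary terms through the boundedness of the partial trace sums of [phi]. *)
Lemma weak_identity_of_modes g0 g1 v t phi : 0 <= t ->
  sqint mu `[0, t] g0 -> sqint mu `[0, t] g1 ->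
  heat_modes g0 g1 (fun n s => coef (v s) n) t -> is_H1 phi ->
  inner (v t) phi + \int[mu]_(s in `[0, t]) inner (deriv1 (v s)) (deriv1 phi)
  = inner (v 0) phi + \int[mu]_(s in `[0, t]) (g1 s * trace phi 1 - g0 s * trace phi 0).
Proof.
move=> t0 g02 g12 hv Hphi.
have fin : (mu (itv0 t) < +oo)%E by rewrite lebesgue_measure_itv/=; case: ifPn; rewrite ?ltry.
have g01 : mu.-integrable `[0, t] (EFin \o g0) by apply: sqint_L1.
have g11 : mu.-integrable `[0, t] (EFin \o g1) by apply: sqint_L1.
have aint n : mu.-integrable `[0, t] (EFin \o (fun s => coef (v s) n)).
  by apply: sqint_L1 => //; exact: ac_sqint (hv n).
have H1v : {ae mu, forall s, `[0, t]%classic s -> is_H1 (v s)} by exact: heat_H1_ae hv.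
pose A N s := \sum_(i <- index_iota 0 N) coef phi i * (lam R i * coef (v s) i).
pose G N s := g1 s * (\sum_(0 <= i < N) coef phi i * cosmode i 1) -
   g0 s * (\sum_(0 <= i < N) coef phi i * cosmode i 0).
have Aint i : mu.-integrable `[0, t] (EFin \o (fun s => coef phi i * (lam R i * coef (v s) i))).
  by do 2 apply: integrableZr => //.
have A1 N : mu.-integrable `[0, t] (EFin \o A N) by apply: integrable_sumr.
have gc (c : R) (g : R -> R) : mu.-integrable `[0, t] (EFin \o g) ->
    mu.-integrable `[0, t] (EFin \o (fun s => g s * c)).
  by move=> h; rewrite (_ : (fun s => g s * c) = fun s => c * g s);
    [exact: integrableZr|apply/funext => s; rewrite mulrC].
have G1 N : mu.-integrable `[0, t] (EFin \o G N).
  by apply: integrableBr => //; exact: gc.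
have H1int := H1norm_integrable t0 g02 g12 hv.
have cvA : \int[mu]_(s in `[0, t]) A N s @[N --> \oo] -->
    \int[mu]_(s in `[0, t]) inner (deriv1 (v s)) (deriv1 phi).
  apply: (@Rdominated _ (measurableTypeR R) R mu (itv0 t) A _
    (fun s => H1norm (v s) ^+ 2 + L2norm (deriv1 phi) ^+ 2)) => //.
  - by move=> N; exact: integrable_mf (A1 N).
  - apply: integrableDr => //.
    by apply: (itv_bounded_integrable (M := `|L2norm (deriv1 phi) ^+ 2|)).
  - apply: ae_imply1 H1v => s Hs st; have := deriv_parseval (Hs st) Hphi.
    rewrite (_ : (fun N => A N s) = fun N =>
      \sum_(0 <= i < N) lam R i * (coef (v s) i * coef phi i))//.
    apply/funext => N; apply: eq_bigr => i _.
    by rewrite mulrCA [coef phi i * _]mulrC.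
  - apply: ae_imply1 H1v => s Hs st N.
    apply: (@le_trans _ _ (\sum_(0 <= i < N) lam R i * coef (v s) i ^+ 2 +
       \sum_(0 <= i < N) lam R i * coef phi i ^+ 2)); last first.
      rewrite lerD ?(deriv_bessel _ Hphi)//.
      by apply: le_trans (deriv_bessel _ (Hs st)) _; rewrite H1norm_sqr lerDr sqr_ge0.
    apply: (le_trans (ler_norm_sum _ _ _)); rewrite -big_split/=.
    apply: ler_sum => i _; rewrite mulrCA normrM (ger0_norm (lam_ge0 R i)) -mulrDr.
    apply: ler_wpM2l; first exact: lam_ge0.
    rewrite normrM -(real_normK (num_real (coef (v s) i))) -(real_normK (num_real (coef phi i))).
    by have := sqr_ge0 (`|coef phi i| - `|coef (v s) i|); nra.
have cvG : \int[mu]_(s in `[0, t]) G N s @[N --> \oo] -->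
    \int[mu]_(s in `[0, t]) (g1 s * trace phi 1 - g0 s * trace phi 0).
  have [M1 hM1] := trace_bound (or_intror erefl) Hphi.
  have [M0 hM0] := trace_bound (or_introl erefl) Hphi.
  apply: (@Rdominated _ (measurableTypeR R) R mu (itv0 t) G _
    (fun s => `|M1| * `|g1 s| + `|M0| * `|g0 s|)) => //.
  - by move=> N; exact: integrable_mf (G1 N).
  - by apply: integrableDr => //; apply: integrableZr => //; exact: integrable_norm.
  - apply: aeW => s st; apply: cvgB; apply: cvgMr.
      by apply: trace_cvg => //; right.
    by apply: trace_cvg => //; left.
  - apply: aeW => s st N; apply: (le_trans (ler_normB _ _)).
    rewrite !normrM ![`|g1 s| * _]mulrC ![`|g0 s| * _]mulrC lerD// ler_wpM2r//.
      by rewrite (le_trans (hM1 N))// ler_norm.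
    by rewrite (le_trans (hM0 N))// ler_norm.
have eqN N : \sum_(0 <= i < N) coef (v t) i * coef phi i +
     \int[mu]_(s in `[0, t]) A N s =
   \sum_(0 <= i < N) coef (v 0) i * coef phi i + \int[mu]_(s in `[0, t]) G N s.
  have -> : \sum_(0 <= i < N) coef (v t) i * coef phi i =
      \sum_(0 <= i < N) coef (v 0) i * coef phi i +
      \int[mu]_(s in `[0, t]) (G N s - A N s).
    have -> : \int[mu]_(s in `[0, t]) (G N s - A N s) =
        \int[mu]_(s in `[0, t]) (\sum_(i <- index_iota 0 N) coef phi i *
          (- lam R i * coef (v s) i + (g1 s * cosmode i 1 - g0 s * cosmode i 0))).
      apply: eq_Rintegral => s _; rewrite /G /A !mulr_sumr -!sumrB.
      by apply: eq_bigr => i _; ring.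
    rewrite Rintegral_sum//; last by move=> i; apply: integrableZr => //; exact: (hv i).1.
    rewrite -big_split/=; apply: eq_bigr => i _.
    rewrite RintegralZl//; last exact: (hv i).1.
    by rewrite ((hv i).2 t) ?t0 ?lexx// mulrDl [X in _ + X]mulrC.
  rewrite -addrA -RintegralD//; last exact: integrableBr.
  by congr (_ + _); apply: eq_Rintegral => s _; rewrite subrK.
have cvl : \sum_(0 <= i < N) coef (v t) i * coef phi i + \int[mu]_(s in `[0, t]) A N s
    @[N --> \oo] --> inner (v t) phi +
      \int[mu]_(s in `[0, t]) inner (deriv1 (v s)) (deriv1 phi).
  by apply: cvgD => //; exact: coef_parseval.
apply: (Rcvg_unique cvl); under eq_cvg do rewrite eqN.
by apply: cvgD => //; exact: coef_parseval.
Qed.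


Section regularity.
Variables (T : R) (g0 g1 : R -> R) (v : R -> L2 R).
Hypotheses (T0 : 0 <= T) (g02 : sqint mu `[0, T] g0) (g12 : sqint mu `[0, T] g1).
Hypothesis hv : heat_modes g0 g1 (fun n t => coef (v t) n) T.

(** The tail at time [s] is controlled by the tail of the initial state plus [16 / (m + 1)] times a
    fixed energy of the boundary data, so one [m] serves all times. *)
Lemma heat_tail e : 0 < e -> exists m, forall s, 0 <= s <= T -> forall N,
  \sum_(m <= i < N) coef (v s) i ^+ 2 <= e.
Proof.
move=> e0; have [W hW] := unit_weight R.
have wW := hW T T0; have [W' [acW W_gt0 _ W0]] := wW.
have WT : 0 < W T by rewrite W_gt0// T0 lexx.
have gg1 : mu.-integrable `[0, T] (EFin \o (fun s => W s * (g0 s ^+ 2 + g1 s ^+ 2))).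
  apply: ac_mulr_integrable acW _ => //; apply: integrableDr => //; [exact: g02.2|exact: g12.2].
set Q := \int[mu]_(s in `[0, T]) (W s * (g0 s ^+ 2 + g1 s ^+ 2)).
have Q0 : 0 <= Q.
  apply: Rintegral_ge0 => // s; rewrite /= in_itv/= => sT.
  by rewrite mulr_ge0 ?addr_ge0 ?sqr_ge0// ltW// W_gt0.
(* Half of the allowance goes to the initial tail and half to the boundary data; the factor [W T]
   undoes the weight on the left-hand side. *)
pose d := W T * e / 2; have d0 : 0 < d by rewrite divr_gt0// mulr_gt0.
have /cvgrPdist_le/(_ d d0)[m1 _ hm1] := @coef_norm R (v 0).
have [m2 hm2] : exists m2 : nat, 16 * Q / d <= m2%:R.
  by exists (Num.truncn (16 * Q / d)).+1; rewrite ltW// truncnS_gt.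
exists (maxn m1 m2) => s sT N; set m := maxn m1 m2; have /andP[s0 s1] := sT.
have h := modes_bound m N s0 (isT : 0 < 1)%N (hW s s0)
  (sqint_itvS (lexx 0) s1 g02) (sqint_itvS (lexx 0) s1 g12) (heat_modesS s1 hv).
have Qs : \int[mu]_(x in `[0, s]) (W x * (g0 x ^+ 2 + g1 x ^+ 2)) <= Q.
  rewrite -subr_ge0 RintegralB_itv//; apply: Rintegral_ge0 => // x.
  rewrite /= in_itv/= => /andP[sx xT].
  by rewrite mulr_ge0 ?addr_ge0 ?sqr_ge0// ltW// W_gt0// xT (le_trans s0).
have [Nm|mN] := leqP N m; first by rewrite big_geq// ltW.
have init : \sum_(m <= i < N) coef (v 0) i ^+ 2 <= d.
  have := hm1 m (leq_maxl _ _); rewrite ger0_norm; last first.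
    by rewrite subr_ge0; exact: coef_bessel.
  apply: le_trans; rewrite lerBrDl.
  rewrite -(@big_cat_nat _ _ _ m 0%N N)//=; first exact: coef_bessel.
  exact: ltnW.
have tail : 16 / (m + 1)%:R * Q <= d.
  rewrite mulrAC ler_pdivrMr ?ltr0n ?addn1// mulrC -ler_pdivrMl// mulrC.
  rewrite [d^-1 * _]mulrC; apply: le_trans hm2 _.
  by rewrite ler_nat (leq_trans (leq_maxr m1 m2))// leqnSn.
have WsT : W T <= W s by have /andP[] := weight_decr T0 (sqr_ge0 _) wW sT.
rewrite -(ler_pM2l WT); apply: (@le_trans _ _ (d + d)); last by rewrite /d -splitr.
apply: le_trans (lerD init (le_trans (ler_wpM2l _ Qs) tail)); last by rewrite divr_ge0.
apply: le_trans h; rewrite mulr_sumr; apply: ler_sum => i _.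
rewrite (le_trans (ler_wpM2r (sqr_ge0 _) WsT))// lerDl mulr_ge0//.
  by rewrite ltW// resolvent_gt0.
apply: Rintegral_ge0 => // x; rewrite /= in_itv/= => /andP[x0 xs].
by rewrite mulr_ge0 ?sqr_ge0// ltW// W_gt0// x0 (le_trans xs).
Qed.

Lemma heat_continuous t : 0 <= t -> t < T ->
  L2norm (v s - v t) @[s --> within (fun s => 0 <= s) (nbhs t)] --> (0 : R).
Proof.
move=> t0 tT; apply/cvgrPdist_le => e e0.
(* One fifth for the first [m] modes, and two fifths for each of the tails at times [s] and [t]. *)
have e2 : 0 < e ^+ 2 / 5 by rewrite divr_gt0// exprn_gt0.
have [m hm] := heat_tail e2.
have cs : \sum_(0 <= i < m) (coef (v s) i - coef (v t) i) ^+ 2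
    @[s --> within (itv0 T) (nbhs t)] --> \sum_(0 <= i < m) (0 : R).
  apply: (@cvg_big _ _ +%R) => [|i _]; first exact: add_continuous.
  have /subspace_continuousP/(_ t) := ac_continuous T0 (hv i).
  rewrite /= in_itv/= t0 (ltW tT) => /(_ isT) c.
  have c0 : coef (v s) i - coef (v t) i @[s --> within (itv0 T) (nbhs t)] --> (0 : R).
    suff : coef (v s) i - coef (v t) i @[s --> within (itv0 T) (nbhs t)]
        --> (coef (v t) i - coef (v t) i) by rewrite subrr.
    by apply: cvgB => //; exact: cvg_cst.
  suff : (coef (v s) i - coef (v t) i) ^+ 2 @[s --> within (itv0 T) (nbhs t)]
      --> (0 * 0 : R) by rewrite mulr0.
  by under eq_cvg do rewrite expr2; exact: cvgM.
move: cs; rewrite big1// => /cvgrPdist_le/(_ _ e2).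
rewrite !near_withinE => h.
have ltT : \forall s \near t, s < T by exact: lt_nbhsl.
apply: filterS2 h ltT => s hs sT s0.
have st : itv0 T s by rewrite /= in_itv/= s0 ltW.
have tt : 0 <= t <= T by rewrite t0 ltW.
rewrite sub0r normrN ger0_norm ?L2norm_ge0//.
rewrite -ler_sqr ?nnegrE ?L2norm_ge0 ?(ltW e0)//.
rewrite -(cvg_lim (@Rhausdorff R) (@coef_norm R (v s - v t))); apply: limr_le.
  by apply/cvg_ex; eexists; exact: coef_norm.
exists m => // N /= mN; rewrite (@big_cat_nat _ _ _ m)//=.
have h1 : \sum_(0 <= i < m) coef (v s - v t) i ^+ 2 <= e ^+ 2 / 5.
  have := hs st; rewrite sub0r normrN; apply: le_trans; rewrite (le_trans _ (ler_norm _))//.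
  by apply: ler_sum => i _; rewrite coefB.
have h2 : \sum_(m <= i < N) coef (v s - v t) i ^+ 2 <=
   2 * \sum_(m <= i < N) coef (v s) i ^+ 2 + 2 * \sum_(m <= i < N) coef (v t) i ^+ 2.
  rewrite !mulr_sumr -big_split/=; apply: ler_sum => i _; rewrite coefB.
  by have := sqrD_le (coef (v s) i) (- coef (v t) i); rewrite sqrrN.
have h3 : \sum_(m <= i < N) coef (v s) i ^+ 2 <= e ^+ 2 / 5 by apply: hm; rewrite s0 ltW.
have h4 := hm t tt N.
by lra.
Qed.

End regularity.

(** Keep the first [n] modes and round their coefficients to finitely many values. Each approximant
    then takes finitely many values literally, and not just up to almost everywhere equality. *)
Lemma in_L2H1_approx T v : (forall n, measurable_fun (itv0 T) (fun t => coef (v t) n)) ->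
  exists s : nat -> R -> L2 R, [/\ forall n, simple (s n),
    forall n t, is_H1 (s n t) &
    forall t, 0 < t < T -> is_H1 (v t) ->
      (fun n => H1norm (s n t - v t)) @ \oo --> (0 : R)].
Proof.
move=> mv.
pose A i := (fun t => coef (v t) i) \_ (itv0 T).
have mA i : measurable_fun (setT : set (measurableTypeR R)) (A i).
  by apply/(measurable_restrictT _ _).1 => //; exact: mv.
pose c n := \sum_(0 <= i < n) (1 + lam R i).
have c0 n : 0 <= c n by apply: sumr_ge0 => i _; rewrite addr_ge0 ?lam_ge0.
(* Small enough that the rounding errors, weighted by [1 + lam i] and summed over [n] modes, stay
   below [1 / (n + 1)]. *)
pose delta n := (n.+1%:R * (1 + c n))^-1.
have d0 n : 0 < delta n by rewrite invr_gt0 mulr_gt0// ltr_wpDr.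
have /choice[q hq] : forall n : nat, exists q : R -> R, simple q /\
    forall x, `|x| <= n%:R -> `|q x - x| <= delta n.
  by move=> n; have [q sq hq] := quantizer n%:R (d0 n); exists q.
pose s n t := \sum_(i <- index_iota 0 n) q n (A i t) *: L2mode i.
have cs n t i : coef (s n t) i = if (i < n)%N then q n (A i t) else 0.
  rewrite /coef /s dotC.
  have -> : dot mu I01 (@cosmode R i) (\sum_(j <- index_iota 0 n) q n (A j t) *: L2mode j) =
     dot mu I01 (lincomb (@cosmode R) (fun j => q n (A j t)) (index_iota 0 n)) (@cosmode R i).
    rewrite dotC; apply: eq_dot; last exact: aeW.
    by apply: aeW => x xI; rewrite L2sum; apply: eq_bigr => j _; rewrite L2Z L2modeE.
  rewrite dot_lincomb_psi ?iota_uniq//; last exact: orthonormal_cosmode.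
  by rewrite mem_index_iota.
have Hs n t : is_H1 (s n t).
  apply: (@H1_of_coef _ _ (\sum_(0 <= i < n) lam R i * q n (A i t) ^+ 2)) => N.
  have [Nn|nN] := leqP N n.
    rewrite [leRHS](@big_cat_nat _ _ _ N)//=.
    rewrite [X in X <= _](_ : _ = \sum_(0 <= i < N) lam R i * q n (A i t) ^+ 2).
      by rewrite lerDl; apply: sumr_ge0 => i _; rewrite mulr_ge0 ?lam_ge0 ?sqr_ge0.
    by apply: eq_big_nat => i /= iN; rewrite cs (leq_trans iN Nn).
  rewrite (@big_cat_nat _ _ _ n 0 N)//=; last exact: ltnW.
  rewrite [X in _ + X]big_nat [X in _ + X]big1 ?addr0; last first.
    by move=> i /andP[ni _]; rewrite cs ltnNge ni/= expr0n mulr0.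
  by apply: ler_sum_nat => i /= iN; rewrite cs iN.
exists s; split=> [n|//|t t0T Hv].
  rewrite /s; elim: (index_iota 0 n) => [|i r ih].
    by under eq_fun do rewrite big_nil; exact: simple_cst.
  under eq_fun do rewrite big_cons.
  apply: (simple2 +%R) => //.
  apply: (simple2 (fun a (f : L2 R) => a *: f)); last exact: simple_cst.
  by apply: (simple_comp _ (mA i)); exact: (hq n).1.
have At i : A i t = coef (v t) i.
  by rewrite /A patchT// inE/= in_itv/=; move: t0T => /andP[/ltW -> /ltW ->].
pose E n := \sum_(0 <= i < n) (1 + lam R i) * coef (v t) i ^+ 2.
have cvE : E n @[n --> \oo] --> H1norm (v t) ^+ 2.
  rewrite H1norm_sqr (_ : E = fun n => \sum_(0 <= i < n) coef (v t) i ^+ 2 +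
      \sum_(0 <= i < n) lam R i * coef (v t) i ^+ 2); last first.
    by apply/funext => n; rewrite -big_split/=; apply: eq_bigr => i _; rewrite mulrDl mul1r.
  by apply: cvgD; [exact: coef_norm|exact: deriv_norm].
have EE n : E n <= H1norm (v t) ^+ 2.
  rewrite -(cvg_lim (@Rhausdorff R) cvE); apply: nondecreasing_cvgn_le.
    apply/nondecreasing_seqP => k; rewrite /E big_nat_recr//= lerDl.
    by rewrite mulr_ge0 ?sqr_ge0// addr_ge0 ?lam_ge0.
  by apply/cvg_ex; eexists; exact: cvE.
have [n0 hn0] : exists n0 : nat, L2norm (v t) <= n0%:R.
  by exists (Num.truncn (L2norm (v t))).+1; rewrite ltW// truncnS_gt.
have key n : (n0 <= n)%N -> H1norm (s n t - v t) ^+ 2 <=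
    n.+1%:R^-1 + (H1norm (v t) ^+ 2 - E n).
  move=> n0n; have Hd := is_H1B (Hs n t) Hv.
  have cvd : \sum_(0 <= i < N) (1 + lam R i) * coef (s n t - v t) i ^+ 2 @[N --> \oo] -->
      H1norm (s n t - v t) ^+ 2.
    rewrite H1norm_sqr (_ : (fun N => _) = fun N => \sum_(0 <= i < N) coef (s n t - v t) i ^+ 2 +
        \sum_(0 <= i < N) lam R i * coef (s n t - v t) i ^+ 2); last first.
      by apply/funext => N; rewrite -big_split/=; apply: eq_bigr => i _; rewrite mulrDl mul1r.
    by apply: cvgD; [exact: coef_norm|exact: deriv_norm].
  rewrite -(cvg_lim (@Rhausdorff R) cvd); apply: limr_le.
    by apply/cvg_ex; eexists; exact: cvd.
  exists n => // N /= nN; rewrite (@big_cat_nat _ _ _ n)//=; apply: lerD.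
    apply: (@le_trans _ _ (\sum_(0 <= i < n) (1 + lam R i) * delta n)).
      apply: ler_sum_nat => i /= iN; apply: ler_wpM2l; first by rewrite addr_ge0 ?lam_ge0.
      rewrite coefB cs iN At.
      have := (hq n).2 (coef (v t) i).
      have -> : `|coef (v t) i| <= n%:R.
        by rewrite (le_trans (coef_le _ _))// (le_trans hn0)// ler_nat.
      move=> /(_ isT) hd; rewrite -(real_normK (num_real _)).
      have d1 : delta n <= 1.
        rewrite invf_le1 ?mulr_gt0 ?ltr_wpDr// mulr_ege1 ?ler1n//.
        by rewrite lerDl.
      rewrite expr2 -[leRHS]mulr1; apply: ler_pM => //; exact: le_trans d1.
    rewrite -mulr_suml -/(c n) /delta invfM mulrCA ler_piMr ?invr_ge0//.
    rewrite ler_pdivrMr ?ltr_wpDr// mul1r lerDr//.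
  rewrite lerBrDl; apply: le_trans (EE N); rewrite /E [leRHS](@big_cat_nat _ _ _ n)//=.
  rewrite lerD2l; apply: ler_sum_nat => i /andP[ni _].
  by rewrite coefB cs ltnNge ni/= sub0r sqrrN.
have cv2 : H1norm (s n t - v t) ^+ 2 @[n --> \oo] --> (0 : R).
  apply: (@squeeze_cvgr _ _ _ _ (fun=> 0) (fun n => n.+1%:R^-1 + (H1norm (v t) ^+ 2 - E n))).
  - by exists n0 => // n /= n0n; rewrite sqr_ge0 key.
  - exact: cvg_cst.
  - rewrite -(addr0 0); apply: cvgD; first exact: cvg_harmonic.
    rewrite -(subrr (H1norm (v t) ^+ 2)); apply: cvgB => //; exact: cvg_cst.
exact: cvg_sqr0.
Qed.

End weak_solutions.
(** * The closed loop *)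

Section existence_tools.
Context (R : realType).
Notation mu := (@lebesgue_measure R).
Notation itv0 T := (`[0%R, T]%classic : set (measurableTypeR R)).
Implicit Types (f h : L2 R) (v : R -> L2 R) (T kappa : R) (g W : R -> R).

Definition locally_sqint g := forall T, 0 <= T -> sqint mu (itv0 T) g.

Lemma itv0_fin T : (mu (itv0 T) < +oo)%E.
Proof. by rewrite lebesgue_measure_itv/=; case: ifPn; rewrite ?ltry. Qed.

Lemma locally_sqint_integrable g : locally_sqint g -> locally_integrable_pos g.
Proof. by move=> g2 T T0; apply: sqint_L1 (g2 T T0) => //; exact: itv0_fin. Qed.

Lemma weak_of_modes g0 g1 v : locally_sqint g0 -> locally_sqint g1 ->
  (forall T, 0 <= T -> heat_modes g0 g1 (fun n t => coef (v t) n) T) ->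
  weak_heat g0 g1 v.
Proof.
move=> g02 g12 hv; split.
- move=> t t0; have T0 : 0 <= t + 1 by rewrite addr_ge0.
  apply: (heat_continuous T0 (g02 _ T0) (g12 _ T0) (hv _ T0)) => //.
  by rewrite ltrDl.
- move=> T T0; have T0' := ltW T0.
  have H1v := heat_H1_ae T0' (g02 _ T0') (g12 _ T0') (hv _ T0').
  have H1v' : {ae mu, forall t, 0 < t < T -> is_H1 (v t)}.
    apply: ae_imply1 H1v => t ht /andP[t0 tT]; apply: ht.
    by rewrite /= in_itv/= !ltW.
  split => //.
    have [s [ss sH sv]] := in_L2H1_approx (measurable_coef T0' (hv _ T0')).
    exists s; split => //.
    + by move=> n; have [] := ss n.
    + by move=> n; have [] := ss n.
    + by apply: ae_imply1 H1v' => t ht tT; apply: sv => //; exact: ht.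
  have i1 : mu.-integrable `]0, T[ (EFin \o (fun t => H1norm (v t) ^+ 2)).
    apply: integrableS (H1norm_integrable T0' (g02 _ T0') (g12 _ T0') (hv _ T0')) => //.
    by apply: subset_itv; rewrite bnd_simp.
  exact: integrable_lty.
- exact: locally_sqint_integrable.
- exact: locally_sqint_integrable.
- move=> phi Hphi t t0; apply: weak_identity_of_modes => //; [exact: g02|exact: g12|exact: hv].
Qed.

(** Solve each mode separately; [modes_bound] shows that the coefficients remain square-summable at
    every time [t >= 0], so they are those of an element of [L2 R]. *)
Lemma heat_exists f g0 g1 : locally_sqint g0 -> locally_sqint g1 ->
  exists v, (forall n, coef (v 0) n = coef f n) /\
    forall T, 0 <= T -> heat_modes g0 g1 (fun n t => coef (v t) n) T.
Proof.
move=> g02 g12.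
have [a [a0 ha]] := heat_mode_exists (coef f) (locally_sqint_integrable g02)
  (locally_sqint_integrable g12).
have [W hW] := unit_weight R.
have /choice[v hv] : forall t, exists vt : L2 R, 0 <= t -> forall n, coef vt n = a n t.
  move=> t; have [t0|tn0] := pselect (0 <= t); last by exists 0 => /tn0.
  have wW := hW t t0; have [W' [acW W_gt0 _ W0]] := wW.
  have Wt : 0 < W t by rewrite W_gt0// t0 lexx.
  pose Q := \int[mu]_(s in `[0, t]) (W s * (g0 s ^+ 2 + g1 s ^+ 2)).
  have [n|vt hvt] := @L2_of_coef R (a ^~ t) ((W t)^-1 * (L2norm f ^+ 2 + 16 * Q)).
    have h := modes_bound 0 n t0 (isT : 0 < 1)%N wW (g02 t t0) (g12 t t0) (ha t t0).
    rewrite -(ler_pM2l Wt) mulrA mulfV ?gt_eqF// mul1r mulr_sumr.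
    apply: le_trans (lerD (coef_bessel f n) (lexx _)).
    have -> : \sum_(0 <= i < n) coef f i ^+ 2 = \sum_(0 <= i < n) a i 0 ^+ 2.
      by apply: eq_bigr => i _; rewrite a0.
    move: h; rewrite add0n divr1; apply: le_trans.
    apply: ler_sum => i _; rewrite lerDl mulr_ge0 ?(ltW (resolvent_gt0 _ _ _))//.
    apply: Rintegral_ge0 => // s; rewrite /= in_itv/= => st.
    by rewrite mulr_ge0 ?sqr_ge0// ltW// W_gt0.
  by exists vt.
exists v; split=> [n|T T0]; first by rewrite hv.
by apply: (eq_heat_modes (ha T T0)) => n s /andP[s0 _]; rewrite hv.
Qed.

Lemma locally_sqintD g1 g2 : locally_sqint g1 -> locally_sqint g2 ->
  locally_sqint (fun s => g1 s + g2 s).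
Proof. by move=> h1 h2 T T0; apply: sqintD => //; [exact: h1|exact: h2]. Qed.

Lemma locally_sqintB g1 g2 : locally_sqint g1 -> locally_sqint g2 ->
  locally_sqint (fun s => g1 s - g2 s).
Proof. by move=> h1 h2 T T0; apply: sqintB => //; [exact: h1|exact: h2]. Qed.

Lemma locally_sqintZ c g : locally_sqint g -> locally_sqint (fun s => c * g s).
Proof. by move=> h T T0; apply: sqintZ => //; exact: h. Qed.

Lemma locally_sqint0 : locally_sqint (fun=> 0).
Proof. by move=> T T0; exact: sqint0. Qed.

Lemma locally_sqint_ac_mul z' z u : (forall T, 0 <= T -> ac T z' z) -> locally_sqint u ->
  locally_sqint (fun s => z s * u s).
Proof.
move=> az u2 T T0; have [M _ hM] := ac_bounded T0 (az T T0).
have mz := ac_measurable T0 (az T T0).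
apply: (sqint_bounded (M := M)) => //; first exact: u2.
Qed.

Lemma eq_ac_ae T g g' G : 0 <= T -> ac T g G -> mu.-integrable (itv0 T) (EFin \o g') ->
  {ae mu, forall s, itv0 T s -> g s = g' s} -> ac T g' G.
Proof.
move=> T0 [f1 Ff] f'1 ff'; split=> // x /andP[x0 xT]; rewrite Ff ?x0//; congr (_ + _).
apply: ae_eq_Rintegral; apply: ae_imply1 ff' => s hs; rewrite /= in_itv/= => /andP[s0 sx].
by apply: hs; rewrite /= in_itv/= s0 (le_trans sx).
Qed.

Lemma eq_heat_modes_ae T g0 g1 g0' g1' a : 0 <= T -> heat_modes g0 g1 a T ->
  sqint mu (itv0 T) g0' -> sqint mu (itv0 T) g1' ->
  {ae mu, forall s, itv0 T s -> g0 s = g0' s} ->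
  {ae mu, forall s, itv0 T s -> g1 s = g1' s} -> heat_modes g0' g1' a T.
Proof.
move=> T0 ha g02 g12 e0 e1 n; apply: (eq_ac_ae T0 (ha n)).
  apply: integrableDr => //; last first.
    by apply: sqint_L1 => //; [exact: itv0_fin|exact: sqint_bnd_coef].
  apply: integrableZr => //; apply: sqint_L1 => //; first exact: itv0_fin.
  exact: ac_sqint (ha n).
by apply: (ae_imply2 _ e0 e1) => s h0 h1 sT; rewrite h0// h1.
Qed.

Lemma weighted_eq0 T u W kappa d : 0 <= T -> weight kappa T u W -> sqint mu (itv0 T) d ->
  \int[mu]_(t in `[0, T]) (W t * d t ^+ 2) <= 0 ->
  {ae mu, forall t, itv0 T t -> d t = 0}.
Proof.
move=> T0 [W' [acW W_gt0 _ _]] d2 h.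
have i1 : mu.-integrable (itv0 T) (EFin \o (fun t => W t * d t ^+ 2)).
  by apply: ac_mulr_integrable acW _ => //; exact: d2.2.
have p0 t : itv0 T t -> 0 < W t by rewrite /= in_itv/=; exact: W_gt0.
have := @Rintegral_eq0_ae _ (measurableTypeR R) R mu _ _ (measurable_itv _) i1 (fun t tT => mulr_ge0 (ltW (p0 t tT)) (sqr_ge0 _)) h.
apply: ae_imply1 => t ht tT; have /eqP := ht tT.
by rewrite mulf_eq0 (gt_eqF (p0 t tT))/= sqrf_eq0 => /eqP.
Qed.

(** Banach's fixed point theorem on all intervals [[0, T]] at once. The factor [4] makes the squared
    increments decay like [4^-n], as [L2_complete] requires. The fixed point is a class, hence the
    equality only almost everywhere. *)
Lemma picard W kappa u (Phi : (R -> R) -> R -> R) : 0 <= kappa ->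
  (forall T, 0 <= T -> weight kappa T u W) ->
  (forall r, locally_sqint r -> locally_sqint (Phi r)) ->
  (forall r s T, 0 <= T -> locally_sqint r -> locally_sqint s ->
    4 * \int[mu]_(t in `[0, T]) (W t * (Phi r t - Phi s t) ^+ 2) <=
    \int[mu]_(t in `[0, T]) (W t * (r t - s t) ^+ 2)) ->
  exists2 r, locally_sqint r &
    forall T, 0 <= T -> {ae mu, forall t, itv0 T t -> Phi r t = r t}.
Proof.
move=> k0 hW PhiL PhiC; pose F n := iter n Phi (fun=> 0).
have FL n : locally_sqint (F n).
  by elim: n => [|n ih]; [exact: locally_sqint0|exact: PhiL].
have W1 T r : 0 <= T -> sqint mu (itv0 T) r ->
    mu.-integrable (itv0 T) (EFin \o (fun t => W t * r t ^+ 2)).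
  move=> T0 r2; have [W' [acW _ _ _]] := hW T T0.
  by apply: ac_mulr_integrable acW _ => //; exact: r2.2.
have WT T : 0 <= T -> 0 < W T.
  by move=> T0; have [W' [_ W_gt0 _ _]] := hW T T0; rewrite W_gt0// T0 lexx.
have WI T r : 0 <= T -> sqint mu (itv0 T) r ->
    W T * \int[mu]_(t in `[0, T]) (r t ^+ 2) <= \int[mu]_(t in `[0, T]) (W t * r t ^+ 2).
  move=> T0 r2; rewrite -RintegralZl//; last exact: r2.2.
  apply: le_Rintegral => //; [by apply: integrableZr => //; exact: r2.2|exact: W1|].
  move=> t; rewrite /= in_itv/= => tT; rewrite ler_wpM2r ?sqr_ge0//.
  by have /andP[] := weight_decr T0 k0 (hW T T0) tT.
have IW T r : 0 <= T -> sqint mu (itv0 T) r ->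
    \int[mu]_(t in `[0, T]) (W t * r t ^+ 2) <= \int[mu]_(t in `[0, T]) (r t ^+ 2).
  move=> T0 r2; apply: le_Rintegral => //; [exact: W1|exact: r2.2|].
  move=> t; rewrite /= in_itv/= => tT; rewrite ler_piMl ?sqr_ge0//.
  by have /andP[] := weight_decr T0 k0 (hW T T0) tT.
pose K T := \int[mu]_(t in `[0, T]) (W t * (F 1%N t - F 0%N t) ^+ 2).
have step T n : 0 <= T ->
    \int[mu]_(t in `[0, T]) (W t * (F n.+1 t - F n t) ^+ 2) <= K T / 4 ^+ n.
  move=> T0; elim: n => [|n ih]; first by rewrite expr0 divr1.
  rewrite exprS invfM mulrCA ler_pdivlMl//.
  by apply: le_trans ih; exact: (PhiC (F n.+1) (F n) T T0 (FL n.+1) (FL n)).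
have cvF T : 0 <= T -> sqint mu (itv0 T) (pointwise_lim F) /\
    \int[mu]_(x in itv0 T) ((F n x - pointwise_lim F x) ^+ 2) @[n --> \oo] --> (0 : R).
  move=> T0; apply: (@L2_complete _ _ _ mu (itv0 T) F ((W T)^-1 * K T)) => //.
    by move=> n; exact: FL.
  move=> n; rewrite -mulrA ler_pdivlMl ?WT//.
  apply: le_trans (step T n T0); apply: WI => //.
  by apply: sqintB => //; exact: FL.
pose r := pointwise_lim F; have rL : locally_sqint r by move=> T T0; have [] := cvF T T0.
exists r => // T T0.
have d2 : sqint mu (itv0 T) (fun t => Phi r t - r t).
  by apply: sqintB => //; [exact: PhiL|exact: rL].
suff /(weighted_eq0 T0 (hW T T0) d2) : \int[mu]_(t in `[0, T]) (W t * (Phi r t - r t) ^+ 2) <= 0.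
  by apply: ae_imply1 => t ht tT; apply/eqP; rewrite -subr_eq0; apply/eqP; exact: ht.
have [_ cv] := cvF T T0.
have D2 n : sqint mu (itv0 T) (fun t => F n t - r t).
  by apply: sqintB => //; [exact: FL|exact: rL].
have P2 n : sqint mu (itv0 T) (fun t => Phi r t - F n.+1 t).
  by apply: sqintB => //; [exact: PhiL|exact: FL].
pose I n := \int[mu]_(x in itv0 T) ((F n x - r x) ^+ 2).
(* Insert [F n.+1], which is [Phi (F n)]: the contraction bounds one piece and the [L^2] convergence
   the other. *)
have bound n : \int[mu]_(t in `[0, T]) (W t * (Phi r t - r t) ^+ 2) <= 2 * I n + 2 * I n.+1.
  apply: (@le_trans _ _ (2 * \int[mu]_(t in `[0, T]) (W t * (Phi r t - F n.+1 t) ^+ 2) +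
    2 * \int[mu]_(t in `[0, T]) (W t * (F n.+1 t - r t) ^+ 2))).
    rewrite -!RintegralZl//; [|exact: W1|exact: W1].
    rewrite -RintegralD//; [|by apply: integrableZr => //; exact: W1..].
    apply: le_Rintegral => //; first exact: W1.
      by apply: integrableDr => //; apply: integrableZr => //; exact: W1.
    move=> t tT.
    have Wt : 0 <= W t.
      by move: tT; rewrite /= in_itv/=; have [W' [_ W_gt0 _ _]] := hW T T0 => tT; rewrite ltW// W_gt0.
    have := sqrD_le (Phi r t - F n.+1 t) (F n.+1 t - r t).
    by rewrite addrA subrK => /(ler_wpM2l Wt); lra.
  apply: lerD; rewrite ler_pM2l//; last exact: IW.
  apply: le_trans (IW T _ T0 (D2 n)).
  have h := PhiC r (F n) T T0 rL (FL n).
  have h1 : 0 <= \int[mu]_(t in `[0, T]) (W t * (Phi r t - F n.+1 t) ^+ 2).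
    apply: Rintegral_ge0 => // t; rewrite /= in_itv/= => tT.
    by have [W' [_ W_gt0 _ _]] := hW T T0; rewrite mulr_ge0 ?sqr_ge0// ltW// W_gt0.
  have -> : \int[mu]_(t in `[0, T]) (W t * (F n t - r t) ^+ 2) =
     \int[mu]_(t in `[0, T]) (W t * (r t - F n t) ^+ 2).
    by apply: eq_Rintegral => t _; rewrite -sqrrN opprB.
  by move: h h1; rewrite -/(F n.+1); lra.
have cvI : 2 * I n + 2 * I n.+1 @[n --> \oo] --> (2 * 0 + 2 * 0 : R).
  apply: cvgD; apply: cvgMr => //.
  by rewrite (cvg_shiftS I).
rewrite mulr0 addr0 in cvI; rewrite -[leRHS](cvg_lim (@Rhausdorff R) cvI).
by apply: limr_ge; [by apply/cvg_ex; eexists; exact: cvI|exact: nearW].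
Qed.

End existence_tools.

(** * Contraction of the feedback maps and existence *)

Section feedback.
Context (R : realType).
Notation mu := (@lebesgue_measure R).
Notation itv0 T := (`[0%R, T]%classic : set (measurableTypeR R)).
Implicit Types (f h : L2 R) (v : R -> L2 R) (T kappa : R) (g W : R -> R).

Lemma weight_mul_integrable T kappa u W g : 0 <= T -> weight kappa T u W ->
  sqint mu (itv0 T) g -> mu.-integrable (itv0 T) (EFin \o (fun t => W t * g t ^+ 2)).
Proof.
move=> T0 [W' [acW _ _ _]] g2.
by apply: ac_mulr_integrable acW _ => //; exact: g2.2.
Qed.

(** Differentiate [W z^2]. The decay rate of [W] produces [- 2 kappa u^2 z^2], and Young's
    inequality for [2 c r u z] uses half of it and leaves [r^2 / kappa]. This is where the weight
    has to depend on [u]. *)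
Lemma drift_bound T kappa u W z r c : 0 <= T -> 0 < kappa -> weight kappa T u W ->
  sqint mu (itv0 T) u -> sqint mu (itv0 T) r -> c ^+ 2 <= 1 ->
  ac T (fun s => c * r s * u s) z -> z 0 = 0 ->
  kappa ^+ 2 * \int[mu]_(s in `[0, T]) (W s * (z s * u s) ^+ 2) <=
  \int[mu]_(s in `[0, T]) (W s * r s ^+ 2).
Proof.
move=> T0 k0 wW u2 r2 c1 acz z0; have [W' [acW W_gt0 dW W0]] := wW.
have acZ := ac_mul T0 acz acz; have acWZ := ac_mul T0 acW acZ.
have [M _ hM] := ac_bounded T0 acz.
have zu2 : sqint mu (itv0 T) (fun s => z s * u s).
  by apply: (sqint_bounded (M := M)) => //; exact: ac_measurable acz.
have i1 := weight_mul_integrable T0 wW zu2.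
have i2 := weight_mul_integrable T0 wW r2.
have WT : 0 <= W T * (z T * z T).
  by rewrite mulr_ge0 -?expr2 ?sqr_ge0// ltW// W_gt0// T0 lexx.
move: WT; rewrite (acWZ.2 T) ?T0 ?lexx// W0 z0 !mulr0 add0r => h.
rewrite -subr_ge0 -RintegralZl// -RintegralB//; last exact: integrableZr.
rewrite -(pmulr_rge0 _ (_ : 0 < kappa^-1)) ?invr_gt0// -RintegralZl//; last first.
  by apply: integrableBr => //; exact: integrableZr.
apply: (le_trans h); apply: le_Rintegral => //; first exact: acWZ.1.
  by apply: integrableZr => //; apply: integrableBr => //; exact: integrableZr.
move=> s; rewrite /= in_itv/= => sT.
have := dW s sT; have := W_gt0 s sT; move: (W s) (W' s) (z s) (u s) (r s) => w w' x y p w0 ww'.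
have h1 := ler_wpM2r (sqr_ge0 x) ww'.
have h2 : 2 * (x * (c * p * y)) <= kappa * (x * y) ^+ 2 + kappa^-1 * p ^+ 2.
  have h3 := sqr_ge0 (kappa * (x * y) - c * p).
  have h4 := ler_wpM2r (sqr_ge0 p) c1.
  rewrite -(ler_pM2l k0) mulrDr (mulrA kappa kappa^-1) mulfV ?gt_eqF// mul1r; nra.
have h3 := ler_wpM2l (ltW w0) h2.
have h4 : 0 <= kappa * w * x ^+ 2 by rewrite mulr_ge0 ?sqr_ge0// mulr_ge0 ?ltW.
have -> : kappa^-1 * (w * p ^+ 2 - kappa ^+ 2 * (w * (x * y) ^+ 2)) =
   w * (kappa^-1 * p ^+ 2) - kappa * (w * (x * y) ^+ 2) by field; rewrite gt_eqF.
by nra.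
Qed.

Lemma trace_contraction T k u W g0 g1 v x : 0 <= T -> (0 < k)%N -> endpoint x ->
  weight (k%:R ^+ 2) T u W -> sqint mu (itv0 T) g0 -> sqint mu (itv0 T) g1 ->
  heat_modes g0 g1 (fun n t => coef (v t) n) T -> L2norm (v 0) = 0 ->
  k%:R ^+ 2 * \int[mu]_(t in `[0, T]) (W t * trace (v t) x ^+ 2) <=
  128 * \int[mu]_(s in `[0, T]) (W s * (g0 s ^+ 2 + g1 s ^+ 2)).
Proof.
move=> T0 k0 ex wW g02 g12 hv v0.
have [_] := heat_trace T0 g02 g12 hv ex k0 wW.
rewrite v0 expr0n add0r => h; have kp : 0 < k%:R :> R by rewrite ltr0n.
move/(ler_wpM2l (sqr_ge0 (k%:R : R))): h => /le_trans; apply.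
rewrite le_eqVlt; apply/orP; left; apply/eqP.
by move: (\int[mu]_(s in _) _) => Q; field; rewrite gt_eqF.
Qed.

Lemma L2norm_coef0 f : (forall n, coef f n = 0) -> L2norm f = 0.
Proof.
move=> f0; apply/eqP; rewrite -(sqrf_eq0 (L2norm f)); apply/eqP.
apply: (Rcvg_unique (@coef_norm R f)).
rewrite (_ : (fun n => _) = fun=> 0); first exact: cvg_cst.
by apply/funext => n; rewrite big1// => i _; rewrite f0 expr0n.
Qed.

Variables (q b c1 : R) (u : R -> R).
Hypothesis u2 : locally_sqint u.

Definition adapt z0 r t := z0 + \int[mu]_(s in `[0, t]) (- Num.sg b * r s * u s).

Lemma adapt_ac z0 r T : locally_sqint r -> 0 <= T ->
  ac T (fun s => - Num.sg b * r s * u s) (adapt z0 r).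
Proof.
move=> r2 T0; apply: ac_primitive; apply: sqint_mul => //; last exact: u2.
by apply: sqintZ => //; exact: r2.
Qed.

Lemma sg_sqr_le1 : (- Num.sg b) ^+ 2 <= 1.
Proof. by rewrite sqrrN sqr_sg; case: (b != 0); rewrite ?ler01. Qed.

(** By [drift_bound], [z u] is no larger than [r] in the weighted norm, so the squared boundary
    input is at most [2 (b^2 + c1^2)] times that of [r]. With the [128] of [trace_contraction] and
    the desired factor [4] this gives [1024]. *)
Lemma error_contraction T k W z r v : 0 <= T -> (0 < k)%N ->
  1024 * (b ^+ 2 + c1 ^+ 2) <= k%:R ^+ 2 -> weight (k%:R ^+ 2) T u W ->
  sqint mu (itv0 T) r -> ac T (fun s => - Num.sg b * r s * u s) z -> z 0 = 0 ->
  heat_modes (fun=> 0) (fun s => b * (z s * u s) - c1 * r s) (fun n t => coef (v t) n) T ->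
  L2norm (v 0) = 0 ->
  4 * \int[mu]_(t in `[0, T]) (W t * trace (v t) 1 ^+ 2) <=
  \int[mu]_(t in `[0, T]) (W t * r t ^+ 2).
Proof.
move=> T0 k0 hk wW r2 acz z0 hv v0; have [W' [acW W_gt0 dW W0]] := wW.
have [M _ hM] := ac_bounded T0 acz.
have zu2 : sqint mu (itv0 T) (fun s => z s * u s).
  apply: (sqint_bounded (M := M)) => //; [exact: u2|exact: ac_measurable acz].
have kp : 1 <= k%:R :> R by rewrite ler1n.
have k20 : 0 < k%:R ^+ 2 :> R by rewrite exprn_gt0// ltr0n.
have i1 := weight_mul_integrable T0 wW zu2.
have i2 := weight_mul_integrable T0 wW r2.
have g12 : sqint mu (itv0 T) (fun s => b * (z s * u s) - c1 * r s).
  by apply: sqintB => //; exact: sqintZ.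
have ig := weight_mul_integrable T0 wW g12.
have := trace_contraction T0 k0 (or_intror erefl) wW (@locally_sqint0 R T T0) g12 hv v0.
have := drift_bound T0 k20 wW (u2 T0) r2 sg_sqr_le1 acz z0.
set A := \int[mu]_(s in _) (W s * (z s * u s) ^+ 2).
set I := \int[mu]_(s in _) (W s * r s ^+ 2).
set J := \int[mu]_(t in _) (W t * trace (v t) 1 ^+ 2).
have J0 : 0 <= J.
  apply: Rintegral_ge0 => // s; rewrite /= in_itv/= => sT.
  by rewrite mulr_ge0 ?sqr_ge0// ltW// W_gt0.
have A0 : 0 <= A.
  apply: Rintegral_ge0 => // s; rewrite /= in_itv/= => sT.
  by rewrite mulr_ge0 ?sqr_ge0// ltW// W_gt0.
have I0 : 0 <= I.
  apply: Rintegral_ge0 => // s; rewrite /= in_itv/= => sT.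
  by rewrite mulr_ge0 ?sqr_ge0// ltW// W_gt0.
set G := \int[mu]_(s in _) _.
have GAI : G <= 2 * b ^+ 2 * A + 2 * c1 ^+ 2 * I.
  rewrite /G /A /I -!RintegralZl// -RintegralD//; try exact: integrableZr.
  have -> : \int[mu]_(s in `[0, T]) (W s * (0 ^+ 2 + (b * (z s * u s) - c1 * r s) ^+ 2)) =
     \int[mu]_(s in `[0, T]) (W s * (b * (z s * u s) - c1 * r s) ^+ 2).
    by apply: eq_Rintegral => s _; rewrite expr0n add0r.
  apply: le_Rintegral => //.
    by apply: integrableDr => //; apply: integrableZr.
  move=> s; rewrite /= in_itv/= => sT.
  have := sqrD_le (b * (z s * u s)) (- (c1 * r s)); rewrite sqrrN => /(ler_wpM2l (ltW (W_gt0 s sT))).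
  by move=> /le_trans; apply; rewrite le_eqVlt; apply/orP; left; apply/eqP; ring.
move=> hA hJ.
have hA' : A <= I.
  by apply: le_trans hA; rewrite ler_peMl// exprn_ege1// exprn_ege1.
have hG : G <= 2 * (b ^+ 2 + c1 ^+ 2) * I.
  apply: (le_trans GAI); rewrite mulrDr mulrDl lerD2r ler_wpM2l// mulr_ge0 ?sqr_ge0//.
rewrite -(ler_pM2l k20) mulrCA; apply: (@le_trans _ _ (4 * (128 * G))).
  by rewrite ler_wpM2l.
apply: (@le_trans _ _ (1024 * (b ^+ 2 + c1 ^+ 2) * I)); last exact: ler_wpM2r.
by move: hG; lra.
Qed.

(** As in [error_contraction], with [- q p] as the only boundary input: [4 * 128 = 512]. *)
Lemma state_contraction T k W p v : 0 <= T -> (0 < k)%N ->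
  512 * q ^+ 2 <= k%:R ^+ 2 -> weight (k%:R ^+ 2) T u W -> sqint mu (itv0 T) p ->
  heat_modes (fun s => - q * p s) (fun=> 0) (fun n t => coef (v t) n) T ->
  L2norm (v 0) = 0 ->
  4 * \int[mu]_(t in `[0, T]) (W t * trace (v t) 0 ^+ 2) <=
  \int[mu]_(t in `[0, T]) (W t * p t ^+ 2).
Proof.
move=> T0 k0 hk wW p2 hv v0; have [W' [acW W_gt0 dW W0]] := wW.
have k20 : 0 < k%:R ^+ 2 :> R by rewrite exprn_gt0// ltr0n.
have qp2 : sqint mu (itv0 T) (fun s => - q * p s) by exact: sqintZ.
have := trace_contraction T0 k0 (or_introl erefl) wW qp2 (@locally_sqint0 R T T0) hv v0.
have -> : \int[mu]_(s in `[0, T]) (W s * ((- q * p s) ^+ 2 + 0 ^+ 2)) =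
   \int[mu]_(s in `[0, T]) (q ^+ 2 * (W s * p s ^+ 2)).
  by apply: eq_Rintegral => s _; ring.
rewrite RintegralZl//; last exact: (weight_mul_integrable T0 wW p2).
set I := \int[mu]_(s in _) (W s * p s ^+ 2) => h.
have I0 : 0 <= I.
  apply: Rintegral_ge0 => // s; rewrite /= in_itv/= => sT.
  by rewrite mulr_ge0 ?sqr_ge0// ltW// W_gt0.
rewrite -(ler_pM2l k20) mulrCA; apply: (@le_trans _ _ (4 * (128 * (q ^+ 2 * I)))).
  by rewrite ler_wpM2l.
apply: (@le_trans _ _ (512 * q ^+ 2 * I)); last exact: ler_wpM2r.
by lra.
Qed.


Lemma within_ray_continuous (z : R -> R) :
  (forall T, 0 <= T -> {within `[0, T], continuous z}) ->
  {within `[0, +oo[, continuous z}.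
Proof.
move=> cz; apply/subspace_continuousP => t; rewrite /= in_itv/= andbT => t0.
have /subspace_continuousP/(_ t) := cz _ (addr_ge0 t0 ler01).
rewrite /= in_itv/= t0 lerDl ler01 => /(_ isT) c.
apply/cvgrPdist_le => e e0; move/cvgrPdist_le: c => /(_ e e0).
rewrite !near_withinE => h.
have lt1 : \forall s \near t, s < t + 1 by apply: lt_nbhsl; rewrite ltrDl.
apply: filterS2 h lt1 => s hs s1; rewrite /= in_itv/= andbT => s0; apply: hs.
by rewrite /= in_itv/= s0 ltW.
Qed.

Lemma traceB_ae T g0 g1 g0' g1' v v' x : 0 <= T -> endpoint x ->
  sqint mu (itv0 T) g0 -> sqint mu (itv0 T) g1 ->
  sqint mu (itv0 T) g0' -> sqint mu (itv0 T) g1' ->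
  heat_modes g0 g1 (fun n t => coef (v t) n) T ->
  heat_modes g0' g1' (fun n t => coef (v' t) n) T ->
  {ae mu, forall t, itv0 T t -> trace (v t - v' t) x = trace (v t) x - trace (v' t) x}.
Proof.
move=> T0 ex g02 g12 g02' g12' hv hv'.
apply: (ae_imply2 _ (heat_H1_ae T0 g02 g12 hv) (heat_H1_ae T0 g02' g12' hv')).
by move=> t h h' tT; apply: traceB => //; [exact: h|exact: h'].
Qed.

Lemma coef_heat_modesB T g0 g1 g0' g1' v v' :
  heat_modes g0 g1 (fun n t => coef (v t) n) T ->
  heat_modes g0' g1' (fun n t => coef (v' t) n) T ->
  heat_modes (fun s => g0 s - g0' s) (fun s => g1 s - g1' s)
    (fun n t => coef (v t - v' t) n) T.
Proof.
move=> hv hv'; apply: (eq_heat_modes (heat_modesB hv hv')) => n s _.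
by rewrite coefB.
Qed.

Lemma large_nat : exists k : nat, [/\ (0 < k)%N, 1024 * (b ^+ 2 + c1 ^+ 2) <= k%:R ^+ 2
  & 512 * q ^+ 2 <= k%:R ^+ 2].
Proof.
have : 0 <= 1024 * (b ^+ 2 + c1 ^+ 2) by rewrite mulr_ge0 ?ler0n ?addr_ge0 ?sqr_ge0.
have : 0 <= 512 * q ^+ 2 by rewrite mulr_ge0 ?ler0n ?sqr_ge0.
move: (512 * _) (1024 * _) => y x y0 x0; have h := truncnS_gt (x + y).
exists (Num.truncn (x + y)).+1; set N := (Num.truncn _).+1 in h *.
have h1 : N%:R <= N%:R ^+ 2 :> R by rewrite expr2 ler_peMr ?ler0n ?ler1n.
by split=> //; apply: le_trans h1; apply: le_trans (ltW h); rewrite ?lerDl ?lerDr.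
Qed.

(** The mismatch [r] is found first, as a fixed point for the error equation. Then [zeta] is known,
    and the plant is a linear heat equation whose trace at [0] is found by the second fixed point.
    The observer state is the difference of the two solutions. *)
Lemma closed_loop_exists w0 h0 zi : exists w what zeta,
  closed_loop q b c1 u w what zeta /\ initial_state w0 h0 zi w what zeta.
Proof.
have [k [k0 kbc kq]] := large_nat.
have [W hW] := weight_exists (k%:R ^+ 2) u2.
pose ge r s := b * (adapt zi r s * u s) - u s - c1 * r s.
have adL r : locally_sqint r -> locally_sqint (fun s => adapt zi r s * u s).
  by move=> r2; apply: locally_sqint_ac_mul u2 => T T0; exact: (adapt_ac zi r2 T0).
have geL r : locally_sqint r -> locally_sqint (ge r).
  move=> r2; apply: locally_sqintB; last exact: locally_sqintZ.
  by apply: locally_sqintB => //; apply: locally_sqintZ; exact: adL.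
have L0 := @locally_sqint0 R.
have /choice[E hE] : forall r, exists v, locally_sqint r ->
    (forall n, coef (v 0) n = coef (w0 - h0) n) /\
    forall T, 0 <= T -> heat_modes (fun=> 0) (ge r) (fun n t => coef (v t) n) T.
  move=> r; have [r2|nr] := pselect (locally_sqint r); last by exists (fun=> 0) => /nr.
  by have [v hv] := heat_exists (w0 - h0) L0 (geL r r2); exists v.
pose Phi r t := trace (E r t) 1.
have e1 : endpoint (1 : R) by right.
have e0 : endpoint (0 : R) by left.
have PhiL r : locally_sqint r -> locally_sqint (Phi r).
  move=> r2 T T0; have [_ /(_ T T0) hm] := hE r r2.
  by have [] := heat_trace T0 (L0 T T0) (geL r r2 T T0) hm e1 k0 (hW T T0).
have PhiC r s T : 0 <= T -> locally_sqint r -> locally_sqint s ->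
    4 * \int[mu]_(t in `[0, T]) (W t * (Phi r t - Phi s t) ^+ 2) <=
    \int[mu]_(t in `[0, T]) (W t * (r t - s t) ^+ 2).
  move=> T0 r2 s2; have [r0 /(_ T T0) hr] := hE r r2; have [s0 /(_ T T0) hs] := hE s s2.
  have hd := coef_heat_modesB hr hs.
  have -> : \int[mu]_(t in `[0, T]) (W t * (Phi r t - Phi s t) ^+ 2) =
      \int[mu]_(t in `[0, T]) (W t * trace (E r t - E s t) 1 ^+ 2).
    apply: ae_eq_Rintegral.
    have := traceB_ae T0 e1 (L0 T T0) (geL r r2 T T0) (L0 T T0) (geL s s2 T T0) hr hs.
    by apply: ae_imply1 => t ht tT; rewrite ht.
  apply: (error_contraction (z := fun t => adapt zi r t - adapt zi s t) T0 k0 kbc (hW T T0)).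
  - by apply: sqintB => //; [exact: r2|exact: s2].
  - apply: eq_ac (ac_add (adapt_ac zi r2 T0) (ac_scale (-1) (adapt_ac zi s2 T0))) _ _ => t _ /=.
      by ring.
    by rewrite mulN1r.
  - by rewrite /adapt set_itv1 !Rintegral_set1 subrr.
  - rewrite (_ : (fun s0 => 0) = fun s0 => 0 - 0 :> R); last by apply/funext => t; rewrite subr0.
    rewrite (_ : (fun t => b * _ - _) = fun t => ge r t - ge s t)//.
    by apply/funext => t; rewrite /ge; ring.
  - by apply: L2norm_coef0 => n; rewrite coefB r0 s0 subrr.
have [r r2 rfix] := picard (sqr_ge0 _) hW PhiL PhiC.
(* [r] is the trace of the error only almost everywhere. The actual trace [rho] replaces it from
   here on, which leaves [zeta] and the boundary integrals unchanged. *)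
pose e := E r; pose rho t := trace (e t) 1.
have rho2 : locally_sqint rho by exact: PhiL.
pose zeta := adapt zi rho.
have rr T : 0 <= T -> {ae mu, forall t, itv0 T t -> r t = rho t}.
  by move=> T0; apply: ae_imply1 (rfix T T0) => t ht tT; rewrite -ht.
have zz t : 0 <= t -> adapt zi r t = zeta t.
  move=> t0; rewrite /zeta /adapt; congr (_ + _); apply: ae_eq_Rintegral.
  by apply: ae_imply1 (rr t t0) => s hs st; rewrite hs.
have [ei em] := hE r r2.
have he T : 0 <= T -> heat_modes (fun=> 0) (ge rho) (fun n t => coef (e t) n) T.
  move=> T0; apply: (eq_heat_modes_ae T0 (em T T0)) => //.
  - exact: L0.
  - exact: geL.
  - by apply: aeW => s.
  - apply: ae_imply1 (rr T T0) => s hs sT; rewrite /ge hs// zz//.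
    by move: sT; rewrite /= in_itv/= => /andP[].
pose g1 t := b * zeta t * u t.
have g1L : locally_sqint g1.
  have -> : g1 = fun t => b * (zeta t * u t) by apply/funext => t; rewrite /g1 mulrA.
  by apply: locally_sqintZ; exact: adL.
pose g0 (p : R -> R) (t : R) := - q * p t.
have g0L p : locally_sqint p -> locally_sqint (g0 p) by exact: locally_sqintZ.
have /choice[P hP] : forall p, exists v, locally_sqint p ->
    (forall n, coef (v 0) n = coef w0 n) /\
    forall T, 0 <= T -> heat_modes (g0 p) g1 (fun n t => coef (v t) n) T.
  move=> p; have [p2|np] := pselect (locally_sqint p); last by exists (fun=> 0) => /np.
  by have [v hv] := heat_exists w0 (g0L p p2) g1L; exists v.
pose Psi p t := trace (P p t) 0.
have PsiL p : locally_sqint p -> locally_sqint (Psi p).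
  move=> p2 T T0; have [_ /(_ T T0) hm] := hP p p2.
  by have [] := heat_trace T0 (g0L p p2 T T0) (g1L T T0) hm e0 k0 (hW T T0).
have PsiC p s T : 0 <= T -> locally_sqint p -> locally_sqint s ->
    4 * \int[mu]_(t in `[0, T]) (W t * (Psi p t - Psi s t) ^+ 2) <=
    \int[mu]_(t in `[0, T]) (W t * (p t - s t) ^+ 2).
  move=> T0 p2 s2; have [p0 /(_ T T0) hp] := hP p p2; have [s0 /(_ T T0) hs] := hP s s2.
  have hd := coef_heat_modesB hp hs.
  have -> : \int[mu]_(t in `[0, T]) (W t * (Psi p t - Psi s t) ^+ 2) =
      \int[mu]_(t in `[0, T]) (W t * trace (P p t - P s t) 0 ^+ 2).
    apply: ae_eq_Rintegral.
    have := traceB_ae T0 e0 (g0L p p2 T T0) (g1L T T0) (g0L s s2 T T0) (g1L T T0) hp hs.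
    by apply: ae_imply1 => t ht tT; rewrite ht.
  apply: (state_contraction T0 k0 kq (hW T T0)).
  - by apply: sqintB => //; [exact: p2|exact: s2].
  - rewrite (_ : (fun s0 => 0) = fun t => g1 t - g1 t); last by apply/funext => t; rewrite subrr.
    rewrite (_ : (fun t => - q * _) = fun t => g0 p t - g0 s t)//.
    by apply/funext => t; rewrite /g0; ring.
  - by apply: L2norm_coef0 => n; rewrite coefB p0 s0 subrr.
have [p p2 pfix] := picard (sqr_ge0 _) hW PsiL PsiC.
have [wi wm] := hP p p2.
pose w := P p; pose what t := w t - e t.
pose tw0 t := trace (w t) 0.
have tw02 : locally_sqint tw0 by exact: PsiL.
have hw T : 0 <= T -> heat_modes (g0 tw0) g1 (fun n t => coef (w t) n) T.
  move=> T0; apply: (eq_heat_modes_ae T0 (wm T T0)) => //.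
  - exact: g0L.
  - exact: g1L.
  - by apply: ae_imply1 (pfix T T0) => s hs sT; rewrite /g0 -hs.
  - by apply: aeW => s.
pose d t := trace (w t) 1 - trace (what t) 1.
have hwhat T : 0 <= T -> heat_modes (fun s => g0 tw0 s - 0) (fun s => g1 s - ge rho s)
    (fun n t => coef (what t) n) T.
  by move=> T0; apply: coef_heat_modesB; [exact: hw|exact: he].
have dL0 : locally_sqint (fun s => g0 tw0 s - 0) by apply: locally_sqintB => //; exact: g0L.
have dL1 : locally_sqint (fun s => g1 s - ge rho s) by apply: locally_sqintB => //; exact: geL.
have d2 : locally_sqint d.
  move=> T T0; apply: sqintB => //.
    by have [] := heat_trace T0 (g0L _ tw02 T T0) (g1L T T0) (hw T T0) e1 k0 (hW T T0).
  by have [] := heat_trace T0 (dL0 T T0) (dL1 T T0) (hwhat T T0) e1 k0 (hW T T0).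
(* [closed_loop] uses the difference of the traces and not the trace of the difference; they agree
   at the times when both states are in [H^1]. *)
have rd T : 0 <= T -> {ae mu, forall t, itv0 T t -> rho t = d t}.
  move=> T0; have := traceB_ae T0 e1 (g0L _ tw02 T T0) (g1L T T0) (dL0 T T0) (dL1 T T0)
    (hw T T0) (hwhat T T0).
  by apply: ae_imply1 => t ht tT; rewrite /d -ht// /what subKr.
exists w, what, zeta; split; split.
- by apply: weak_of_modes; [exact: g0L|exact: g1L|exact: hw].
- apply: weak_of_modes; first exact: g0L.
    by apply: locally_sqintD => //; exact: locally_sqintZ.
  move=> T T0; apply: (eq_heat_modes_ae T0 (hwhat T T0)).
  + exact: g0L.
  + by apply: sqintD => //; [exact: u2|apply: sqintZ => //; exact: d2].
  + by apply: aeW => s _; rewrite subr0.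
  + apply: ae_imply1 (rd T T0) => s hs sT; rewrite /ge /g1 hs// -/(d s).
    by rewrite -/zeta; ring.
- split.
  + by apply: within_ray_continuous => T T0; exact: ac_continuous (adapt_ac zi rho2 T0).
  + move=> T T0; have dT := d2 T T0; have uT := u2 T0.
    by apply: sqint_mul => //; apply: sqintZ.
  + move=> t t0; rewrite [LHS]/zeta /adapt {1}/zeta /adapt set_itv1 Rintegral_set1 addr0.
    congr (_ + _); apply: ae_eq_Rintegral.
    by apply: ae_imply1 (rd t t0) => s hs st; rewrite hs.
- by apply: coef_eq => n; rewrite wi.
- by apply: coef_eq => n; rewrite /what coefB wi ei coefB subKr.
- by rewrite /zeta /adapt set_itv1 Rintegral_set1 addr0.
Qed.

End feedback.

(** * Square integrability of inputs in [W] *)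

Section input_class.
Context (R : realType).
Notation mu := (@lebesgue_measure R).
Notation itv0 T := (`[0%R, T]%classic : set (measurableTypeR R)).
Notation ray := (`]0%R, +oo[%classic : set (measurableTypeR R)).

Lemma le_Rintegral_subset (A B : set (measurableTypeR R)) (f : R -> R) :
  measurable A -> measurable B -> A `<=` B -> mu.-integrable B (EFin \o f) ->
  (forall x, B x -> 0 <= f x) ->
  \int[mu]_(x in A) f x <= \int[mu]_(x in B) f x.
Proof.
move=> mA mB AB f1 f0; have fA := integrableS mB mA AB f1.
rewrite -lee_fin -!RintegralE//; apply: ge0_subset_integral => //.
by have /measurable_int := f1.
Qed.

(** Squaring [u = f + g] splits the bound into the constant [2 M^2] and the integrable [2 g^2]. The
    latter is cut off to the positive half-line, since nothing is known of [g] elsewhere. *)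
Lemma in_W_sqr_le (u : R -> R) : in_W u ->
  (forall T, 0 <= T -> measurable_fun (itv0 T) u) /\
  exists K G, [/\ mu.-integrable (setT : set (measurableTypeR R)) (EFin \o G), 0 <= K,
    (forall x, 0 <= G x) & {ae mu, forall x, 0 <= x -> u x ^+ 2 <= K + G x}].
Proof.
move=> [f [g [fL gL ufg]]].
have mf : measurable_fun (setT : set (measurableTypeR R)) f by move: fL => /andP[]; rewrite inE.
have mg : measurable_fun (setT : set (measurableTypeR R)) g by move: gL => /andP[]; rewrite inE.
split=> [T T0|].
  apply: (measurable_fun_itv_obnd_cbndP _ _ _).1.
  apply: (@eq_measurable_fun _ _ _ _ _ (fun x => f x + g x)).
    by move=> x; rewrite inE/= in_itv/= => /andP[x0 _]; rewrite ufg.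
  by apply: measurable_funTS; exact: measurable_funD.
have [M M0 fM] : exists2 M, 0 <= M & {ae mu, forall x, ray x -> `|f x| <= M}.
  move: fL => /andP[_]; rewrite inE/= /finite_norm unlock /Lnorm.
  (* The norm of exponent [+oo] is an essential supremum only on a space of positive measure. *)
  have -> : (0 < @lebesgue_on R `]0%R, +oo[ setT)%E.
    rewrite /lebesgue_on /mrestr setTI.
    by rewrite [X in (_ < X)%E](lebesgue_measure_itv `]0%R, +oo[) /= ltry -[X in (_ < X)%E]/(+oo%E) ltry.
  move=> /ess_sup_inf.ess_supr_bounded[M fM]; exists `|M| => //.
  have /ae_mrestr := fM; apply: ae_imply1 => x h xr.
  exact: le_trans (h xr) (ler_norm _).
have g1 : mu.-integrable ray (EFin \o (fun x => g x ^+ 2)).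
  have /integrableP[_ foo] := Lfun2_integrable_sqr gL.
  apply/integrableP; split.
    by apply/measurable_EFinP; apply: measurable_funX; exact: measurable_funTS.
  by move: foo; rewrite integral_mrestr.
exists (2 * M ^+ 2), (fun x => 2 * ((fun x => g x ^+ 2) \_ ray) x); split.
- apply: integrableZr => //; have := (integrable_mkcond _ _).1 g1.
  move=> /(_ (measurable_itv _)); apply: eq_integrable => // x _.
  by rewrite /= /patch; case: ifP.
- by rewrite mulr_ge0 ?sqr_ge0.
- by move=> x; rewrite mulr_ge0// /patch; case: ifP => // _; exact: sqr_ge0.
apply: (ae_imply2 _ fM (@ae_not_endpoint R)) => x fx x01 x0.
have xp : 0 < x by rewrite lt_neqAle x0 andbT; apply/eqP => xx; apply: x01; left.
have xr : ray x by rewrite /= in_itv/= xp.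
rewrite ufg// patchT ?inE//; apply: (le_trans (sqrD_le _ _)).
rewrite lerD2r ler_wpM2l// -(real_normK (num_real (f x))) lerXn2r ?nnegrE//.
exact: fx.
Qed.

Lemma in_W_locally_sqint (u : R -> R) : in_W u -> locally_sqint u.
Proof.
move=> /in_W_sqr_le[mu_ [K [G [G1 K0 G0 uG]]]] T T0; split; first exact: mu_.
apply: (@integrable_le_ae _ (measurableTypeR R) R mu (itv0 T) _ (fun x => K + G x)) => //.
- by apply: measurable_funX; exact: mu_.
- apply: ae_imply1 uG => x h; rewrite /= in_itv/= => /andP[x0 _].
  by rewrite ger0_norm ?sqr_ge0 ?h.
- apply: integrableDr => //; first by apply: (itv_bounded_integrable (M := `|K|)).
  exact: integrableS G1.
Qed.

(** The bounded part contributes at most [K] per unit of time, and the integrable part at most its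
    total integral. *)
Lemma in_W_uniform (u : R -> R) : in_W u -> exists2 C, 0 <= C &
  forall s t, 0 <= s -> s <= t -> \int[mu]_(x in `[s, t]) (u x ^+ 2) <= C * (1 + (t - s)).
Proof.
move=> uW; have u2 := in_W_locally_sqint uW.
have [_ [K [G [G1 K0 G0 uG]]]] := in_W_sqr_le uW.
pose I := \int[mu]_(x in setT) G x.
have I0 : 0 <= I by apply: Rintegral_ge0.
exists (K + I); first exact: addr_ge0.
move=> s t s0 st.
have K1 : mu.-integrable `[s, t] (EFin \o (fun=> K)).
  by apply: (itv_bounded_integrable (M := `|K|)).
have Gst : mu.-integrable `[s, t] (EFin \o G) by exact: integrableS G1.
apply: (@le_trans _ _ (\int[mu]_(x in `[s, t]) (K + G x))).
  apply: le_Rintegral_ae => //.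
  - by apply: integrable_itvS (u2 t (le_trans s0 st)).2.
  - exact: integrableDr.
  - apply: ae_imply1 uG => x h; rewrite /= in_itv/= => /andP[sx _].
    by apply: h; exact: le_trans sx.
rewrite RintegralD// Rintegral_cst//.
have -> : fine (mu `[s, t]%classic) = t - s.
  rewrite lebesgue_measure_itv/= lte_fin.
  move: st; rewrite le_eqVlt => /predU1P[->|st]; first by rewrite ltxx subrr.
  by rewrite st -EFinB.
have := @le_Rintegral_subset `[s, t]%classic setT G (measurable_itv _) measurableT
  (@subsetT _ _) G1 (fun x _ => G0 x).
rewrite -/I => h; have ts : 0 <= t - s by rewrite subr_ge0.
have := mulr_ge0 I0 ts; lra.
Qed.

End input_class.

(** * Uniqueness for the closed loop *)

Section uniqueness.
Context (R : realType).
Notation mu := (@lebesgue_measure R).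
Notation itv0 T := (`[0%R, T]%classic : set (measurableTypeR R)).
Implicit Types (f : L2 R) (v : R -> L2 R) (T kappa : R) (g W : R -> R).

Lemma integrable_open_closed T g : 0 <= T -> measurable_fun (itv0 T) g ->
  mu.-integrable (`]0, T[%classic : set (measurableTypeR R)) (EFin \o g) ->
  mu.-integrable (itv0 T) (EFin \o g).
Proof.
move=> T0 mg g1.
have : mu.-integrable (`]0, T]%classic : set (measurableTypeR R)) (EFin \o g).
  apply/integrableP; split.
    by apply/measurable_EFinP; apply: measurable_funS mg => //; apply: subset_itv; rewrite bnd_simp.
  have /integrableP[_] := g1; rewrite integral_itv_bndo_bndc//.
  by apply/measurable_EFinP/measurableT_comp => //; exact: (integrable_mf g1).
move=> g1'; apply/integrableP; split; first exact/measurable_EFinP.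
have /integrableP[_] := g1'; rewrite integral_itv_obnd_cbnd//.
by apply/measurable_EFinP/measurableT_comp => //; exact: (integrable_mf g1').
Qed.

(** The energy estimates need square-integrable boundary data, while [weak_heat] grants only
    integrable ones. The Bochner condition breaks the circle: [trace_sqr_le] with [k = 1] bounds the
    squared trace by [8] times the squared [H^1] norm. *)
Lemma weak_trace_sqint g0 g1 v x : weak_heat g0 g1 v -> endpoint x ->
  locally_sqint (fun t => trace (v t) x).
Proof.
move=> hv ex T T0; have hm T' : 0 <= T' -> heat_modes g0 g1 (fun n t => coef (v t) n) T'.
  by move=> T'0; exact: modes_of_weak.
have [_ /(_ (T + 1) (ltr_wpDl T0 ltr01))[Hv _ fin] _ _ _] := hv.
have T1 : 0 <= T + 1 by rewrite addr_ge0.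
have mc n : measurable_fun (itv0 (T + 1)) (fun t => coef (v t) n).
  exact: measurable_coef (hm _ T1) n.
have mH : measurable_fun (itv0 (T + 1)) (fun t => H1norm (v t) ^+ 2).
  have -> : (fun t => H1norm (v t) ^+ 2) = fun t =>
      L2norm (v t) ^+ 2 + L2norm (deriv1 (v t)) ^+ 2 by apply/funext => t; exact: H1norm_sqr.
  by apply: measurable_funD; [exact: measurable_L2norm_sqr|exact: measurable_deriv_sqr].
have mt : measurable_fun (itv0 (T + 1)) (fun t => trace (v t) x) by exact: measurable_trace.
suff : sqint mu (itv0 (T + 1)) (fun t => trace (v t) x).
  by apply: sqint_itvS => //; rewrite lerDl.
split => //; apply: (@integrable_le_ae _ (measurableTypeR R) R mu (itv0 (T + 1)) _
  (fun t => 8 * H1norm (v t) ^+ 2)) => //.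
- exact: measurable_funX.
- apply: aeW => t tT; rewrite ger0_norm ?sqr_ge0//.
  have [Ht|nt] := pselect (is_H1 (v t)); last first.
    by rewrite trace_out// expr0n mulr_ge0 ?sqr_ge0.
  have := @trace_sqr_le R (v t) x 1%N (H1norm (v t) ^+ 2) ex isT; rewrite divr1; apply => n.
  rewrite H1norm_sqr; apply: le_trans (lerD (coef_bessel (v t) n) (deriv_bessel n Ht)).
  rewrite -big_split/=; apply: ler_sum => i _; rewrite mulrDl expr1n mul1r addrC.
  by [].
- apply: integrableZr => //; apply: integrable_open_closed => //.
  apply: integrable_Rlty => //.
    by apply: measurable_funS mH => //; apply: subset_itv; rewrite bnd_simp.
  by move=> t _; exact: sqr_ge0.
Qed.

Variables (q b c1 : R) (u : R -> R).
Hypothesis u2 : locally_sqint u.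

Section loop.
Variables (w what : R -> L2 R) (zeta : R -> R).
Hypothesis hl : closed_loop q b c1 u w what zeta.

Definition mismatch t := trace (w t) 1 - trace (what t) 1.

Lemma loop_p_sqint : locally_sqint (fun t => trace (w t) 0).
Proof. by have [h _ _] := hl; apply: weak_trace_sqint h _; left. Qed.

Lemma mismatch_sqint : locally_sqint mismatch.
Proof.
have [h h' _] := hl.
by apply: locally_sqintB; apply: weak_trace_sqint; first [exact: h|exact: h'|right].
Qed.

Lemma loop_zeta_ac T : 0 <= T -> ac T (fun t => - Num.sg b * mismatch t * u t) zeta.
Proof.
move=> T0; have [_ _ [_ h1 hz]] := hl; split; first exact: h1.
by move=> t /andP[t0 _]; exact: hz.
Qed.

Lemma loop_input_sqint : locally_sqint (fun t => zeta t * u t).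
Proof. by apply: locally_sqint_ac_mul u2 => T T0; exact: (loop_zeta_ac T0). Qed.

Lemma loop_w_modes T : 0 <= T ->
  heat_modes (fun t => - q * trace (w t) 0) (fun t => b * zeta t * u t)
    (fun n t => coef (w t) n) T.
Proof. by move=> T0; have [h _ _] := hl; exact: modes_of_weak. Qed.

Lemma loop_what_modes T : 0 <= T ->
  heat_modes (fun t => - q * trace (w t) 0) (fun t => u t + c1 * mismatch t)
    (fun n t => coef (what t) n) T.
Proof. by move=> T0; have [_ h _] := hl; exact: modes_of_weak. Qed.

Definition error t := w t - what t.

Lemma bzu_sqint : locally_sqint (fun t => b * zeta t * u t).
Proof.
have -> : (fun t => b * zeta t * u t) = fun t => b * (zeta t * u t).
  by apply/funext => t; rewrite mulrA.
exact: locally_sqintZ loop_input_sqint.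
Qed.

Definition error_input t := b * (zeta t * u t) - u t - c1 * mismatch t.

Lemma error_input_sqint : locally_sqint error_input.
Proof.
apply: locally_sqintB; last exact: locally_sqintZ mismatch_sqint.
by apply: locally_sqintB => //; exact: locally_sqintZ loop_input_sqint.
Qed.

Lemma error_modes T : 0 <= T ->
  heat_modes (fun=> 0) error_input (fun n t => coef (error t) n) T.
Proof.
move=> T0; have h := coef_heat_modesB (loop_w_modes T0) (loop_what_modes T0).
rewrite (_ : (fun=> 0) = fun t => - q * trace (w t) 0 - - q * trace (w t) 0); last first.
  by apply/funext => t; rewrite subrr.
rewrite (_ : error_input = fun t => b * zeta t * u t - (u t + c1 * mismatch t))//.
by apply/funext => t; rewrite /error_input; ring.
Qed.

Lemma error_trace_ae T : 0 <= T ->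
  {ae mu, forall t, itv0 T t -> trace (error t) 1 = mismatch t}.
Proof.
move=> T0; apply: (traceB_ae T0 _ _ _ _ _ (loop_w_modes T0) (loop_what_modes T0)).
- by right.
- exact: locally_sqintZ loop_p_sqint _ T0.
- exact: bzu_sqint.
- exact: locally_sqintZ loop_p_sqint _ T0.
- by apply: locally_sqintD => //; exact: locally_sqintZ mismatch_sqint.
Qed.

End loop.

Lemma contraction_eq0 T k W d : 0 <= T -> weight (k%:R ^+ 2) T u W -> sqint mu (itv0 T) d ->
  4 * \int[mu]_(t in `[0, T]) (W t * d t ^+ 2) <= \int[mu]_(t in `[0, T]) (W t * d t ^+ 2) ->
  {ae mu, forall t, itv0 T t -> d t = 0}.
Proof.
move=> T0 wW d2 h; apply: (weighted_eq0 T0 wW d2).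
by move: h; set I := \int[mu]_(t in _) _; lra.
Qed.

Lemma heat_zero T k W g0 g1 v : 0 <= T -> (0 < k)%N -> weight (k%:R ^+ 2) T u W ->
  sqint mu (itv0 T) g0 -> sqint mu (itv0 T) g1 ->
  heat_modes g0 g1 (fun n t => coef (v t) n) T -> L2norm (v 0) = 0 ->
  {ae mu, forall t, itv0 T t -> g0 t = 0} -> {ae mu, forall t, itv0 T t -> g1 t = 0} ->
  forall n, coef (v T) n = 0.
Proof.
move=> T0 k0 wW g02 g12 hv v0 z0 z1 n.
have [W' [_ W_gt0 _ _]] := wW.
have := heat_sup T0 g02 g12 hv k0 wW.
rewrite (@ae_eq_Rintegral _ _ _ mu _ _ (fun=> 0)); last first.
  by apply: (ae_imply2 _ z0 z1) => t h0 h1 tT; rewrite h0// h1// expr0n addr0 mulr0.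
have -> : \int[mu]_(t in `[0, T]) (0 : R) = 0 by rewrite /Rintegral integral0_eq.
rewrite v0 expr0n add0r mulr0.
rewrite pmulr_rle0 ?W_gt0 ?T0 ?lexx// => h.
have /eqP : L2norm (v T) ^+ 2 == 0 by rewrite eq_le h sqr_ge0.
move=> /eqP; rewrite sqrf_eq0 => /eqP n0.
by apply/eqP; rewrite -normr_le0 (le_trans (coef_le _ _))// n0.
Qed.

(** Same order as for existence: the difference [d] of the mismatches satisfies [4 |d|^2 <= |d|^2]
    in the weighted norm, hence vanishes; then the gains and the errors agree, and the same argument
    applies to the traces at [0]. Traces agree almost everywhere, but [heat_zero] gives the states
    at the final time [T], which is arbitrary. *)
Lemma closed_loop_unique w what zeta w' what' zeta' (w0 h0 : L2 R) z0 :
  closed_loop q b c1 u w what zeta -> closed_loop q b c1 u w' what' zeta' ->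
  initial_state w0 h0 z0 w what zeta -> initial_state w0 h0 z0 w' what' zeta' ->
  forall t, 0 <= t -> [/\ w' t =L2 w t, what' t =L2 what t & zeta' t = zeta t].
Proof.
move=> hl hl' [iw ih iz] [iw' ih' iz'] T T0.
have [k [k0 kbc kq]] := large_nat q b c1.
have [W /(_ T T0) wW] := weight_exists (k%:R ^+ 2) u2.
pose d t := mismatch w' what' t - mismatch w what t.
have d2 : sqint mu (itv0 T) d.
  by apply: sqintB => //; [exact: mismatch_sqint hl' _ T0|exact: mismatch_sqint hl _ T0].
have he := coef_heat_modesB (error_modes hl' T0) (error_modes hl T0).
have cw n t : w' 0 =L2 w0 -> coef (w' 0) n = coef w0 n by move=> h; exact: eq_coef h.
have e0 : L2norm (error w' what' 0 - error w what 0) = 0.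
  apply: L2norm_coef0 => n; rewrite !coefB.
  by rewrite (eq_coef n iw) (eq_coef n iw') (eq_coef n ih) (eq_coef n ih') subrr.
pose z t := zeta' t - zeta t.
have acz : ac T (fun s => - Num.sg b * d s * u s) z.
  apply: eq_ac (ac_add (loop_zeta_ac hl' T0) (ac_scale (-1) (loop_zeta_ac hl T0))) _ _ => s _ /=.
    by rewrite /d; ring.
  by rewrite mulN1r.
have z00 : z 0 = 0 by rewrite /z iz iz' subrr.
have hed : heat_modes (fun=> 0) (fun s => b * (z s * u s) - c1 * d s)
    (fun n t => coef (error w' what' t - error w what t) n) T.
  rewrite (_ : (fun=> 0) = fun t => 0 - 0 :> R); last by apply/funext => t; rewrite subr0.
  rewrite (_ : (fun s => b * _ - _) = fun t => error_input w' what' zeta' t - error_input w what zeta t)//.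
  by apply/funext => t; rewrite /error_input /z /d; ring.
have tr : {ae mu, forall t, itv0 T t ->
    trace (error w' what' t - error w what t) 1 = d t}.
  have L0 := @locally_sqint0 R T T0.
  have h1 := traceB_ae T0 (or_intror erefl) L0 (error_input_sqint hl' T0) L0
    (error_input_sqint hl T0) (error_modes hl' T0) (error_modes hl T0).
  have h2 := ae_imply2 (fun t a b tT => conj (a tT) (b tT)) (error_trace_ae hl' T0) (error_trace_ae hl T0).
  by apply: (ae_imply2 _ h1 h2) => t a1 a2 tT; rewrite a1//; have [-> ->] := a2 tT.
have dz : {ae mu, forall t, itv0 T t -> d t = 0}.
  apply: (contraction_eq0 T0 wW d2).
  have := error_contraction u2 T0 k0 kbc wW d2 acz z00 hed e0.
  congr (4 * _ <= _); apply: ae_eq_Rintegral.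
  by apply: ae_imply1 tr => t ht tT; rewrite ht.
have zz t : 0 <= t <= T -> z t = 0.
  move=> tT; rewrite (acz.2 t tT) z00 add0r.
  rewrite (@ae_eq_Rintegral _ _ _ mu _ _ (fun=> 0)); first by rewrite /Rintegral integral0_eq.
  apply: ae_imply1 dz => s hs; rewrite /= in_itv/= => /andP[s0 st].
  rewrite hs ?mulr0 ?mul0r//= in_itv/= s0 (le_trans st)//.
  by case/andP: tT.
have aci := ac_bounded T0 acz.
have zu2 : sqint mu (itv0 T) (fun s => z s * u s).
  have [M _ hM] := aci.
  apply: (sqint_bounded (M := M)) => //; [exact: u2|exact: ac_measurable acz].
have ezero : forall n, coef (error w' what' T - error w what T) n = 0.
  apply: (heat_zero (v := fun t => error w' what' t - error w what t)
    T0 k0 wW (@locally_sqint0 R T T0) _ hed e0).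
  - by apply: sqintB => //; exact: sqintZ.
  - exact: aeW.
  - apply: ae_imply1 dz => t ht tT; by rewrite ht// zz ?mul0r ?mulr0 ?subr0.
pose p t := trace (w' t) 0 - trace (w t) 0.
have p2 : sqint mu (itv0 T) p.
  by apply: sqintB => //; [exact: loop_p_sqint hl' _ T0|exact: loop_p_sqint hl _ T0].
have qp2 : sqint mu (itv0 T) (fun s => - q * p s) by exact: sqintZ.
have hw : heat_modes (fun s => - q * p s) (fun=> 0) (fun n t => coef (w' t - w t) n) T.
  apply: (eq_heat_modes_ae T0 (coef_heat_modesB (loop_w_modes hl' T0) (loop_w_modes hl T0))) => //.
  - exact: locally_sqint0.
  - by apply: aeW => s _; rewrite /p; ring.
  - apply: aeW => s; rewrite /= in_itv/= => /zz; rewrite /z => /eqP; rewrite subr_eq0 => /eqP ->.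
    by rewrite subrr.
have w00 : L2norm (w' 0 - w 0) = 0.
  by apply: L2norm_coef0 => n; rewrite !coefB (eq_coef n iw) (eq_coef n iw') subrr.
have trp : {ae mu, forall t, itv0 T t -> trace (w' t - w t) 0 = p t}.
  apply: (traceB_ae T0 (or_introl erefl) _ _ _ _ (loop_w_modes hl' T0) (loop_w_modes hl T0)).
  - exact: locally_sqintZ (loop_p_sqint hl') _ T0.
  - exact: bzu_sqint hl' _ T0.
  - exact: locally_sqintZ (loop_p_sqint hl) _ T0.
  - exact: bzu_sqint hl _ T0.
have pz : {ae mu, forall t, itv0 T t -> p t = 0}.
  apply: (contraction_eq0 T0 wW p2).
  have := state_contraction T0 k0 kq wW p2 hw w00.
  congr (4 * _ <= _); apply: ae_eq_Rintegral.
  by apply: ae_imply1 trp => t ht tT; rewrite ht.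
have wzero : forall n, coef (w' T - w T) n = 0.
  apply: (heat_zero (v := fun t => w' t - w t) T0 k0 wW qp2 (@locally_sqint0 R T T0) hw w00).
  - by apply: ae_imply1 pz => t ht tT; rewrite ht// mulr0.
  - exact: aeW.
have ww n : coef (w' T) n = coef (w T) n.
  by have /eqP := wzero n; rewrite coefB subr_eq0 => /eqP.
split.
- exact: coef_eq.
- apply: coef_eq => n; have := ezero n; rewrite !coefB ww => /eqP.
  by rewrite subr_eq0 => /eqP/addrI/oppr_inj.
- by apply/eqP; rewrite -subr_eq0; apply/eqP; apply: zz; rewrite T0 lexx.
Qed.

End uniqueness.
(** * Stability *)

Section limits_at_infinity.
Context (R : realType).

(** The threshold is kept nonnegative so that estimates valid for [t >= 0] apply beyond it. *)
Definition tends (f : R -> R) l := forall e, 0 < e ->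
  exists2 M, 0 <= M & forall t, M <= t -> `|f t - l| <= e.

Lemma tends_cvg f l : tends f l -> f t @[t --> +oo] --> l.
Proof.
move=> h; apply/cvgrPdist_le => e e0; have [M M0 hM] := h e e0.
by exists M; split; [exact: num_real|move=> t /ltW Mt; rewrite distrC; exact: hM].
Qed.

Lemma tends_shift f l a : 0 <= a -> tends (fun t => f (t + a)) l -> tends f l.
Proof.
move=> a0 h e e0; have [M M0 hM] := h e e0; exists (M + a); first exact: addr_ge0.
by move=> t Mt; have := hM (t - a); rewrite subrK lerBrDr => /(_ Mt).
Qed.

Lemma tendsD f g l m : tends f l -> tends g m -> tends (fun t => f t + g t) (l + m).
Proof.
move=> hf hg e e0; have e2 : 0 < e / 2 by rewrite divr_gt0.
have [M1 M10 h1] := hf _ e2; have [M2 M20 h2] := hg _ e2.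
exists (Num.max M1 M2); first by rewrite le_max M10.
move=> t; rewrite ge_max => /andP[t1 t2]; rewrite opprD addrACA.
rewrite (le_trans (ler_normD _ _))// [leRHS](splitr e).
by rewrite lerD ?h1 ?h2.
Qed.

Lemma tendsZ f l c : tends f l -> tends (fun t => c * f t) (c * l).
Proof.
move=> h e e0; have c0 : 0 < `|c| + 1 by rewrite ltr_wpDl.
have [M M0 hM] := h _ (divr_gt0 e0 c0); exists M => // t Mt.
rewrite -mulrBr normrM (le_trans (ler_wpM2l (normr_ge0 c) (hM t Mt)))//.
by rewrite mulrA ler_pdivrMr// mulrC ler_wpM2l ?(ltW e0)// lerDl.
Qed.

Lemma tends_cst (c : R) : tends (fun=> c) c.
Proof. by move=> e e0; exists 0 => // t _; rewrite subrr normr0 ltW. Qed.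

Lemma eq_tends f g l : (forall t, 0 <= t -> f t = g t) -> tends f l -> tends g l.
Proof.
move=> fg h e e0; have [M M0 hM] := h e e0; exists M => // t Mt.
by rewrite -fg ?hM// (le_trans M0).
Qed.

Lemma tends_squeeze f g : (forall t, 0 <= t -> `|f t| <= g t) -> tends g 0 -> tends f 0.
Proof.
move=> fg h e e0; have [M M0 hM] := h e e0; exists M => // t Mt.
rewrite subr0 (le_trans (fg t (le_trans M0 Mt)))//.
by have := hM t Mt; rewrite subr0; apply: le_trans; exact: ler_norm.
Qed.

Lemma tends_sqr f : tends (fun t => f t ^+ 2) 0 -> tends f 0.
Proof.
move=> h e e0; have [M M0 hM] := h _ (exprn_gt0 2 e0); exists M => // t Mt.
have := hM t Mt; rewrite !subr0 normrX ler_pXn2r// ?nnegrE ?ltW//.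
Qed.

(** Continuity forbids a sign change once [z ^ 2] stays away from [0]. *)
Lemma tends_of_sqr (z : R -> R) l : (forall T : R, 0 <= T -> {within `[0, T], continuous z}) ->
  tends (fun t => z t ^+ 2) l -> exists m, tends z m.
Proof.
move=> cz hz.
have l0 : 0 <= l.
  rewrite leNgt; apply/negP => l0; have [|M M0 hM] := hz (- l / 2).
    by rewrite divr_gt0// oppr_gt0.
  have := hM M (lexx M); rewrite ler_norml => /andP[_].
  by have := sqr_ge0 (z M); lra.
have [l00|ln0] := eqVneq l 0.
  by exists 0; apply: tends_sqr; rewrite -[X in tends _ X]l00.
have lp : 0 < l by rewrite lt_neqAle eq_sym ln0.
have [|M M0 hM] := hz (l / 2); first by rewrite divr_gt0.
have nz t : M <= t -> z t != 0.
  move=> Mt; apply/eqP => zt; have := hM t Mt; rewrite zt expr0n sub0r normrN.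
  by rewrite ger0_norm//; lra.
have sgz t : M <= t -> Num.sg (z t) = Num.sg (z M).
  move=> Mt; apply/eqP/negPn/negP => sne.
  have t0 := le_trans M0 Mt.
  have cMt : {within `[M, t], continuous z}.
    by apply: continuous_subspaceW (cz t t0); apply: subset_itv; rewrite bnd_simp.
  have h0 : Num.min (z M) (z t) <= 0 <= Num.max (z M) (z t).
    rewrite ge_min le_max; have [zM|zM|zM] := ltgtP (z M) 0; rewrite ?orbT//=.
    - have [zt|zt|zt] := ltgtP (z t) 0; rewrite ?orbT//=.
      by move: sne; rewrite (ltr0_sg zM) (ltr0_sg zt) eqxx.
    - have [zt|zt|zt] := ltgtP (z t) 0; rewrite ?orbT//=.
      by move: sne; rewrite (gtr0_sg zM) (gtr0_sg zt) eqxx.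
  have [c] := IVT Mt cMt h0.
  by rewrite in_itv/= => /andP[Mc _] zc; have := nz c Mc; rewrite zc eqxx.
pose r := Num.sqrt l; have rp : 0 < r by rewrite sqrtr_gt0.
have rr : r ^+ 2 = l by rewrite sqr_sqrtr.
(* With the sign frozen, [r * | |z| - r | <= |z^2 - l|] because [|z| + r >= r]. *)
exists (Num.sg (z M) * r) => e e0.
have [M' M'0 hM'] := hz _ (mulr_gt0 rp e0).
exists (Num.max M M'); first by rewrite le_max M0.
move=> t; rewrite ge_max => /andP[t1 t2].
rewrite [z t]numEsg sgz// -mulrBr normrM normr_sg nz// mul1r.
have := hM' t t2; rewrite -rr -(real_normK (num_real (z t))) subr_sqr normrM.
move=> h; rewrite -(ler_pM2l rp); apply: le_trans h; rewrite mulrC ler_wpM2l//.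
by rewrite ger0_norm ?addr_ge0// ?(ltW rp)// lerDr.
Qed.

End limits_at_infinity.

(** * Energy balance and convergence *)

Section stability.
Context (R : realType).
Notation mu := (@lebesgue_measure R).
Notation itv0 T := (`[0%R, T]%classic : set (measurableTypeR R)).
Implicit Types (f : L2 R) (v : R -> L2 R) (T kappa : R) (g W : R -> R).

(** Add the product rule for the squares of the modes and pass to the limit by dominated
    convergence: the gradient sums lie below the squared [H^1] norm, and the trace products below
    [g^2] plus [8] times that norm squared. *)
Lemma heat_energy_ac T g v : 0 <= T -> sqint mu (itv0 T) g ->
  heat_modes (fun=> 0) g (fun n t => coef (v t) n) T ->
  ac T (fun t => - (2 * L2norm (deriv1 (v t)) ^+ 2) + 2 * (g t * trace (v t) 1))
    (fun t => L2norm (v t) ^+ 2).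
Proof.
move=> T0 g2 hv; have L0 := @locally_sqint0 R T T0.
have H1v := heat_H1_ae T0 L0 g2 hv.
have H1i := H1norm_integrable T0 L0 g2 hv.
have e1 : endpoint (1 : R) by right.
have [W hW] := unit_weight R.
have [tr2 _] := heat_trace T0 L0 g2 hv e1 (isT : 0 < 1)%N (hW T T0).
have mc n := measurable_coef T0 hv n.
have D1 : mu.-integrable (itv0 T) (EFin \o (fun t => L2norm (deriv1 (v t)) ^+ 2)).
  apply: integrable_le H1i => //; first exact: measurable_deriv_sqr.
  by move=> t _; rewrite ger0_norm ?sqr_ge0// H1norm_sqr lerDr sqr_ge0.
have gt1 : mu.-integrable (itv0 T) (EFin \o (fun t => g t * trace (v t) 1)).
  exact: sqint_mul.
split.
  rewrite (_ : (fun t => - _ + _) = fun t =>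
    -2 * L2norm (deriv1 (v t)) ^+ 2 + 2 * (g t * trace (v t) 1)); last first.
    by apply/funext => t; rewrite mulNr.
  by apply: integrableDr => //; exact: integrableZr.
move=> t /andP[t0 tT].
have sub : (itv0 t `<=` itv0 T)%classic by apply: subset_itv; rewrite bnd_simp.
pose A N s := \sum_(i <- index_iota 0 N) lam R i * coef (v s) i ^+ 2.
pose B N s := g s * \sum_(i <- index_iota 0 N) coef (v s) i * cosmode i 1.
have a2 i : sqint mu (itv0 T) (fun s => coef (v s) i) by exact: ac_sqint (hv i).
have A1 N : mu.-integrable (itv0 T) (EFin \o A N).
  apply: integrable_sumr; first exact: measurable_itv.
  by move=> i; apply: integrableZr => //; exact: (a2 i).2.
have Bs N : sqint mu (itv0 T) (fun s => \sum_(i <- index_iota 0 N) coef (v s) i * cosmode i 1).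
  apply: sqint_sum => // i; rewrite (_ : (fun s => _) = fun s => cosmode i 1 * coef (v s) i).
    exact: sqintZ.
  by apply/funext => s; rewrite mulrC.
have B1 N : mu.-integrable (itv0 T) (EFin \o B N) by exact: sqint_mul.
have cvA : \int[mu]_(s in `[0, t]) A N s @[N --> \oo] -->
    \int[mu]_(s in `[0, t]) (L2norm (deriv1 (v s)) ^+ 2).
  apply: (@Rdominated _ (measurableTypeR R) R mu (itv0 t) A _ (fun s => H1norm (v s) ^+ 2)) => //.
  - by move=> N; apply: measurable_funS (integrable_mf (A1 N)).
  - exact: integrableS H1i.
  - by apply: ae_imply1 H1v => s Hs st; apply: deriv_norm; apply: Hs; exact: sub.
  - apply: ae_imply1 H1v => s Hs st N; rewrite ger0_norm; last first.
      by apply: sumr_ge0 => i _; rewrite mulr_ge0 ?sqr_ge0 ?lam_ge0.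
    apply: (le_trans (deriv_bessel N (Hs (sub _ st)))).
    by rewrite H1norm_sqr lerDr sqr_ge0.
have cvB : \int[mu]_(s in `[0, t]) B N s @[N --> \oo] -->
    \int[mu]_(s in `[0, t]) (g s * trace (v s) 1).
  apply: (@Rdominated _ (measurableTypeR R) R mu (itv0 t) B _
    (fun s => g s ^+ 2 + 8 * H1norm (v s) ^+ 2)) => //.
  - by move=> N; apply: measurable_funS (integrable_mf (B1 N)).
  - apply: integrableS (sub) _ => //; apply: integrableDr => //; first exact: g2.2.
    exact: integrableZr.
  - apply: ae_imply1 H1v => s Hs st; apply: cvgMr; apply: trace_cvg => //.
    by apply: Hs; exact: sub.
  - apply: ae_imply1 H1v => s Hs st N.
    have := @partial_trace_sqr_le R (v s) 1 1%N N e1 isT; rewrite divr1.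
    have : \sum_(0 <= i < N) (lam R i + 1%:R ^+ 2) * coef (v s) i ^+ 2 <= H1norm (v s) ^+ 2.
      rewrite H1norm_sqr; apply: le_trans (lerD (coef_bessel (v s) N) (deriv_bessel N (Hs (sub _ st)))).
      rewrite -big_split/=; apply: ler_sum => i _; rewrite mulrDl expr1n mul1r addrC.
      by [].
    rewrite /B; move: (\sum_(0 <= i < N) _ * cosmode i 1) (H1norm _ ^+ 2) (\sum_(0 <= i < N) _) => x h y yh xy.
    rewrite normrM -(real_normK (num_real (g s))).
    have : `|x| ^+ 2 <= 8 * h by rewrite real_normK ?num_real//; lra.
    by have := sqr_ge0 (`|g s| - `|x|); have := sqr_ge0 `|g s|; have := sqr_ge0 `|x|; nra.
have eqN N : \sum_(0 <= i < N) coef (v t) i ^+ 2 =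
    \sum_(0 <= i < N) coef (v 0) i ^+ 2 +
      (- 2 * \int[mu]_(s in `[0, t]) A N s + 2 * \int[mu]_(s in `[0, t]) B N s).
  have A1' := integrable_itvS (lexx 0) tT (A1 N).
  have B1' := integrable_itvS (lexx 0) tT (B1 N).
  have sq i := ac_mul t0 (acS tT (hv i)) (acS tT (hv i)).
  rewrite -!RintegralZl// -RintegralD//; try exact: integrableZr.
  have -> : \int[mu]_(s in `[0, t]) (- 2 * A N s + 2 * B N s) =
      \int[mu]_(s in `[0, t]) (\sum_(i <- index_iota 0 N)
       ((- lam R i * coef (v s) i + (g s * cosmode i 1 - 0 * cosmode i 0)) * coef (v s) i +
        coef (v s) i * (- lam R i * coef (v s) i + (g s * cosmode i 1 - 0 * cosmode i 0)))).
    apply: eq_Rintegral => s _; rewrite /A /B !mulr_sumr -big_split/=.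
    by apply: eq_bigr => i _; move: (cosmode i 1) (cosmode i 0) => x y; ring.
  rewrite Rintegral_sum//; last by move=> i; exact: (sq i).1.
  rewrite -big_split/=; apply: eq_bigr => i _; have := (sq i).2 t.
  by rewrite t0 lexx => /(_ isT); rewrite -!expr2.
have -> : \int[mu]_(s in `[0, t]) (- (2 * L2norm (deriv1 (v s)) ^+ 2) + 2 * (g s * trace (v s) 1)) =
    - 2 * \int[mu]_(s in `[0, t]) (L2norm (deriv1 (v s)) ^+ 2) +
    2 * \int[mu]_(s in `[0, t]) (g s * trace (v s) 1).
  have D1' := integrable_itvS (lexx 0) tT D1.
  have gt1' := integrable_itvS (lexx 0) tT gt1.
  rewrite -!RintegralZl// -RintegralD//; try exact: integrableZr.
  by apply: eq_Rintegral => s _; rewrite mulNr.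
apply: (Rcvg_unique (@coef_norm R (v t))); under eq_cvg do rewrite eqN.
apply: cvgD; first exact: coef_norm.
by apply: cvgD; apply: cvgMr.
Qed.


Lemma small_factor (a e : R) : 0 <= a -> 0 < e -> exists2 d, 0 < d & a * d <= e.
Proof.
move=> a0 e0; have a1 : 0 < a + 1 by rewrite ltr_wpDl.
exists (e / (a + 1)); first exact: divr_gt0.
by rewrite mulrA ler_pdivrMr// mulrC ler_wpM2l ?(ltW e0)// lerDl.
Qed.

Variables (q b c1 : R) (u : R -> R).
Hypotheses (hb : b != 0) (hc1 : 0 < c1) (uW : in_W u).
Variables (w what : R -> L2 R) (zeta : R -> R).
Hypothesis hl : closed_loop q b c1 u w what zeta.

Let u2 : locally_sqint u := in_W_locally_sqint uW.
Let e := error w what.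
Let r := mismatch w what.
Let z t := b * zeta t - 1.
Let Y t := L2norm (e t) ^+ 2.
Let V t := Y t + `|b|^-1 * z t ^+ 2.
Let F t := 2 * L2norm (deriv1 (e t)) ^+ 2 + 2 * c1 * r t ^+ 2.
Let nb0 : 0 < `|b|. Proof. by rewrite normr_gt0. Qed.

Let r2 : locally_sqint r. Proof. exact: mismatch_sqint hl. Qed.

Lemma gain_ac T : 0 <= T -> ac T (fun t => - `|b| * r t * u t) z.
Proof.
move=> T0; apply: eq_ac (ac_add (ac_scale b (loop_zeta_ac hl T0)) (ac_cst T (-1))) _ _ => t _ //=.
rewrite /r addr0 normrEsg; ring.
Qed.

Lemma gain_input_sqint : locally_sqint (fun t => z t * u t).
Proof. exact: locally_sqint_ac_mul gain_ac u2. Qed.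

Lemma error_energy_ac T : 0 <= T -> ac T (fun t => - F t + 2 * (z t * u t * r t)) Y.
Proof.
move=> T0.
have g2 := error_input_sqint u2 hl T0.
have h := heat_energy_ac T0 g2 (error_modes hl T0).
have H1i := H1norm_integrable T0 (@locally_sqint0 R T T0) g2 (error_modes hl T0).
have D1 : mu.-integrable (itv0 T) (EFin \o (fun t => L2norm (deriv1 (e t)) ^+ 2)).
  apply: integrable_le H1i => //.
    by apply: measurable_deriv_sqr => // n; exact: measurable_coef (error_modes hl T0) n.
  by move=> t _; rewrite ger0_norm ?sqr_ge0// H1norm_sqr lerDr sqr_ge0.
apply: (eq_ac_ae T0 h).
  rewrite (_ : (fun t => - _ + _) = fun t =>
    (-2 * L2norm (deriv1 (e t)) ^+ 2 + - (2 * c1) * r t ^+ 2) + 2 * (z t * u t * r t)); last first.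
    apply/funext => t; rewrite /F; move: (L2norm _) => D; ring.
  apply: integrableDr => //.
    by apply: integrableDr => //; apply: integrableZr => //; exact: (r2 T0).2.
  by apply: integrableZr => //; apply: sqint_mul => //; [exact: gain_input_sqint|exact: r2].
apply: ae_imply1 (error_trace_ae u2 hl T0) => t ht tT; rewrite ht// -/(r t).
rewrite /error_input -/(r t) /F -/(e t) /z.
move: (L2norm (deriv1 (e t)) ^+ 2) => D; ring.
Qed.

(** The term [2 z u r] of the energy balance cancels against the derivative of [z^2 / |b|], because
    [sgn b] in the adaptation law turns [b] into [|b|]. *)
Lemma lyapunov_ac T : 0 <= T -> ac T (fun t => - F t) V.
Proof.
move=> T0; have az := gain_ac T0.
apply: eq_ac (ac_add (error_energy_ac T0) (ac_scale `|b|^-1 (ac_mul T0 az az))) _ _ => t _ //=.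
rewrite -addrA -[RHS]addr0; congr (_ + _).
by move: (r t) (z t) (u t) => x y v; field; rewrite gt_eqF.
Qed.

Lemma F_ge0 t : 0 <= F t.
Proof. by rewrite addr_ge0// mulr_ge0 ?sqr_ge0// mulr_ge0// ltW. Qed.

Lemma V_ge0 t : 0 <= V t.
Proof. by rewrite addr_ge0 ?sqr_ge0// mulr_ge0 ?sqr_ge0// invr_ge0. Qed.

Lemma F_integrable s t : 0 <= s -> s <= t -> mu.-integrable `[s, t] (EFin \o F).
Proof.
move=> s0 st; have [h _] := lyapunov_ac (le_trans s0 st).
apply: (@integrable_itvS _ _ 0 t) => //.
rewrite (_ : F = fun x => -1 * - F x); first exact: integrableZr.
by apply/funext => x; rewrite mulN1r opprK.
Qed.

Lemma dissipation s t : 0 <= s -> s <= t -> \int[mu]_(x in `[s, t]) F x = V s - V t.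
Proof.
move=> s0 st; rewrite -opprB (ac_incr (lyapunov_ac (le_trans s0 st)))//.
rewrite -mulN1r -RintegralZl//.
  by apply: eq_Rintegral => x _; rewrite mulN1r opprK.
have [h _] := lyapunov_ac (le_trans s0 st); exact: integrable_itvS h.
Qed.

Lemma V_decr s t : 0 <= s -> s <= t -> V t <= V s.
Proof.
move=> s0 st; rewrite -subr_ge0 -dissipation//.
by apply: Rintegral_ge0 => // x _; exact: F_ge0.
Qed.

Lemma V_tends : exists L, tends V L.
Proof.
pose A := [set V t | t in [set t : R | 0 <= t]].
have A0 : A !=set0 by exists (V 0), 0 => /=.
have lb : lbound A 0 by move=> _ [t _ <-]; exact: V_ge0.
have hi : has_inf A by split=> //; exists 0.
exists (inf A) => d d0; have [_ [s s0 <-] Vs] := inf_adherent d0 hi.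
exists s => // t st; rewrite ger0_norm ?subr_ge0.
  by rewrite lerBlDl (le_trans (V_decr s0 st))// ltW.
by apply: ge_inf; [exists 0|exists t => //=; exact: le_trans st].
Qed.

(** The dissipation over a window of length [tau] is this drop, so every quantity bounded by it dies
    out. *)
Lemma drop_tends tau : 0 <= tau -> tends (fun t => V t - V (t + tau)) 0.
Proof.
move=> tau0; have [L hL] := V_tends; rewrite -(subrr L) -mulN1r.
apply: (eq_tends (f := fun t => V t + -1 * V (t + tau))).
  by move=> t _; rewrite mulN1r.
apply: tendsD => //; apply: tendsZ => d d0; have [M M0 hM] := hL d d0.
by exists M => // t Mt; apply: hM; rewrite (le_trans Mt)// lerDl.
Qed.

Lemma mismatch_int s t : 0 <= s -> s <= t ->
  \int[mu]_(x in `[s, t]) (r x ^+ 2) <= (2 * c1)^-1 * (V s - V t).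
Proof.
move=> s0 st; rewrite -dissipation// -RintegralZl//; last exact: F_integrable.
have c2 : 0 < 2 * c1 by rewrite mulr_gt0.
apply: le_Rintegral => //.
- by apply: (@integrable_itvS _ _ 0 t) => //; exact: (r2 (le_trans s0 st)).2.
- by apply: integrableZr => //; exact: F_integrable.
- by move=> x _; rewrite ler_pdivlMl// /F lerDr mulr_ge0 ?sqr_ge0.
Qed.

Lemma cross_int C s t : 0 <= s -> s <= t ->
  \int[mu]_(x in `[s, t]) (u x ^+ 2) <= C ->
  (\int[mu]_(x in `[s, t]) (`|u x| * `|r x|)) ^+ 2 <= C * ((2 * c1)^-1 * (V s - V t)).
Proof.
move=> s0 st uC; have t0 := le_trans s0 st.
have absS g : sqint mu (itv0 t) g -> sqint mu `[s, t] (fun x => `|g x|).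
  move=> g2; have gs := sqint_itvS s0 (lexx t) g2; apply: sqint_le (gs) => //.
    by apply: measurableT_comp => //; exact: gs.1.
  by move=> x _; rewrite normr_id.
have := @cauchy_schwarz _ (measurableTypeR R) R mu _ _ _ (measurable_itv _)
  (absS _ (u2 t0)) (absS _ (r2 t0)).
move/le_trans; apply.
have sq g : \int[mu]_(x in `[s, t]) (`|g x| ^+ 2) = \int[mu]_(x in `[s, t]) (g x ^+ 2).
  by apply: eq_Rintegral => x _; rewrite real_normK ?num_real.
rewrite !sq; apply: ler_pM => //; last exact: mismatch_int.
  by apply: Rintegral_ge0 => x _; exact: sqr_ge0.
by apply: Rintegral_ge0 => x _; exact: sqr_ge0.
Qed.

Lemma gain_bounded : exists2 Z, 0 <= Z & forall t, 0 <= t -> `|z t| <= Z.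
Proof.
exists (Num.sqrt (`|b| * V 0)); first exact: sqrtr_ge0.
move=> t t0; rewrite -sqrtr_sqr ler_sqrt ?mulr_ge0 ?V_ge0//.
rewrite -ler_pdivrMl//; apply: le_trans (V_decr (lexx 0) t0).
by rewrite /V lerDr sqr_ge0.
Qed.

Lemma error_H1_ae T : 0 <= T -> {ae mu, forall t, itv0 T t -> is_H1 (e t)}.
Proof.
by move=> T0; exact: heat_H1_ae T0 (@locally_sqint0 R T T0) (error_input_sqint u2 hl T0) (error_modes hl T0).
Qed.

(** Poincare's inequality bounds the energy by the dissipation; average over
    [s, s + 1] the energy inequality between [x] and [s + 1]. *)
Lemma error_tends : tends Y 0.
Proof.
have [Z Z0 hZ] := gain_bounded; have [C C0 hC] := in_W_uniform uW.
pose B s := \int[mu]_(x in `[s, s + 1]) (`|u x| * `|r x|).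
have Bt : tends B 0.
  apply: tends_sqr; apply: (tends_squeeze (g := fun s => C * 2 * (2 * c1)^-1 * (V s - V (s + 1)))).
    move=> s s0; have s1 : s <= s + 1 by rewrite lerDl.
    rewrite ger0_norm ?sqr_ge0// -mulrA; apply: cross_int => //.
    by have := hC s (s + 1) s0 s1; rewrite addrAC subrr add0r.
  by rewrite -[X in tends _ X](mulr0 (C * 2 * (2 * c1)^-1)); apply: tendsZ; exact: drop_tends.
(* [L2norm_le_trace] bounds [Y] by [2 r^2] plus [17] times the squared derivative; in [F] these come
   with coefficients [2 c1] and [2]. *)
pose K := 17 / 2 + c1^-1; have K0 : 0 <= K by rewrite addr_ge0 ?divr_ge0// invr_ge0 ltW.
apply: (tends_shift (a := 1)) => //.
apply: (tends_squeeze (g := fun s => K * (V s - V (s + 1)) + 2 * Z * B s)); last first.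
  rewrite -[X in tends _ X](addr0 0); apply: tendsD.
    by rewrite -[X in tends _ X](mulr0 K); apply: tendsZ; exact: drop_tends.
  by rewrite -[X in tends _ X](mulr0 (2 * Z)); apply: tendsZ.
move=> s s0; have s1 : s <= s + 1 by rewrite lerDl.
have t0 : 0 <= s + 1 by exact: le_trans s1.
rewrite ger0_norm ?sqr_ge0//.
have ur1 : mu.-integrable `[s, s + 1] (EFin \o (fun x => `|u x| * `|r x|)).
  have ur : mu.-integrable (itv0 (s + 1)) (EFin \o (fun x => u x * r x)).
    by apply: sqint_mul => //; [exact: u2|exact: r2].
  apply: (@integrable_itvS _ _ 0 (s + 1)) => //.
  rewrite (_ : (fun x => _) = fun x => `|u x * r x|); first exact: integrable_norm.
  by apply/funext => x; rewrite normrM.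
have acY := error_energy_ac t0.
(* Between [x] and [s + 1] the dissipation is discarded and the gain is replaced by its bound
   [Z]. *)
have step x : s <= x <= s + 1 -> Y (s + 1) <= Y x + 2 * Z * B s.
  move=> /andP[sx xs]; have x0 := le_trans s0 sx.
  rewrite -lerBlDl (ac_incr acY)//.
  have urx : mu.-integrable `[x, s + 1] (EFin \o (fun x => `|u x| * `|r x|)).
    exact: integrable_itvS ur1.
  apply: (@le_trans _ _ (\int[mu]_(y in `[x, s + 1]) (2 * Z * (`|u y| * `|r y|)))).
    apply: le_Rintegral => //.
    - exact: integrable_itvS acY.1.
    - exact: integrableZr.
    - move=> y; rewrite /= in_itv/= => /andP[xy _]; have y0 := le_trans x0 xy.
      have zZ := hZ y y0; have f0 := F_ge0 y.
      apply: (@le_trans _ _ (2 * (z y * u y * r y))); first by rewrite addrC gerBl.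
      rewrite -[leRHS]mulrA ler_wpM2l// (le_trans (ler_norm _))// !normrM -mulrA.
      by rewrite ler_wpM2r// mulr_ge0.
  rewrite RintegralZl// ler_wpM2l ?mulr_ge0//.
  apply: le_Rintegral_subset => //.
  by apply: subset_itv; rewrite bnd_simp.
have m1 : fine (mu (`[s, s + 1]%classic)) = 1.
  by rewrite lebesgue_measure_itv/= lte_fin ltrDl ltr01 -EFinB/= addrAC subrr add0r.
have cstI (k : R) : \int[mu]_(x in `[s, s + 1]) k = k by rewrite Rintegral_cst// m1 mulr1.
have cst1 (k : R) : mu.-integrable `[s, s + 1] (EFin \o (fun=> k)).
  by apply: (itv_bounded_integrable (M := `|k|)).
have Y1 : mu.-integrable `[s, s + 1] (EFin \o Y).
  have [M _ hM] := ac_bounded t0 acY; apply: (@integrable_itvS _ _ 0 (s + 1)) => //.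
  by apply: (itv_bounded_integrable (M := M)) => //; exact: ac_measurable acY.
rewrite -[Y (s + 1)]cstI; apply: (@le_trans _ _ (\int[mu]_(x in `[s, s + 1]) (Y x + 2 * Z * B s))).
  by apply: le_Rintegral => //; exact: integrableDr.
rewrite RintegralD// cstI lerD2r -dissipation// -RintegralZl//; last exact: F_integrable.
apply: le_Rintegral_ae => //; first by apply: integrableZr => //; exact: F_integrable.
apply: (ae_imply2 _ (error_H1_ae t0) (error_trace_ae u2 hl t0)) => x Hx tx.
rewrite /= in_itv/= => /andP[sx xs].
have xi : itv0 (s + 1) x by rewrite /= in_itv/= (le_trans s0 sx).
have := L2norm_le_trace (or_intror erefl) (Hx xi); rewrite tx// -/(r x) -/(e x) -/(Y x).
move/le_trans; apply; rewrite /F /K; move: (L2norm _ ^+ 2) (sqr_ge0 (L2norm (deriv1 (e x)))) => D D0.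
have c0 : 0 <= c1^-1 * D by rewrite mulr_ge0// invr_ge0 ltW.
have cr : c1^-1 * (c1 * r x ^+ 2) = r x ^+ 2 by rewrite mulKf// gt_eqF.
have cp : 0 <= c1 * r x ^+ 2 by rewrite mulr_ge0 ?sqr_ge0// ltW.
by rewrite mulrDl !mulrDr; lra.
Qed.

Lemma gain_tends : exists m, tends z m.
Proof.
have [L hL] := V_tends.
apply: (@tends_of_sqr R z (`|b| * L)).
  by move=> T T0; exact: ac_continuous (gain_ac T0).
have : tends (fun t => `|b| * (V t + -1 * Y t)) (`|b| * (L + -1 * 0)).
  by apply: tendsZ; apply: tendsD => //; apply: tendsZ; exact: error_tends.
rewrite mulr0 addr0; apply: eq_tends => t _.
by rewrite /V mulN1r addrAC subrr add0r mulVKf// gt_eqF.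
Qed.

(** The mean of the error satisfies [c' = u z - c1 r]. *)
Lemma input_tends m tau : 0 <= tau -> tends z m -> m != 0 ->
  tends (fun t => \int[mu]_(s in `[t, t + tau]) u s) 0.
Proof.
move=> tau0 hz m0.
have [C C0 hC] := in_W_uniform uW.
have tt t : t <= t + tau by rewrite lerDl.
pose a t := coef (e t) 0.
have ha : tends a 0.
  apply: tends_sqr; apply: (tends_squeeze (g := Y)); last exact: error_tends.
  move=> t _; rewrite ger0_norm ?sqr_ge0// -(real_normK (num_real _)).
  by rewrite lerXn2r ?nnegrE ?L2norm_ge0// coef_le.
have hat : tends (fun t => a (t + tau)) 0.
  move=> d d0; have [M M0 hM] := ha d d0; exists M => // t Mt.
  by apply: hM; exact: le_trans (tt t).
have r1 t : 0 <= t -> mu.-integrable `[t, t + tau] (EFin \o r).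
  move=> t0; have t1 := le_trans t0 (tt t); apply: (@integrable_itvS _ _ 0 (t + tau)) => //.
  by apply: sqint_L1 (r2 t1) => //; exact: itv0_fin.
have u1 t : 0 <= t -> mu.-integrable `[t, t + tau] (EFin \o u).
  move=> t0; have t1 := le_trans t0 (tt t); apply: (@integrable_itvS _ _ 0 (t + tau)) => //.
  by apply: sqint_L1 (u2 t1) => //; exact: itv0_fin.
have cst1 (k : R) (t : R) : mu.-integrable `[t, t + tau] (EFin \o (fun=> k)).
  by apply: (itv_bounded_integrable (M := `|k|)).
have mtau t : fine (mu (`[t, t + tau]%classic)) = tau.
  rewrite lebesgue_measure_itv/= lte_fin ltrDl.
  move: tau0; rewrite le_eqVlt => /predU1P[<-|tp]; first by rewrite ltxx.
  by rewrite tp -EFinB/= addrAC subrr add0r.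
have hr : tends (fun t => \int[mu]_(s in `[t, t + tau]) r s) 0.
  apply: tends_sqr.
  apply: (tends_squeeze (g := fun t => tau * (2 * c1)^-1 * (V t - V (t + tau)))); last first.
    by rewrite -[X in tends _ X](mulr0 (tau * (2 * c1)^-1)); apply: tendsZ; exact: drop_tends.
  move=> t t0; rewrite ger0_norm ?sqr_ge0//.
  have one2 : sqint mu `[t, t + tau] (fun=> 1 : R).
    by split=> //; under eq_fun do rewrite expr1n; exact: cst1.
  have rt2 := sqint_itvS t0 (lexx _) (r2 (le_trans t0 (tt t))).
  have := @cauchy_schwarz _ (measurableTypeR R) R mu _ _ _ (measurable_itv _) one2 rt2.
  under eq_Rintegral do rewrite mul1r.
  move/le_trans; apply; rewrite -mulrA; apply: ler_pM => //.
  - by apply: Rintegral_ge0 => x _; exact: sqr_ge0.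
  - by apply: Rintegral_ge0 => x _; exact: sqr_ge0.
  - under eq_Rintegral do rewrite expr1n.
    by rewrite Rintegral_cst// mul1r mtau.
  - exact: mismatch_int.
pose E t := \int[mu]_(s in `[t, t + tau]) ((z s - m) * u s).
have zu1 t : 0 <= t -> mu.-integrable `[t, t + tau] (EFin \o (fun s => z s * u s)).
  move=> t0; have t1 := le_trans t0 (tt t); apply: (@integrable_itvS _ _ 0 (t + tau)) => //.
  by apply: sqint_L1 (gain_input_sqint t1) => //; exact: itv0_fin.
have Ei t : 0 <= t -> mu.-integrable `[t, t + tau] (EFin \o (fun s => (z s - m) * u s)).
  move=> t0; rewrite (_ : (fun s => _) = fun s => z s * u s - m * u s).
    by apply: integrableBr => //; [exact: zu1|apply: integrableZr => //; exact: u1].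
  by apply/funext => s; rewrite mulrBl.
(* [|u| <= 1 + u^2] has bounded integral over windows of length [tau], so replacing [z] by its limit
   [m] costs a constant times the largest [|z - m|]. *)
have hE : tends E 0.
  move=> d d0.
  have [dd dd0 hdd] := small_factor (addr_ge0 tau0 (mulr_ge0 C0 (addr_ge0 ler01 tau0))) d0.
  have [M M0 hM] := hz dd dd0; exists M => // t Mt; have t0 := le_trans M0 Mt.
  rewrite subr0; apply: le_trans hdd.
  have := @le_normr_Rintegral _ (measurableTypeR R) R mu _ _ (measurable_itv _) (Ei t t0); move/le_trans; apply.
  have us1 : mu.-integrable `[t, t + tau] (EFin \o (fun s => u s ^+ 2)).
    by apply: (@integrable_itvS _ _ 0 (t + tau)) => //; exact: (u2 (le_trans t0 (tt t))).2.
  apply: (@le_trans _ _ (\int[mu]_(s in `[t, t + tau]) (dd * (1 + u s ^+ 2)))).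
    apply: le_Rintegral => //.
    - by apply: integrable_norm => //; exact: Ei.
    - by apply: integrableZr => //; exact: integrableDr.
    - move=> s; rewrite /= in_itv/= => /andP[ts _].
      rewrite normrM ler_pM// ?hM// ?(le_trans Mt)//.
      rewrite -(real_normK (num_real (u s))).
      by have := sqr_ge0 (`|u s| - 1); have := normr_ge0 (u s); nra.
  rewrite RintegralZl//; last exact: integrableDr.
  rewrite mulrC ler_wpM2r ?(ltW dd0)// RintegralD// Rintegral_cst// mul1r mtau lerD2l.
  by have := hC t (t + tau) t0 (tt t); rewrite addrAC subrr add0r.
(* Mode [0] has eigenvalue [0], so its equation integrates over the window with no decay term. *)
have main t : 0 <= t -> a (t + tau) + -1 * a t + -1 * E t +
    c1 * \int[mu]_(s in `[t, t + tau]) r s = m * \int[mu]_(s in `[t, t + tau]) u s.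
  move=> t0; have t1 := le_trans t0 (tt t).
  have := ac_incr (error_modes hl t1 0%N) t0 (tt t) (lexx _); rewrite -/(a t) -/(a (t + tau)).
  have -> : \int[mu]_(s in `[t, t + tau]) (- lam R 0 * coef (error w what s) 0 +
      (error_input b c1 u w what zeta s * cosmode 0 1 - 0 * cosmode 0 0)) =
      \int[mu]_(s in `[t, t + tau]) ((z s - m) * u s + m * u s - c1 * r s).
    apply: eq_Rintegral => s _; rewrite lam0 oppr0 !mul0r add0r subr0.
    have -> : @cosmode R 0 1 = 1 by rewrite /cosmode /amp/= !mul0r cos0 mulr1.
    by rewrite mulr1 /error_input -/(r s) /z; ring.
  rewrite RintegralB//; last 2 first.
  - by apply: integrableDr => //; [exact: Ei|apply: integrableZr => //; exact: u1].
  - by apply: integrableZr => //; exact: r1.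
  rewrite RintegralD//; last 2 first.
  - exact: Ei.
  - by apply: integrableZr => //; exact: u1.
  rewrite RintegralZl//; last by first [exact: u1|exact: r1].
  rewrite RintegralZl//; last by first [exact: u1|exact: r1].
  by rewrite -/(E t) => h; rewrite mulN1r h; ring.
have : tends (fun t => m^-1 * (a (t + tau) + -1 * a t + -1 * E t +
    c1 * \int[mu]_(s in `[t, t + tau]) r s)) (m^-1 * (0 + -1 * 0 + -1 * 0 + c1 * 0)).
  apply: tendsZ; apply: tendsD; last exact: tendsZ.
  by apply: tendsD; [apply: tendsD => //; exact: tendsZ|exact: tendsZ].
rewrite !mulr0 !addr0 mulr0; apply: eq_tends => t t0.
by rewrite main// mulKf.
Qed.

(** The limit of [zeta] is [(m + 1) / b]. A nonzero [m] would make all windowed integrals of [u]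
    tend to [0], so persistent excitation leaves only [m = 0]. *)
Lemma closed_loop_stable :
  (exists zeta0, `|zeta t - zeta0| + L2norm (w t - what t) @[t --> +oo] --> (0 : R)) /\
  (persistently_exciting u -> zeta t @[t --> +oo] --> b^-1).
Proof.
have [m hm] := gain_tends.
have hzeta : tends zeta (b^-1 * (m + 1)).
  have : tends (fun t => b^-1 * (z t + 1)) (b^-1 * (m + 1)).
    by apply: tendsZ; apply: tendsD => //; exact: tends_cst.
  by apply: eq_tends => t _; rewrite /z subrK mulKf.
split.
  exists (b^-1 * (m + 1)); apply: tends_cvg; rewrite -[X in tends _ X](addr0 0).
  apply: tendsD; last by apply: tends_sqr; exact: error_tends.
  move=> d d0; have [M M0 hM] := hzeta d d0; exists M => // t Mt.
  by rewrite subr0 normr_id; exact: hM.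
move=> [tau tau0 hPE]; have [m0|m0] := eqVneq m 0.
  by apply: tends_cvg; move: hzeta; rewrite m0 add0r mulr1.
exfalso; apply: hPE; apply: tends_cvg; exact: (input_tends (ltW tau0) hm m0).
Qed.

End stability.

Unset Implicit Arguments.

Theorem theorem2p1 (R : realType) (q b c1 : R) (u0 : R -> R)
    (hq : 0 < q) (hb : b != 0) (hc1 : 0 < c1) (hu0 : in_W u0)
    (w_init what_init : L2 R) (zeta_init : R) :
  exists (w what : R -> L2 R) (zeta : R -> R),
    [/\ closed_loop q b c1 u0 w what zeta
          /\ initial_state w_init what_init zeta_init w what zeta,
        forall (w' what' : R -> L2 R) (zeta' : R -> R),
          closed_loop q b c1 u0 w' what' zeta' ->
          initial_state w_init what_init zeta_init w' what' zeta' ->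
          forall t, 0 <= t ->
            [/\ w' t =L2 w t, what' t =L2 what t & zeta' t = zeta t],
        exists zeta0 : R,
          `|zeta t - zeta0| + L2norm (w t - what t) @[t --> +oo] --> (0 : R)
      & persistently_exciting u0 -> zeta t @[t --> +oo] --> b^-1].
Proof.
have u2 := in_W_locally_sqint hu0.
have [w [what [zeta [hl hi]]]] := closed_loop_exists q b c1 u2 w_init what_init zeta_init.
have [stable PE] := closed_loop_stable hb hc1 hu0 hl.
exists w, what, zeta; split => // w' what' zeta' hl' hi' t t0.
exact: (closed_loop_unique u2 hl hl' hi hi').
Qed.
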